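(* Let $n\ge 1$, $\gamma\in\mathbb{R}$, $\alpha>1$, $s\in\mathbb{R}$, $q\in[1,\infty]$, $r\in(0,\infty]$ and $T>0$. Assume $$\gamma>-\min(2,n),\qquad \alpha\ge \max\Big(1,1+\frac{\gamma}{n}\Big),\qquad \frac{\gamma}{\alpha-1}\le s\le n,\qquad \alpha\le q\le\infty,\qquad 0<r\le\infty,$$ and assume moreover the exponent conditions $$\text{(a) either } \frac sn+\frac1q>0, \text{ or } \frac sn+\frac1q=0 \text{ and } r=\infty;\qquad \text{(b) either } \frac sn+\frac1q<1, \text{ or } \frac sn+\frac1q=1 \text{ and } r\le1.$$ Put $q_c=\frac{n(\alpha-1)}{2+\gamma}$ and $Q_c=\frac{n\alpha}{n+\gamma}$. Suppose that either (i) $\frac sn+\frac1q<\min\big(\frac1{q_c},\frac1{Q_c}\big)$, or (ii) $\frac sn+\frac1q=\frac1{Q_c}<\frac1{q_c}$ and $r\le\alpha$. Then solutions of the Hardy–Hénon parabolic equation in $L^\infty(0,T;\dot K^s_{q,r}(\mathbb{R}^n))$ are unique: if $u_1,u_2\in L^\infty(0,T;\dot K^s_{q,r}(\mathbb{R}^n))$ are both solutions with the same initial datum $u_0$, then $u_1(t)=u_2(t)$ for almost every $t\in(0,T)$.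
   Context: For $j\in\mathbb{Z}$ let $A_j=\{x\in\mathbb{R}^n: 2^{j-1}\le|x|<2^j\}$. For $s\in\mathbb{R}$ and $0<q,r\le\infty$, the homogeneous Herz space $\dot K^s_{q,r}(\mathbb{R}^n)$ is the space of measurable $f$ with finite quasi-norm $\|f\|_{\dot K^s_{q,r}}=\big(\sum_{j\in\mathbb{Z}}[2^{js}\|f\chi_{A_j}\|_{L^q}]^r\big)^{1/r}$ (with the usual supremum modification if $r=\infty$). The heat semigroup is $e^{t\Delta}f(x)=(4\pi t)^{-n/2}\int_{\mathbb{R}^n}e^{-|x-y|^2/(4t)}f(y)\,dy$. The Hardy–Hénon parabolic equation is $\partial_t u-\Delta u=|x|^\gamma|u|^{\alpha-1}u$ on $(0,\infty)\times\mathbb{R}^n$, $u(0)=u_0$; a solution on $(0,T)$ with initial datum $u_0$ means a function $u$ satisfying the Duhamel integral equation $u(t)=e^{t\Delta}u_0+\int_0^t e^{(t-\tau)\Delta}\big[|\cdot|^\gamma|u(\tau)|^{\alpha-1}u(\tau)\big]\,d\tau$ for $t\in(0,T)$. *)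

(* Defs.v *)
From HB Require Import structures.
From mathcomp Require Import all_boot all_order all_algebra.
From mathcomp Require Import all_classical all_reals all_analysis.
Set Implicit Arguments.

Unset Strict Implicit.
Unset Printing Implicit Defensive.
Import Order.TTheory GRing.Theory Num.Theory.
Import numFieldNormedType.Exports.
Local Open Scope classical_set_scope.
Local Open Scope ring_scope.

Section HardyHenon.
Context {R : realType}.

Definition enorm (n : nat) (x : 'rV[R]_n) : R := Num.sqrt (\sum_(i < n) x 0 i ^+ 2).

(** Borel sigma-algebra on R^n = sigma-algebra generated by the coordinate maps. *)
Definition coord_sets (n : nat) : set (set 'rV[R]_n) :=
  [set A | exists (i : 'I_n) (B : set R), measurable B /\
           A = (fun x : 'rV[R]_n => x 0 i) @^-1` B].

Definition Rn (n : nat) := g_sigma_algebraType (@coord_sets n).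

(** Iterated Lebesgue integral over R^k (Tonelli: for nonnegative Borel
    functions this is the integral against n-dimensional Lebesgue measure). *)
Fixpoint iint (k : nat) (f : seq R -> \bar R) : \bar R :=
  match k with
  | 0 => f [::]
  | k'.+1 => (\int[@lebesgue_measure R]_x iint k' (fun s => f (x :: s)))%E
  end.

Definition vec_of_seq (n : nat) (s : seq R) : 'rV[R]_n := \row_(i < n) nth 0 s i.

Definition lebint (n : nat) (g : 'rV[R]_n -> \bar R) : \bar R :=
  iint n (fun s => g (vec_of_seq n s)).

Definition lebm (n : nat) (A : set 'rV[R]_n) : \bar R :=
  lebint (fun x => (\1_A x)%:E).

(** Signed Lebesgue integral over R^n: integral of positive part minus
    integral of negative part (same convention as mathcomp's \int). *)
Definition slebint (n : nat) (g : 'rV[R]_n -> R) : \bar R :=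
  (lebint (fun x => (Num.max (g x) 0)%:E) - lebint (fun x => (Num.max (- g x) 0)%:E))%E.

Definition lq_norm (n : nat) (q : \bar R) (f : 'rV[R]_n -> R) : \bar R :=
  match q with
  | q'%:E => poweR (lebint (fun x => (`|f x| `^ q')%:E)) q'^-1
  | +oo%E => ereal_inf [set M : \bar R | lebm [set x | (M < (`|f x|)%:E)%E] = 0%E]
  | -oo%E => 0%E
  end.

Definition annulus (n : nat) (j : int) : set 'rV[R]_n :=
  [set x | 2 `^ (j%:~R - 1) <= enorm x < 2 `^ j%:~R].

Definition herz_norm (n : nat) (s : R) (q r : \bar R) (f : 'rV[R]_n -> R) : \bar R :=
  let a := fun j : int =>
    ((2 `^ (j%:~R * s))%:E * lq_norm q (fun x => (f x * \1_(@annulus n j) x)%R))%E in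
  match r with
  | r'%:E => poweR (\esum_(j in [set: int]) poweR (a j) r') r'^-1
  | +oo%E => ereal_sup (range a)
  | -oo%E => 0%E
  end.

Definition einv (q : \bar R) : R :=
  match q with q'%:E => q'^-1 | _ => 0 end.

Definition heat_kernel (n : nat) (t : R) (x : 'rV[R]_n) : R :=
  (4 * pi * t) `^ (- (n%:R / 2)) * expR (- (enorm x ^+ 2) / (4 * t)).

Definition heat (n : nat) (t : R) (f : 'rV[R]_n -> R) (x : 'rV[R]_n) : \bar R :=
  slebint (fun y => heat_kernel t (x - y) * f y).

Definition nonlin (n : nat) (gamma alpha : R) (v : 'rV[R]_n -> R) (x : 'rV[R]_n) : R :=
  enorm x `^ gamma * (`|v x| `^ (alpha - 1) * v x).

Definition duhamel_solution (n : nat) (gamma alpha T : R)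
    (u0 : 'rV[R]_n -> R) (u : R -> 'rV[R]_n -> R) : Prop :=
  forall t, 0 < t < T ->
    lebm [set x | (u t x)%:E <>
      (heat t u0 x + \int[@lebesgue_measure R]_(tau in `]0%R, t[)
                        heat (t - tau) (nonlin gamma alpha (u tau)) x)%E] = 0%E.

Definition in_Linf_herz (n : nat) (s : R) (q r : \bar R) (T : R)
    (u : R -> 'rV[R]_n -> R) : Prop :=
  measurable_fun [set: (R * Rn n)%type] (fun p : (R * Rn n)%type => u p.1 p.2) /\
  exists M : R, {ae @lebesgue_measure R, forall t, 0 < t < T ->
                  (herz_norm s q r (u t) <= M%:E)%E}.

End HardyHenon.

(* Main.v *)
(* Both solutions satisfy, for almost all (t, x),
     |u1 - u2|(t) <= int_0^t e^{(t-tau)Delta} g(tau) dtau,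
   with g = |x|^gamma | |u1|^(alpha-1) u1 - |u2|^(alpha-1) u2 | <= V |u1 - u2| and
   V = C |x|^gamma (|u1|^(alpha-1) + |u2|^(alpha-1)), hence g <= V int_0^t e^{(t-tau)Delta} g.
   Integrate this against phi(t,x) = exp(-lam t - (1+t)|x|_1).  The decay of phi increases
   with t, which leaves a factor exp(-(t-tau)|x|_1) to spend on the growth of V at infinity,
   and the Herz bound gives
     int V(t,x) exp(-sigma |x|_1) K_{2 sigma}(x-y) dx <= C sigma^-beta   with beta < 1,
   because (alpha-1)(s + n/q) - gamma < min(2,n).  Thus Theta := int int g phi satisfies
   Theta <= C (int_0^T sigma^-beta e^{-lam sigma} dsigma) Theta <= Theta/2 for lam large;
   Theta is finite since alpha (s + n/q) <= n + gamma (with r <= alpha in the case of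
   equality), so Theta = 0 and g = 0, whence u1 = u2. *)

Require Import Defs.
From HB Require Import structures.
From mathcomp Require Import all_boot all_order all_algebra.
From mathcomp Require Import all_classical all_reals all_analysis.
From mathcomp Require Import measurable_realfun.
From mathcomp Require Import ring lra.
Set Implicit Arguments.
Unset Strict Implicit.
Unset Printing Implicit Defensive.
Import Order.TTheory GRing.Theory Num.Theory.
Import numFieldNormedType.Exports.
Local Open Scope classical_set_scope.
Local Open Scope ring_scope.

(** The inequality is run on g rather than on u1 - u2 because the Herz bounds control g directly: it
    is at most |x|^gamma (|u1|^alpha + |u2|^alpha), whose weighted integral the condition on Q_c
    makes finite. As lam may depend on T, one absorption covers all of (0,T), with no short time
    steps and no mapping property of the heat semigroup between Herz spaces. The other obstacle is
    measurability. Integrals over R^n are iterated one-dimensional integrals and u0 is an arbitrary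
    function, so e^{t Delta} u0 is a priori a difference of two iterated lower integrals, and the
    Duhamel identity holds off a set that is null only in that sense. Before two such identities are
    subtracted, this term is shown to agree almost everywhere, for almost every t, with a measurable
    function of x; monotonicity in t of the unnormalised Gaussian integral makes this possible.
    Subtraction is then legitimate because the left side is real, which forces each term on the
    right to be finite. *)

(** * Lebesgue measure on R^n from iterated integrals *)

Section rn_measure.
Context {R : realType}.
Notation leb := (@lebesgue_measure R).

Lemma measurable_coord (n : nat) (i : 'I_n) :
  measurable_fun [set: @Rn R n] (fun x : Rn n => (x : 'rV[R]_n) 0 i).
Proof.
move=> _ B mB; rewrite setTI; apply: sub_sigma_algebra.
by exists i, B; split.
Qed.

Lemma measurable_fun_Rn d (X : measurableType d) (n : nat) (f : X -> @Rn R n) :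
  (forall i, measurable_fun setT (fun x => (f x : 'rV[R]_n) 0 i)) ->
  measurable_fun setT f.
Proof.
move=> mf; apply: (@measurability _ _ X (Rn n) setT f (coord_sets (n:=n))) => //.
move=> _ [_ [i [B [mB ->]]] <-]; rewrite setTI.
by rewrite -[X in measurable X]setTI; exact: mf.
Qed.

(** [iint] integrates the head of the list outermost, so R^(n+1) is identified with the first
    coordinate times the remaining ones. *)
Definition consv (n : nat) (p : R * @Rn R n) : @Rn R n.+1 :=
  \row_(i < n.+1) (if unlift ord0 i is Some j then (p.2 : 'rV[R]_n) 0 j else p.1).

Definition uncons (n : nat) (x : @Rn R n.+1) : R * @Rn R n :=
  ((x : 'rV[R]_n.+1) 0 ord0, \row_(j < n) (x : 'rV[R]_n.+1) 0 (lift ord0 j)).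

Lemma consvK (n : nat) : cancel (@consv n) (@uncons n).
Proof.
case=> a y; rewrite /uncons /consv mxE unlift_none; congr pair.
by apply/rowP => j; rewrite !mxE liftK.
Qed.

Lemma measurable_consv (n : nat) : measurable_fun setT (@consv n).
Proof.
apply: measurable_fun_Rn => i; rewrite /consv.
case: (unliftP ord0 i) => [j ->|->].
  under eq_fun do rewrite mxE liftK.
  exact: (measurableT_comp (measurable_coord j) measurable_snd).
by under eq_fun do rewrite mxE unlift_none; exact: measurable_fst.
Qed.

Lemma measurable_uncons (n : nat) : measurable_fun setT (@uncons n).
Proof.
apply: measurable_fun_pair; first exact: measurable_coord.
apply: measurable_fun_Rn => i.
by under eq_fun do rewrite mxE; exact: measurable_coord.
Qed.

Lemma vec_of_seq_cons (n : nat) (x : R) (s : seq R) :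
  vec_of_seq n.+1 (x :: s) = consv (x, vec_of_seq n s).
Proof.
apply/rowP => i; rewrite /consv !mxE; case: unliftP => [j ->|->] //=.
by rewrite mxE.
Qed.

Lemma lebint_cons (n : nat) (g : 'rV[R]_n.+1 -> \bar R) :
  lebint g = (\int[leb]_x lebint (fun y : 'rV[R]_n => g (consv (x, y))))%E.
Proof.
rewrite /lebint/=; apply: eq_integral => x _; congr iint.
by apply/funext => s; rewrite vec_of_seq_cons.
Qed.

(** Tonelli's theorem asks for a bundled sigma-finite measure; equality of integrals is enough to
    move between the bundled and the bare measure. *)
Lemma sigma_finite_pack d (X : measurableType d) (m : {measure set X -> \bar R}) :
  sigma_finite setT m ->
  exists m' : {sigma_finite_measure set X -> \bar R}, forall f, integral m' setT f = integral m setT f.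
Proof.
move=> sf.
pose H1 := isSFinite.Build _ _ _ m (sfinite_measure_sigma_finite sf).
pose H2 := isSigmaFinite.Build _ _ _ m sf.
by exists (HB.pack_for (SigmaFiniteMeasure.type X R) (Measure.sort m) H1 H2).
Qed.

Lemma sigma_finite_prod d1 d2 (X1 : measurableType d1) (X2 : measurableType d2)
    (m1 : {sigma_finite_measure set X1 -> \bar R})
    (m2 : {sigma_finite_measure set X2 -> \bar R}) :
  sigma_finite setT (m1 \x m2)%E.
Proof.
have /sigma_finiteP[F [TF ndF Foo]] := sigma_finiteT m1.
have /sigma_finiteP[G [TG ndG Goo]] := sigma_finiteT m2.
exists (fun k => F k `*` G k).
  rewrite -setXTT TF TG predeqE => -[x y]; split.
    move=> [/= [k _ Fkx] [l _ Gly]]; exists (maxn k l) => //; split.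
    - by move: x Fkx; exact/subsetPset/ndF/leq_maxl.
    - by move: y Gly; exact/subsetPset/ndG/leq_maxr.
  by move=> [k _ []/= ? ?]; split; exists k.
move=> k; have [? ?] := Foo k; have [? ?] := Goo k.
split; first exact: measurableX.
by rewrite product_measure1E// lte_mul_pinfty// ge0_fin_numE.
Qed.

(** Induction on the dimension: a Dirac mass at the empty vector, then the image of [leb \x mu]
    under [consv], whose integral Tonelli turns into the iterated one. This makes the convergence
    theorems available for [lebint] on measurable integrands. *)
Lemma Rn_measure_exists (n : nat) :
  exists mu : {sigma_finite_measure set (@Rn R n) -> \bar R},
  forall f : Rn n -> \bar R, measurable_fun [set: @Rn R n] f -> (forall x, 0 <= f x)%E ->
  @lebint R n f = integral mu setT f.
Proof.
elim: n => [|n [mu IH]].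
  exists (\d_(vec_of_seq 0 [::] : @Rn R 0)) => f mf f0.
  by rewrite integral_dirac// diracT mul1e.
(* An image of a sigma-finite measure need not be sigma-finite; here the covering sets are pulled
   back by the inverse [uncons]. *)
have nusf : sigma_finite setT (pushforward (leb \x mu)%E (@consv n)).
  have [F TF mF] := sigma_finite_prod leb mu.
  exists (fun k => (@uncons n) @^-1` F k).
    by rewrite -preimage_bigcup -TF preimage_setT.
  move=> k; have [mFk Foo] := mF k; split.
    by rewrite -[X in measurable X]setTI; exact: measurable_uncons.
  rewrite /pushforward -comp_preimage.
  have -> : (@uncons n) \o (@consv n) = id by apply/funext => p; exact: consvK.
  by rewrite preimage_id.
have /(_ (@measurable_consv n))[M ME] := @sigma_finite_pack _ _ (pushforward (leb \x mu)%E (@consv n)) nusf.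
exists M => f mf f0.
rewrite ME.
rewrite lebint_cons ge0_integral_pushforward//=.
rewrite preimage_setT fubini_tonelli1//; last first.
  by apply: measurableT_comp => //; exact: measurable_consv.
apply: eq_integral => x _; rewrite IH//.
apply: (measurableT_comp mf); apply: (measurableT_comp (@measurable_consv n)).
exact: pair1_measurable.
exact: measurable_consv.
Qed.

End rn_measure.

Section lebRn.
Context {R : realType}.
Notation leb := (@lebesgue_measure R).

Definition lebRn (n : nat) : {sigma_finite_measure set (@Rn R n) -> \bar R} :=
  projT1 (cid (@Rn_measure_exists R n)).

Lemma lebintE (n : nat) (f : Rn n -> \bar R) :
  measurable_fun [set: @Rn R n] f -> (forall x, 0 <= f x)%E ->
  @lebint R n f = (\int[lebRn n]_x f x)%E.
Proof. exact: (projT2 (cid (@Rn_measure_exists R n))). Qed.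

Lemma lebmE (n : nat) (A : set (Rn n)) : measurable A ->
  @lebm R n A = lebRn n A.
Proof.
move=> mA; rewrite /lebm lebintE ?integral_indic ?setIT//.
by apply/measurable_EFinP; exact: measurable_indic.
Qed.

(** Upper bounds suffice: the factors will be normal densities of mass one or indicators of
    intervals. *)
Lemma lebint_prod_le (n : nat) (f : 'I_n -> R -> R) (C : R) :
  (forall i, measurable_fun setT (f i)) -> (forall i x, 0 <= f i x) ->
  (forall i, \int[leb]_x (f i x)%:E <= C%:E)%E ->
  (@lebint R n (fun x => (\prod_(i < n) f i (x 0 i))%:E) <= (C ^+ n)%:E)%E.
Proof.
elim: n f => [|n IH] f mf f0 fC.
  by rewrite /lebint/= big_ord0 expr0.
have C0 : 0 <= C.
  rewrite -lee_fin (le_trans _ (fC ord0))//; apply: integral_ge0 => x _.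
  by rewrite lee_fin.
have mP : measurable_fun [set: @Rn R n]
    (fun y => \prod_(i < n) f (lift ord0 i) ((y : 'rV[R]_n) 0 i)).
  apply: measurable_prod => i _.
  by apply: (measurableT_comp (mf _)); exact: measurable_coord.
have P0 (y : @Rn R n) : 0 <= \prod_(i < n) f (lift ord0 i) ((y : 'rV[R]_n) 0 i).
  by apply: prodr_ge0.
rewrite lebint_cons.
rewrite (eq_integral (fun x : measurableTypeR R => (f ord0 x)%:E *
   lebint (fun y : 'rV[R]_n => (\prod_(i < n) f (lift ord0 i) (y 0 i))%:E)))%E; last first.
  move=> x _.
  rewrite (_ : (fun y => _) = (fun y : 'rV[R]_n =>
    (f ord0 x * \prod_(i < n) f (lift ord0 i) (y 0 i))%:E)); last first.
    apply/funext => y; rewrite big_ord_recl /consv mxE unlift_none/=.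
    congr (_ * _)%:E; apply: eq_bigr => i _; congr (f _ _).
    by rewrite mxE liftK.
  rewrite lebintE; [|by apply/measurable_EFinP; exact: measurable_funM|
    by move=> y; rewrite lee_fin mulr_ge0].
  rewrite lebintE; [|exact/measurable_EFinP|by []].
  under eq_integral do rewrite EFinM.
  rewrite ge0_integralZl_EFin//; last exact/measurable_EFinP.
  by move=> y _; rewrite lee_fin.
have mf0 : measurable_fun [set: measurableTypeR R] (fun x => (f ord0 x)%:E).
  by apply: (measurableT_comp (@EFin_measurable R setT)); exact: mf.
have J0 : (0 <= lebint (fun y : 'rV[R]_n =>
    (\prod_(i < n) f (lift ord0 i) (y 0 i))%:E))%E.
  rewrite lebintE; [|exact/measurable_EFinP|by []].
  by apply: integral_ge0 => y _; rewrite lee_fin.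
rewrite ge0_integralZr//; last by move=> x _; rewrite lee_fin.
rewrite exprS EFinM; apply: lee_pmul => //.
- by apply: integral_ge0 => y _; rewrite lee_fin.
- by apply: (IH (fun i => f (lift ord0 i))) => i; [exact: mf|exact: f0|exact: fC].
Qed.

(** The identity 1/y = y |y|^(-2) also holds at 0 with the convention 1/0 = 0, and reduces the claim
    to [powR]. *)
Lemma measurable_funV d (X : measurableType d) (f : X -> R) :
  measurable_fun setT f -> measurable_fun setT (fun x => (f x)^-1).
Proof.
move=> mf; have -> : (fun x => (f x)^-1) = (fun x => f x * (`|f x| `^ (-1)) ^+ 2).
  apply/funext => x; have [->|f0] := eqVneq (f x) 0; first by rewrite mul0r invr0.
  rewrite powRN powRr1// exprVn real_normK ?num_real// expr2 invfM mulrA divff//.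
  by rewrite mul1r.
apply: measurable_funM => //; apply: measurable_funX.
apply: (measurableT_comp (measurable_powR _)).
exact: (measurableT_comp (@normr_measurable R setT)).
Qed.

Lemma measurable_enorm (n : nat) : measurable_fun [set: @Rn R n] (@enorm R n).
Proof.
rewrite /enorm.
apply: (measurableT_comp (f := @Num.sqrt R)).
  exact: (continuous_measurable_fun (@sqrt_continuous R)).
apply: measurable_sum => i; apply: measurable_funX.
exact: measurable_coord.
Qed.

Lemma enorm_ge0 (n : nat) (x : 'rV[R]_n) : 0 <= enorm x.
Proof. exact: sqrtr_ge0. Qed.

Lemma enorm_sqr (n : nat) (x : 'rV[R]_n) : enorm x ^+ 2 = \sum_(i < n) x 0 i ^+ 2.
Proof. by rewrite sqr_sqrtr// sumr_ge0// => i _; exact: sqr_ge0. Qed.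

Lemma coord_le_enorm (n : nat) (x : 'rV[R]_n) (i : 'I_n) : `|x 0 i| <= enorm x.
Proof.
rewrite -(@ler_pXn2r _ 2)// ?nnegrE ?enorm_ge0// enorm_sqr real_normK ?num_real//.
by rewrite (bigD1 i)//= lerDl sumr_ge0// => j _; exact: sqr_ge0.
Qed.

Lemma measurable_subRn d (X : measurableType d) (n : nat) (f g : X -> @Rn R n) :
  measurable_fun setT f -> measurable_fun setT g ->
  measurable_fun setT (fun x => ((f x : 'rV[R]_n) - g x : 'rV[R]_n) : Rn n).
Proof.
move=> mf mg; apply: measurable_fun_Rn => i.
under eq_fun do rewrite !mxE.
by apply: measurable_funB; apply: (measurableT_comp (measurable_coord i)).
Qed.

Lemma measurable_heat_kernel d (X : measurableType d) (n : nat) (t : X -> R)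
    (g : X -> @Rn R n) :
  measurable_fun setT t -> measurable_fun setT g ->
  measurable_fun setT (fun x => @heat_kernel R n (t x) (g x)).
Proof.
move=> mt mg; rewrite /heat_kernel.
apply: measurable_funM.
  apply: (measurableT_comp (measurable_powR _)).
  by apply: measurable_funM.
apply: (measurableT_comp (@measurable_expR R)).
apply: measurable_funM.
  apply: measurable_funN; apply: measurable_funX.
  exact: (measurableT_comp (@measurable_enorm n) mg).
by apply: measurable_funV; exact: measurable_funM.
Qed.

End lebRn.

(** * Gaussian kernels and exponential weights *)

Section gauss.
Context {R : realType}.

Lemma heat_kernel_ge0 (n : nat) (t : R) (x : 'rV[R]_n) : 0 <= heat_kernel t x.
Proof. by rewrite mulr_ge0 ?powR_ge0 ?expR_ge0. Qed.

Lemma heat_kernel_le (n : nat) (t : R) (x : 'rV[R]_n) : 0 < t ->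
  heat_kernel t x <= (4 * pi * t) `^ (- (n%:R / 2)).
Proof.
move=> t0; rewrite ler_piMr ?powR_ge0// -expR0 ler_expR mulNr oppr_le0.
by rewrite divr_ge0 ?sqr_ge0// mulr_ge0// ltW.
Qed.

(** Each coordinate contributes a centred normal density of variance 2t, so the mass of the kernel
    comes from the one-dimensional integral. *)
Lemma heat_kernel_prod (n : nat) (t : R) (x : 'rV[R]_n) : 0 < t ->
  heat_kernel t x = \prod_(i < n) normal_pdf 0 (Num.sqrt (2 * t)) (x 0 i).
Proof.
move=> t0; have t4 : 0 < 4 * pi * t by rewrite !mulr_gt0// pi_gt0.
have s0 : Num.sqrt (2 * t) != 0 by rewrite gt_eqF// sqrtr_gt0 mulr_gt0.
rewrite /heat_kernel enorm_sqr.
rewrite [RHS](eq_bigr (fun i => normal_peak (Num.sqrt (2 * t)) *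
  normal_fun 0 (Num.sqrt (2 * t)) (x 0 i))); last by move=> i _; rewrite normal_pdfE.
rewrite big_split/= prodr_const card_ord.
have s2 : Num.sqrt (2 * t) ^+ 2 = 2 * t by rewrite sqr_sqrtr// mulr_ge0// ltW.
congr (_ * _).
  rewrite /normal_peak s2.
  have -> : 2 * t * pi *+ 2 = 4 * pi * t by ring.
  rewrite -[Num.sqrt _](powR12_sqrt (ltW t4)) -powRN -powR_mulrn ?powR_ge0//.
  by rewrite -powRrM; congr (_ `^ _); rewrite mulNr mulrC.
rewrite /normal_fun -expR_sum s2; congr expR.
rewrite -mulr_suml -sumrN; congr (_ / _); last by ring.
by apply: eq_bigr => i _; rewrite subr0.
Qed.

Lemma integral_heat_kernel_le1 (n : nat) (t : R) (y : @Rn R n) : 0 < t ->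
  (\int[@lebRn R n]_x (heat_kernel t ((x : 'rV[R]_n) - y))%:E <= 1)%E.
Proof.
move=> t0.
rewrite -lebintE; last 2 first.
- apply/measurable_EFinP; apply: measurable_heat_kernel => //.
  by apply: measurable_subRn => //; exact: measurable_cst.
- by move=> x; rewrite lee_fin heat_kernel_ge0.
rewrite (_ : (fun x => _) = (fun x : 'rV[R]_n => (\prod_(i < n)
   normal_pdf ((y : 'rV[R]_n) 0 i) (Num.sqrt (2 * t)) (x 0 i))%:E)); last first.
  apply/funext => x; rewrite heat_kernel_prod//; congr (_%:E).
  have s0 : Num.sqrt (2 * t) != 0 by rewrite gt_eqF// sqrtr_gt0 mulr_gt0.
  apply: eq_bigr => i _; rewrite !mxE !normal_pdfE// /normal_fun subr0.
  by [].
rewrite (le_trans (@lebint_prod_le _ _ (fun i => normal_pdf ((y : 'rV[R]_n) 0 i)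
  (Num.sqrt (2 * t))) 1 _ _ _))//.
- by move=> i; exact: measurable_normal_pdf.
- by move=> i x; exact: normal_pdf_ge0.
- by move=> i; rewrite integral_normal_pdf.
- by rewrite expr1n.
Qed.

(** With this norm the exponent of the weight is a sum over coordinates, like that of the Gaussian,
    so squares can be completed one coordinate at a time. *)
Definition l1 (n : nat) (x : 'rV[R]_n) : R := \sum_(i < n) `|x 0 i|.

Lemma l1_ge0 (n : nat) (x : 'rV[R]_n) : 0 <= l1 x.
Proof. by apply: sumr_ge0. Qed.

Lemma l1_sub (n : nat) (x y : 'rV[R]_n) : l1 y <= l1 x + l1 (x - y).
Proof.
rewrite /l1 -big_split/=; apply: ler_sum => i _; rewrite !mxE.
by apply: le_trans (ler_normB (x 0 i) (x 0 i - y 0 i)); rewrite subKr.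
Qed.

Lemma enorm_le_l1 (n : nat) (x : 'rV[R]_n) : enorm x <= l1 x.
Proof.
rewrite -(@ler_pXn2r _ 2)// ?nnegrE ?enorm_ge0 ?l1_ge0// enorm_sqr.
rewrite expr2 {1}/l1 mulr_suml; apply: ler_sum => i _.
rewrite -[x 0 i ^+ 2]real_normK ?num_real// expr2 ler_wpM2l//.
by rewrite /l1 (bigD1 i)//= lerDl sumr_ge0.
Qed.

Lemma measurable_l1 (n : nat) : measurable_fun [set: @Rn R n] (@l1 n).
Proof.
apply: measurable_sum => i.
by apply: (measurableT_comp (@normr_measurable R setT)); exact: measurable_coord.
Qed.

(* Completing the square in each coordinate: [A |z_i| <= z_i^2/(8 t) + 2 t A^2]. *)
Lemma heat_kernel_weight (n : nat) (t A : R) (z : 'rV[R]_n) : 0 < t -> 0 <= A ->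
  expR (A * l1 z) * heat_kernel t z <=
  2 `^ (n%:R / 2) * expR (n%:R * (2 * t * A ^+ 2)) * heat_kernel (2 * t) z.
Proof.
move=> t0 A0; rewrite /heat_kernel.
(* Comparing the normalisations at times t and 2t produces the factor 2^(n/2). *)
have -> : 4 * pi * t = (4 * pi * (2 * t)) * 2^-1 by field.
have p0 : (0 : R) <= 4 * pi * (2 * t).
  by rewrite !mulr_ge0// ?pi_ge0// ltW.
have -> : (4 * pi * (2 * t) * 2^-1) `^ (- (n%:R / 2)) =
    2 `^ (n%:R / 2) * (4 * pi * (2 * t)) `^ (- (n%:R / 2)).
  rewrite powRM// mulrC; congr (_ * _).
  by rewrite -powR_inv1// -powRrM mulN1r opprK.
set P := _ `^ (- _); set c := 2 `^ _.
set E1 := expR (A * _); set E2 := expR (n%:R * _).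
rewrite (_ : E1 * _ = c * P * (E1 * expR (- enorm z ^+ 2 / (4 * t)))); last by ring.
rewrite (_ : c * E2 * _ = c * P * (E2 * expR (- enorm z ^+ 2 / (4 * (2 * t)))));
  last by ring.
rewrite ler_wpM2l ?mulr_ge0 ?powR_ge0// -!expRD ler_expR enorm_sqr.
have t8 : 0 < 8 * t by rewrite mulr_gt0.
rewrite -subr_ge0 -(pmulr_rge0 _ t8).
rewrite (_ : _ * _ = \sum_(i < n) (`|z 0 i| - 4 * t * A) ^+ 2).
  by apply: sumr_ge0 => i _; exact: sqr_ge0.
rewrite [RHS](eq_bigr (fun i => z 0 i ^+ 2 - 8 * t * A * `|z 0 i| + (4 * t * A) ^+ 2)).
  rewrite big_split/= sumrB -mulr_sumr -/(l1 z) sumr_const card_ord -mulr_natl.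
  by field; rewrite gt_eqF.
by move=> i _; rewrite sqrrB real_normK ?num_real//; ring.
Qed.

(** By the triangle inequality the weight at x is at most the weight at y times exp(A|x - y|_1), a
    factor that the Gaussian absorbs by doubling its time. *)
Lemma heat_kernel_weight_sub (n : nat) (t A : R) (x y : 'rV[R]_n) : 0 < t -> 0 <= A ->
  expR (- (A * l1 x)) * heat_kernel t (x - y) <=
  2 `^ (n%:R / 2) * expR (n%:R * (2 * t * A ^+ 2)) *
    (expR (- (A * l1 y)) * heat_kernel (2 * t) (x - y)).
Proof.
move=> t0 A0; rewrite [leRHS]mulrCA.
apply: (@le_trans _ _ (expR (- (A * l1 y)) *
    (expR (A * l1 (x - y)) * heat_kernel t (x - y)))).
  have := heat_kernel_ge0 t (x - y); move: (heat_kernel t _) => K K0.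
  rewrite [leRHS]mulrA -expRD; apply: ler_wpM2r => //; rewrite ler_expR.
  by rewrite -mulrN -[- (A * _)]mulrN -mulrDr ler_wpM2l//; have := l1_sub x y; lra.
by rewrite ler_wpM2l ?expR_ge0//; exact: heat_kernel_weight.
Qed.

Definition box (n : nat) (a : R) : set (@Rn R n) :=
  [set x | forall i, `|(x : 'rV[R]_n) 0 i| <= a].

Lemma measurable_box (n : nat) (a : R) : measurable (@box n a).
Proof.
rewrite (_ : box a = \bigcap_(i in [set: 'I_n])
    ((fun x : @Rn R n => (x : 'rV[R]_n) 0 i) @^-1` `[- a, a]%classic)).
  apply: fin_bigcap_measurable => [|i _]; first exact: finite_finset.
  by rewrite -[X in measurable X]setTI; exact: measurable_coord.
apply/seteqP; split => x /= xB i; last by rewrite ler_norml; exact: (xB i).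
by rewrite /= in_itv/= -ler_norml.
Qed.

Lemma lebRn_box_le (n : nat) (a : R) : 0 <= a ->
  (lebRn n (box a) <= ((2 * a) ^+ n)%:E)%E.
Proof.
move=> a0.
have mI : measurable `[- a, a]%classic by [].
have E : (fun x : 'rV[R]_n => (\1_(@box n a) x : R)%:E) =
         (fun x => (\prod_(i < n) \1_(`[- a, a]%classic) (x 0 i))%:E).
  apply/funext => x; congr (_%:E); rewrite indicE.
  have [/set_mem/= xB|/negP xB] := boolP (x \in _).
    rewrite big1// => i _; rewrite indicE mem_set//= in_itv/= -ler_norml.
    exact: xB.
  have [i xi] : exists i, ~~ (`|x 0 i| <= a).
    by apply/not_existsP => H; apply: xB; apply/mem_set => i /=; have /negP/negbNE := H i.
  rewrite (bigD1 i)//= indicE memNset ?mul0r//= in_itv/= -ler_norml.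
  exact/negP.
rewrite -lebmE; last exact: measurable_box.
rewrite /lebm E.
rewrite (le_trans (@lebint_prod_le _ _ (fun i => \1_(`[- a, a]%classic)) (2 * a) _ _ _))//.
- move=> i; rewrite integral_indic//= setIT lebesgue_measure_itv/= lte_fin.
  case: ifPn => _; last by rewrite lee_fin mulr_ge0.
  by rewrite -EFinB lee_fin opprK; lra.
Qed.

End gauss.

(** * Dyadic annuli and Herz coefficients *)

Section pow2.
Context {R : realType}.
Implicit Types x y : R.

Lemma pow2_gt0 x : 0 < 2 `^ x.
Proof. by rewrite powR_gt0. Qed.

Lemma pow2D x y : 2 `^ (x + y) = 2 `^ x * 2 `^ y.
Proof. by rewrite powRD// pnatr_eq0 implybT. Qed.

Lemma pow2_lt x y : (2 `^ x < 2 `^ y) = (x < y).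
Proof. by rewrite /powR pnatr_eq0/= ltr_expR ltr_pM2r// ln_gt0// ltr1n. Qed.

Lemma pow2_le x y : (2 `^ x <= 2 `^ y) = (x <= y).
Proof. by rewrite /powR pnatr_eq0/= ler_expR ler_pM2r// ln_gt0// ltr1n. Qed.

End pow2.

Section annuli.
Context {R : realType}.
Variable n : nat.
Notation ann := (@annulus R n).
Notation mu := (@lebRn R n).

Lemma measurable_annulus (k : int) : measurable (ann k : set (Rn n)).
Proof.
rewrite (_ : (ann k : set (Rn n)) =
  (@enorm R n : Rn n -> R) @^-1` `[2 `^ (k%:~R - 1), 2 `^ k%:~R[%classic).
  by rewrite -[X in measurable X]setTI; exact: measurable_enorm.
by apply/seteqP; split => x; rewrite /annulus/= in_itv.
Qed.

Lemma annulus_box (k : int) : (ann k : set (Rn n)) `<=` box (2 `^ k%:~R).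
Proof.
by move=> x /andP[_ /ltW xk] i; rewrite (le_trans _ xk)// coord_le_enorm.
Qed.

Lemma lebRn_annulus_le (k : int) :
  (mu (ann k : set (Rn n)) <= ((2 * 2 `^ k%:~R) ^+ n)%:E)%E.
Proof.
apply: le_trans (lebRn_box_le _ (powR_ge0 _ _)).
apply: le_measure; rewrite ?inE; last exact: annulus_box.
- exact: measurable_annulus.
- exact: measurable_box.
Qed.

Lemma annulus_exists (x : 'rV[R]_n) : enorm x != 0 -> exists k, ann k x.
Proof.
move=> x0; have {}x0 : 0 < enorm x by rewrite lt_neqAle eq_sym x0 enorm_ge0.
have l2 : 0 < ln 2 :> R by rewrite ln_gt0// ltr1n.
pose L := ln (enorm x) / ln 2.
have E : enorm x = 2 `^ L.
  by rewrite /powR pnatr_eq0/= /L divfK ?gt_eqF// lnK.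
(* Annuli are closed on the inner side, 2^(k-1) <= |x| < 2^k, so k exceeds the integer part of log_2
   |x| by one. *)
exists (Num.floor L + 1); rewrite /annulus/= E pow2_le pow2_lt.
have := floor_le L; have := floorD1_gt L.
by rewrite intrD addrK => -> ->.
Qed.

Lemma lebRn_enorm0 : (0 < n)%N -> mu [set x | @enorm R n x = 0] = 0%E.
Proof.
move=> n0; apply/eqP; rewrite eq_le measure_ge0 andbT.
have mZ : measurable ([set x | @enorm R n x = 0] : set (Rn n)).
  rewrite (_ : [set x | _] = (@enorm R n : Rn n -> R) @^-1` [set 0])//.
  by rewrite -[X in measurable X]setTI; exact: measurable_enorm.
apply/lee_addgt0Pr => e e0; rewrite add0e.
(* Then 2a = min(1,e), and (2a)^n <= 2a <= e because n >= 1. *)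
pose a := Num.min 1 e / 2.
have a0 : 0 < a by rewrite divr_gt0// lt_min ltr01.
apply: (@le_trans _ _ (((2 * a) ^+ n)%:E)).
  apply: le_trans (lebRn_box_le _ (ltW a0)).
  apply: le_measure; rewrite ?inE//; first exact: measurable_box.
  move=> x /= x0 i; rewrite (le_trans (coord_le_enorm _ _))// x0; exact: ltW.
rewrite lee_fin -(prednK n0) exprS /a.
rewrite (_ : 2 * (Num.min 1 e / 2) = Num.min 1 e); last by field.
have m0 : 0 <= Num.min 1 e by rewrite le_min ler01 ltW.
rewrite (@le_trans _ _ (Num.min 1 e))//; last by rewrite ge_min lexx orbT.
by rewrite ler_piMr// exprn_ile1// ge_min lexx.
Qed.

(** The annuli cover everything but the origin, a null set. Integer indices are enumerated in pairs
    i, -i; the annulus of index 0 is counted twice, which is harmless for an upper bound. *)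
Lemma annuli_sum (psi : Rn n -> \bar R) (e : int -> R) (S : R) : (0 < n)%N ->
  measurable_fun [set: @Rn R n] psi -> (forall x, 0 <= psi x)%E ->
  (forall k, \int[mu]_(x in (ann k : set (Rn n))) psi x <= (e k)%:E)%E ->
  (forall N, \sum_(i < N) (e i%:Z + e (- i%:Z)) <= S) ->
  (\int[mu]_x psi x <= S%:E)%E.
Proof.
move=> n0 mpsi psi0 psie eS.
pose f (i : nat) x := ((psi \_ (ann i%:Z : set (Rn n))) x +
   (psi \_ (ann (- i%:Z) : set (Rn n))) x)%E.
have mr k : measurable_fun setT (psi \_ (ann k : set (Rn n))).
  apply/(measurable_restrictT _ (measurable_annulus k)).
  exact: measurable_funS mpsi.
have r0 k x : (0 <= (psi \_ (ann k : set (Rn n))) x)%E.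
  by rewrite patchE; case: ifP.
have mf i : measurable_fun setT (f i) by exact: emeasurable_funD.
have f0 i x : (0 <= f i x)%E by rewrite adde_ge0.
apply: (@le_trans _ _ (\int[mu]_x (\sum_(i <oo) f i x))%E).
  apply: ae_ge0_le_integral => //.
  - by move=> x _; exact: nneseries_ge0.
  - exact: ge0_emeasurable_sum.
  exists [set x | @enorm R n x = 0]; split; [|exact: lebRn_enorm0|].
    rewrite (_ : [set x | _] = (@enorm R n : Rn n -> R) @^-1` [set 0])//.
    by rewrite -[X in measurable X]setTI; exact: measurable_enorm.
  move=> x /= xP; apply: contrapT => /eqP /annulus_exists[k xk]; apply: xP => _.
  have : (psi x <= f `|k|%N x)%E.
    have r1 : psi x = (psi \_ (ann k : set (Rn n))) x by rewrite patchE mem_set.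
    rewrite r1 /f; case: k {xk r1} => m; rewrite ?NegzE ?abszN absz_nat.
      by rewrite leeDl.
    by rewrite leeDr.
  move/le_trans; apply.
  rewrite (@nneseriesD1 _ _ `|k|%N)// leeDl//.
  by apply: nneseries_ge0.
rewrite integral_nneseries//.
apply: lime_le.
  apply: is_cvg_nneseries => i _ _; exact: integral_ge0.
apply: nearW => N; rewrite big_mkord.
apply: (@le_trans _ _ (\sum_(i < N) (e i%:Z + e (- i%:Z))%:E)%E).
  apply: lee_sum => i _; rewrite ge0_integralD// -!integral_mkcond EFinD leeD//.
by rewrite sumEFin lee_fin.
Qed.

End annuli.

Section herz.
Context {R : realType}.
Variable n : nat.
Notation ann := (@annulus R n).
Notation mu := (@lebRn R n).
Implicit Types f : @Rn R n -> R.

(** A pointwise substitute for Hoelder's inequality: below the level L use x^rho <= L^rho, above it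
    x^(rho-q) <= L^(rho-q). Choosing L afterwards optimises the bound. *)
Lemma powR_split (rho q L x : R) : 0 < rho -> rho <= q -> 0 < L -> 0 <= x ->
  x `^ rho <= L `^ rho + L `^ (rho - q) * x `^ q.
Proof.
move=> rho0 rhoq L0 x0; have [xL|Lx] := leP x L.
  rewrite (@le_trans _ _ (L `^ rho))//.
    by rewrite ge0_ler_powR// ?nnegrE// ltW.
  by rewrite lerDl mulr_ge0// powR_ge0.
have {}x0 : 0 < x by exact: lt_trans Lx.
rewrite (@le_trans _ _ (L `^ (rho - q) * x `^ q))//; last by rewrite lerDr powR_ge0.
rewrite (_ : rho = rho - q + q); last by rewrite subrK.
rewrite powRD; last by rewrite (gt_eqF x0) implybT.
rewrite subrK ler_wpM2r ?powR_ge0// -[rho - q]opprK opprB !powRN.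
rewrite lef_pV2 ?posrE ?powR_gt0//.
by rewrite ge0_ler_powR// ?nnegrE ?subr_ge0// ltW.
Qed.

Lemma measurable_normpow d (X : measurableType d) (f : X -> R) (p : R) :
  measurable_fun setT f -> measurable_fun setT (fun x => `|f x| `^ p).
Proof.
move=> mf; apply: (measurableT_comp (measurable_powR p)).
exact: (measurableT_comp (@normr_measurable R setT) mf).
Qed.

Lemma patch_indic (A : set (Rn n)) (f : @Rn R n -> R) (g : R -> R) : g 0 = 0 ->
  (fun x => (g (f x * \1_A x))%:E) = ((fun x => (g (f x))%:E) \_ A).
Proof.
move=> g0; apply/funext => x; rewrite patchE indicE.
by case: (x \in A); rewrite ?mulr1// mulr0 g0.
Qed.

(* The strict inequality [c < c'] keeps the level [2^(-k delta) c'] at which [|f|] is cut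
   positive, also when [c = 0]. *)
Lemma annulus_powR_le (s : R) (q : \bar R) (rho c c' : R) (k : int) f :
  measurable_fun [set: @Rn R n] f -> 0 < rho -> (rho%:E <= q)%E ->
  ((2 `^ (k%:~R * s))%:E * lq_norm q (fun x : 'rV[R]_n => (f x * \1_(ann k) x)%R)
     <= c%:E)%E -> 0 <= c -> c < c' ->
  (\int[mu]_(x in (ann k : set (Rn n))) (`|f x| `^ rho)%:E <=
   ((2 ^+ n + 1) * (2 `^ (k%:~R * (n%:R - rho * (s + n%:R * einv q))) * c' `^ rho))%:E)%E.
Proof.
move=> mf rho0 + + c0 cc'.
have c'0 : 0 < c' by exact: le_lt_trans cc'.
have mA := @measurable_annulus R n k.
have mp p : measurable_fun (ann k : set (Rn n)) (fun x => (`|f x| `^ p)%:E).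
  apply: measurable_funTS; apply/measurable_EFinP; exact: measurable_normpow.
have A2 : ((2 * 2 `^ k%:~R) ^+ n : R) = 2 ^+ n * 2 `^ (k%:~R * n%:R).
  by rewrite exprMn powRrM powR_mulrn ?powR_ge0.
case: q => [q|_|//]; rewrite ?lee_fin.
  move=> rhoq; rewrite /lq_norm => H.
  have q0 : 0 < q by exact: lt_le_trans rhoq.
  set delta := s + n%:R * einv q%:E.
  have dE : delta * q = s * q + n%:R by rewrite /delta/= mulrDl mulfVK ?gt_eqF.
  pose I := (\int[mu]_(x in (ann k : set (Rn n))) (`|f x| `^ q)%:E)%E.
  have I0 : (0 <= I)%E by apply: integral_ge0 => x _; rewrite lee_fin powR_ge0.
  have {}H : (I <= ((c * 2 `^ (- (k%:~R * s))) `^ q)%:E)%E.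
    move: H; rewrite (patch_indic (ann k) f (g := fun y => `|y| `^ q)); last first.
      by rewrite normr0 powR0// gt_eqF.
    rewrite lebintE; last 2 first.
    - by apply/(measurable_restrictT _ mA).
    - by move=> x; rewrite patchE; case: ifP => // _; rewrite lee_fin powR_ge0.
    rewrite -integral_mkcond -/I.
    rewrite -lee_pdivlMl ?pow2_gt0// => H.
    have -> : I = poweR (poweR I q^-1) q by rewrite -poweRrM mulVf ?poweRe1// gt_eqF.
    rewrite -poweR_EFin.
    apply: (gt0_ler_poweR (ltW q0)); rewrite ?in_itv/= ?leey ?andbT ?poweR_ge0//.
      by rewrite lee_fin mulr_ge0// powR_ge0.
    by rewrite mulrC powRN.
  (* This level gives the two terms, L^rho times the measure of the annulus and L^(rho-q) times the
     integral of |f|^q, the same power of 2^k. *)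
  pose L := 2 `^ (- (k%:~R * delta)) * c'.
  have L0 : 0 < L by rewrite mulr_gt0// pow2_gt0.
  apply: (@le_trans _ _ (\int[mu]_(x in (ann k : set (Rn n)))
      ((L `^ rho)%:E + (L `^ (rho - q))%:E * (`|f x| `^ q)%:E))%E).
    apply: ge0_le_integral => //.
    - by apply: emeasurable_funD => //; exact: measurable_funeM.
    - by move=> x _; rewrite -EFinM -EFinD lee_fin; exact: powR_split.
  rewrite ge0_integralD//; last 3 first.
  - by move=> x _; rewrite lee_fin powR_ge0.
  - by move=> x _; rewrite -EFinM lee_fin mulr_ge0// powR_ge0.
  - exact: measurable_funeM.
  rewrite integral_cst// ge0_integralZl_EFin ?powR_ge0//.
  rewrite -/I.
  apply: (@le_trans _ _ ((L `^ rho)%:E * (2 ^+ n * 2 `^ (k%:~R * n%:R))%:E +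
     (L `^ (rho - q))%:E * ((c' * 2 `^ (- (k%:~R * s))) `^ q)%:E)%E).
    apply: leeD.
      rewrite lee_pmul// ?lee_fin ?powR_ge0// -A2.
      exact: lebRn_annulus_le.
    rewrite lee_pmul// ?lee_fin ?powR_ge0// (le_trans H)// lee_fin.
    rewrite ge0_ler_powR// ?nnegrE ?mulr_ge0 ?powR_ge0// ?ltW//.
    by rewrite ltr_pM2r ?pow2_gt0.
  rewrite -!EFinM -EFinD lee_fin mulrDl mul1r.
  rewrite le_eqVlt; apply/orP; left; apply/eqP.
  rewrite /L !powRM ?powR_ge0 ?(ltW c'0)// -!powRrM.
  have cq : c' `^ (rho - q) * c' `^ q = c' `^ rho.
    by rewrite -powRD ?subrK// (gt_eqF c'0) implybT.
  congr (_ + _).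
    rewrite (_ : k%:~R * (n%:R - rho * delta) = - (k%:~R * delta) * rho + k%:~R * n%:R).
      by rewrite pow2D; ring.
    by ring.
  rewrite (_ : k%:~R * (n%:R - rho * delta) =
     - (k%:~R * delta) * (rho - q) + - (k%:~R * s) * q).
    by rewrite pow2D -cq; ring.
  rewrite (_ : - (k%:~R * delta) * (rho - q) = k%:~R * (delta * q) - k%:~R * delta * rho).
    by rewrite dE; ring.
  by ring.
rewrite /lq_norm /= mulr0 addr0 => H.
pose L := 2 `^ (- (k%:~R * s)) * c'.
have L0 : 0 < L by rewrite mulr_gt0// pow2_gt0.
set S := [set M : \bar R | _] in H.
(* The essential supremum is an infimum that is not known to be attained; [c < c'] puts it strictly
   below [L], so some admissible bound [M] lies below [L]. *)
have : (ereal_inf S < L%:E)%E.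
  have p0 : 0 < 2 `^ (k%:~R * s) by exact: pow2_gt0.
  move: H; rewrite -lee_pdivlMl// => /le_lt_trans; apply.
  by rewrite -EFinM lte_fin /L powRN ltr_pM2l// invr_gt0.
move=> /ereal_inf_lt [M SM ML].
have mfA : measurable_fun setT (fun x : Rn n => (`|f x * \1_(ann k) x|)%:E).
  apply/measurable_EFinP; apply: (measurableT_comp (@normr_measurable R setT)).
  by apply: measurable_funM => //; exact: measurable_indic.
have mS : measurable ([set x | (M < (`|f x * \1_(ann k) x|)%:E)%E] : set (Rn n)).
  rewrite -[X in measurable X]setTI; exact: emeasurable_fun_o_infty.
have {}SM : mu [set x | (M < (`|f x * \1_(ann k) x|)%:E)%E] = 0%E.
  by rewrite -lebmE.
apply: (@le_trans _ _ (\int[mu]_(x in (ann k : set (Rn n))) (L `^ rho)%:E)%E).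
  apply: ae_ge0_le_integral => //; first by move=> x _; rewrite lee_fin powR_ge0.
  exists [set x | (M < (`|f x * \1_(ann k) x|)%:E)%E]; split => // x /= xP.
  apply: contrapT => xM; apply: xP => Ax; rewrite lee_fin.
  rewrite ge0_ler_powR// ?nnegrE ?(ltW rho0) ?(ltW L0)//.
  rewrite -lee_fin leNgt; apply/negP => Lx; apply: xM.
  rewrite indicE mem_set// mulr1; exact: lt_trans Lx.
rewrite integral_cst//.
apply: (@le_trans _ _ ((L `^ rho)%:E * (2 ^+ n * 2 `^ (k%:~R * n%:R))%:E)%E).
  rewrite lee_pmul// ?lee_fin ?powR_ge0// -A2; exact: lebRn_annulus_le.
rewrite -EFinM lee_fin /L powRM ?powR_ge0 ?(ltW c'0)// -powRrM.
rewrite (_ : k%:~R * (n%:R - rho * s) = - (k%:~R * s) * rho + k%:~R * n%:R); last by ring.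
rewrite [X in _ <= _ * (X * _)]pow2D mulrDl.
set a := 2 `^ _; set b := 2 `^ _; set d := c' `^ _.
have a0 : 0 <= a by exact: powR_ge0.
have b0 : 0 <= b by exact: powR_ge0.
have d0 : 0 <= d by exact: powR_ge0.
rewrite (_ : a * d * _ = 2 ^+ n * (a * b * d)); last by ring.
by rewrite lerDl !mulr_ge0.
Qed.

End herz.

Section herz_coefficients.
Context {R : realType}.
Variable n : nat.
Notation ann := (@annulus R n).

Lemma sum_le_esum (T : choiceType) (h : nat -> T) (a : T -> \bar R) (N : nat) :
  injective h -> (forall k, 0 <= a k)%E ->
  (\sum_(i < N) a (h i) <= \esum_(k in [set: T]) a k)%E.
Proof.
move=> hinj a0; apply: esum_ge; exists [set` [seq h i | i <- iota 0 N]].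
  by split.
rewrite -fsbig_seq; last by rewrite map_inj_uniq// iota_uniq.
rewrite big_map -(big_mkord xpredT (fun i => a (h i))).
by rewrite /index_iota subn0.
Qed.

(** Real numbers dominating the annular norms let finite and infinite [r] be treated alike. The last
    item is the embedding of l^r in l^a for r <= a, applied once along k >= 0 and once along k <= 0,
    whence the factor 2. *)
Lemma herz_coefficients (f : 'rV[R]_n -> R) (s : R) (q r : \bar R) (M : R) :
  (0 < r)%E -> 0 <= M -> (herz_norm s q r f <= M%:E)%E ->
  exists c : int -> R, [/\ (forall k, 0 <= c k <= M),
    (forall k, (2 `^ (k%:~R * s))%:E *
       lq_norm q (fun x : 'rV[R]_n => (f x * \1_(ann k) x)%R) <= (c k)%:E)%E &
    forall a, (r <= a%:E)%E -> forall N,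
      \sum_(i < N) (c i%:Z `^ a + c (- i%:Z) `^ a) <= 2 * M `^ a].
Proof.
move=> r0 M0; rewrite /herz_norm.
set a := (fun j : int => _ : \bar R).
case: r r0 => [r|_|//]; rewrite ?lte_fin; last first.
  move=> H; exists (fun=> M); split => // [k|k].
  - by rewrite M0 lexx.
  - by rewrite -/(a k) (le_trans _ H)//; apply: ereal_sup_ubound; exists k.
move=> r0 H.
have {}H : (\esum_(j in [set: int]) poweR (a j) r <= (M `^ r)%:E)%E.
  set E := (\esum_(j in _) _)%E in H *.
  have E0 : (0 <= E)%E by apply: esum_ge0 => j _; exact: poweR_ge0.
  have -> : E = poweR (poweR E r^-1) r by rewrite -poweRrM mulVf ?poweRe1// gt_eqF.
  rewrite -poweR_EFin; apply: (gt0_ler_poweR (ltW r0)) => //;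
    by rewrite in_itv/= ?poweR_ge0 leey ?andbT ?lee_fin.
pose c k := fine (maxe 0%E (a k)).
have ar k : (poweR (a k) r <= (M `^ r)%:E)%E.
  apply: le_trans H; have := @sum_le_esum _ (fun i : nat => k + i%:Z)
    (fun j => poweR (a j) r) 1.
  by rewrite big_ord1 addr0; apply => [x y /addrI []//|j]; exact: poweR_ge0.
have aM k : (a k <= M%:E)%E.
  rewrite leNgt; apply/negP => Ma.
  have a0 : (0 <= a k)%E by rewrite (le_trans _ (ltW Ma)).
  have := ar k; rewrite leNgt => /negP; apply.
  rewrite -poweR_EFin; case: (a k) Ma {a0} => [y|_|]; last by rewrite ltNge leNye.
    rewrite lte_fin => My; rewrite !poweR_EFin lte_fin gt0_ltr_powR// nnegrE//.
    exact: le_trans (ltW My).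
  by rewrite poweRyr ?gt_eqF// poweR_EFin ltry.
have cE k : (c k)%:E = maxe 0%E (a k).
  rewrite /c fineK// fin_real// lt_max ltNy0/= gt_max lt0y/=.
  exact: le_lt_trans (aM k) (ltry _).
have c0 k : 0 <= c k by rewrite -lee_fin cE le_max lexx.
have cM k : c k <= M by rewrite -lee_fin cE ge_max lee_fin M0 aM.
have ca k : ((c k `^ r)%:E <= poweR (a k) r)%E.
  rewrite -poweR_EFin cE maxEle; case: ifP => // _.
  by rewrite poweR0r ?gt_eqF ?poweR_ge0.
exists c; split => [k|k|b rb N].
- by rewrite c0 cM.
- by rewrite cE le_max lexx orbT.
rewrite lee_fin in rb.
have key (h : nat -> int) : injective h ->
    \sum_(i < N) c (h i) `^ b <= M `^ b.
  move=> hinj.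
  have Hr : \sum_(i < N) c (h i) `^ r <= M `^ r.
    rewrite -lee_fin -sumEFin (le_trans _ H)//.
    apply: le_trans (sum_le_esum N hinj (fun k => poweR_ge0 (a k) r)).
    by apply: lee_sum.
  (* Split off c^r, whose sum is controlled, and bound the remaining power c^(b-r) by M^(b-r). *)
  have e x : 0 <= x -> x `^ b = x `^ r * x `^ (b - r).
    rewrite le_eqVlt => /predU1P[<-|x0].
      by rewrite (@powR0 _ b) ?(@powR0 _ r) ?mul0r ?gt_eqF// (lt_le_trans r0).
    by rewrite -powRD ?subrKC// (gt_eqF x0) implybT.
  apply: (@le_trans _ _ (\sum_(i < N) c (h i) `^ r * M `^ (b - r))).
    apply: ler_sum => i _; rewrite e// ler_wpM2l ?powR_ge0//.
    by rewrite ge0_ler_powR// ?nnegrE// subr_ge0.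
  by rewrite -mulr_suml e// ler_wpM2r// powR_ge0.
rewrite big_split/= mulr_natl mulr2n lerD//.
- by apply: (key (fun i : nat => i%:Z)) => x y [].
- by apply: (key (fun i : nat => - i%:Z)) => x y /oppr_inj [].
Qed.

(** On the annulus 2^(k-1) <= |x| < 2^k; the factor 2^|kappa| covers both signs of [kappa]. *)
Lemma annulus_enorm_powR (k : int) (x : 'rV[R]_n) (kappa : R) : ann k x ->
  enorm x `^ kappa <= 2 `^ `|kappa| * 2 `^ (k%:~R * kappa).
Proof.
move=> /andP[kx xk]; have x0 : 0 < enorm x by rewrite (lt_le_trans _ kx)// pow2_gt0.
have [k0|k0] := leP 0 kappa.
  rewrite (@le_trans _ _ ((2 `^ k%:~R) `^ kappa))//.
    by rewrite ge0_ler_powR// ?nnegrE ?powR_ge0// ltW.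
  by rewrite -powRrM ler_peMl ?powR_ge0// -[leLHS](powRr0 (2:R)) pow2_le.
have -> : enorm x `^ kappa = (enorm x `^ (- kappa))^-1 by rewrite -powRN opprK.
rewrite (@le_trans _ _ ((2 `^ (k%:~R - 1)) `^ (- kappa))^-1)//.
  rewrite lef_pV2 ?posrE ?powR_gt0//.
  by rewrite ge0_ler_powR// ?nnegrE ?powR_ge0 ?(ltW x0)// oppr_ge0 ltW.
rewrite -powRN -powRrM -pow2D pow2_le (ltr0_norm k0); lra.
Qed.

End herz_coefficients.

(** * Weighted integrals summed over annuli *)

Section weighted_bounds.
Context {R : realType}.
Variable n : nat.
Notation ann := (@annulus R n).
Notation mu := (@lebRn R n).
Implicit Types f w : @Rn R n -> R.

Lemma geometric_le (x : R) (N : nat) : 0 <= x -> x < 1 ->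
  \sum_(i < N) x ^+ i <= (1 - x)^-1.
Proof.
move=> x0 x1; rewrite -(ler_pM2l (x := 1 - x)) ?subr_gt0// divff ?subr_eq0 ?gt_eqF//.
by rewrite -opprB mulNr -subrX1 opprB gerBl exprn_ge0.
Qed.

Lemma pow2_geometric_le (c : R) (N : nat) : 0 < c ->
  \sum_(i < N) 2 `^ (- (i%:R * c)) <= (1 - 2 `^ (- c))^-1.
Proof.
move=> c0; rewrite (eq_bigr (fun i : 'I_N => (2 `^ (- c)) ^+ i)).
  by rewrite geometric_le ?powR_ge0// -[ltRHS](powRr0 (2:R)) pow2_lt oppr_lt0.
by move=> i _; rewrite -powR_mulrn ?powR_ge0// -powRrM; congr (_ `^ _); ring.
Qed.

Lemma annulus_weighted_le (s kappa : R) (q : \bar R) (rho c c' B : R) (k : int) f w :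
  measurable_fun [set: @Rn R n] f -> measurable_fun [set: @Rn R n] w ->
  0 < rho -> (rho%:E <= q)%E -> 0 <= B ->
  ((2 `^ (k%:~R * s))%:E * lq_norm q (fun x : 'rV[R]_n => (f x * \1_(ann k) x)%R)
     <= c%:E)%E -> 0 <= c -> c < c' ->
  (forall x, ann k x -> 0 <= w x <= B) ->
  (\int[mu]_(x in (ann k : set (Rn n))) (@enorm R n x `^ kappa * `|f x| `^ rho * w x)%:E <=
   (2 `^ `|kappa| * (2 ^+ n + 1) *
    (B * 2 `^ (k%:~R * (kappa + n%:R - rho * (s + n%:R * einv q))) * c' `^ rho))%:E)%E.
Proof.
move=> mf mw rho0 rq B0 Hc c0 cc' wB.
have mA := @measurable_annulus R n k.
have mp : measurable_fun (ann k : set (Rn n)) (fun x => (`|f x| `^ rho)%:E).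
  by apply: measurable_funTS; apply/measurable_EFinP; exact: measurable_normpow.
pose K := 2 `^ `|kappa| * 2 `^ (k%:~R * kappa) * B.
apply: (@le_trans _ _ (\int[mu]_(x in (ann k : set (Rn n)))
    (K%:E * (`|f x| `^ rho)%:E))%E).
  apply: ge0_le_integral => //.
  - by move=> x /wB /andP[w0 _]; rewrite lee_fin !mulr_ge0// powR_ge0.
  - apply: measurable_funTS; apply/measurable_EFinP; apply: measurable_funM => //.
    apply: measurable_funM; last exact: measurable_normpow.
    exact: (measurableT_comp (measurable_powR _) (@measurable_enorm R n)).
  - by apply: measurable_funeM.
  - move=> x Ax; have /andP[w0 wxB] := wB _ Ax.
    rewrite -EFinM lee_fin mulrAC ler_wpM2r ?powR_ge0//.
    by rewrite ler_pM ?powR_ge0//; exact: annulus_enorm_powR.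
have K0 : 0 <= K by rewrite !mulr_ge0// powR_ge0.
rewrite ge0_integralZl_EFin//.
apply: le_trans (lee_pmul _ _ (lexx _) (annulus_powR_le mf rho0 rq Hc c0 cc')) _.
- by rewrite lee_fin.
- by apply: integral_ge0 => x _; rewrite lee_fin powR_ge0.
rewrite -EFinM lee_fin /K.
rewrite (_ : k%:~R * (kappa + n%:R - rho * (s + n%:R * einv q)) =
  k%:~R * kappa + k%:~R * (n%:R - rho * (s + n%:R * einv q))); last by ring.
rewrite pow2D le_eqVlt; apply/orP; left; apply/eqP; ring.
Qed.

(** Without weight the k-th annulus contributes at most a multiple of 2^(kE), with E = kappa + n -
    rho(s + n/q). Positivity of E sums this over k < 0, and the decay |x|^(-L) of the weight with L
    > E sums it over k > 0. Only the supremum of the Herz coefficients enters, so [r] is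
    arbitrary. *)
Lemma weighted_integral_bounded (s kappa L D M rho : R) (q r : \bar R) w :
  (0 < n)%N -> (0 < r)%E -> 0 <= M -> 0 < rho -> (rho%:E <= q)%E ->
  0 < kappa + n%:R - rho * (s + n%:R * einv q) < L ->
  measurable_fun [set: @Rn R n] w ->
  (forall x, 0 <= w x <= 1) -> (forall x, @enorm R n x != 0 -> w x <= D * @enorm R n x `^ (- L)) ->
  exists C, forall f, measurable_fun [set: @Rn R n] f -> (@herz_norm R n s q r f <= M%:E)%E ->
  (\int[mu]_x (@enorm R n x `^ kappa * `|f x| `^ rho * w x)%:E <= C%:E)%E.
Proof.
move=> n0 r0 M0 rho0 rq; set E := kappa + _ - _ => /andP[E0 EL] mw w01 wL.
pose A := 2 `^ `|kappa| * (2 ^+ n + 1) : R.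
pose C1 := A * (M + 1) `^ rho * (1 + `|D| * 2 `^ `|- L|).
pose C := C1 * ((1 - 2 `^ (- (L - E)))^-1 + (1 - 2 `^ (- E))^-1).
exists C => f mf Hf.
have [c [c0M Hc _]] := herz_coefficients r0 M0 Hf.
have A0 : 0 <= A by rewrite mulr_ge0 ?powR_ge0// addr_ge0// exprn_ge0.
have C10 : 0 <= C1.
  by rewrite !mulr_ge0 ?powR_ge0// addr_ge0// mulr_ge0// powR_ge0.
(* Bound of the weight on the k-th annulus: its decay for k >= 0, the trivial bound 1 for k < 0. *)
pose Bk (k : int) : R := if (0 <= k)%R then `|D| * (2 `^ `|- L| * 2 `^ (k%:~R * - L)) else 1.
apply: (@annuli_sum R n _ (fun k => A * (Bk k * 2 `^ (k%:~R * E) * (M + 1) `^ rho))) => //.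
- apply/measurable_EFinP; apply: measurable_funM => //.
  apply: measurable_funM; last exact: measurable_normpow.
  exact: (measurableT_comp (measurable_powR _) (@measurable_enorm R n)).
- by move=> x; rewrite lee_fin !mulr_ge0 ?powR_ge0//; have /andP[] := w01 x.
- move=> k; have /andP[ck cM] := c0M k.
  apply: (annulus_weighted_le _ mf mw rho0 rq _ (Hc k) ck) => //.
    by rewrite /Bk; case: ifP => // _; rewrite !mulr_ge0// powR_ge0.
    by rewrite (le_lt_trans cM)// ltrDl.
  move=> x Ax; have /andP[-> w1] := w01 x; rewrite /= /Bk; case: ifP => // _.
  have x0 : @enorm R n x != 0.
    by case/andP: Ax => /(lt_le_trans (pow2_gt0 _)) /gt_eqF ->.
  rewrite (le_trans (wL x x0))// (le_trans (ler_norm _))// normrM ler_wpM2l//.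
  by rewrite ger0_norm ?powR_ge0// annulus_enorm_powR.
move=> N.
rewrite /C mulrDr big_split/=; apply: lerD.
  apply: (@le_trans _ _ (\sum_(i < N) C1 * 2 `^ (- (i%:R * (L - E))))); last first.
    by rewrite -mulr_sumr ler_wpM2l// pow2_geometric_le// subr_gt0.
  apply: ler_sum => i _; rewrite /Bk le0z_nat.
  rewrite (_ : 2 `^ (- (i%:R * (L - E))) = 2 `^ (i%:~R * - L) * 2 `^ (i%:~R * E)); last first.
    by rewrite -pow2D -pmulrn; congr (_ `^ _); ring.
  set u := 2 `^ (_ * - L); set v := 2 `^ (_ * E).
  have u0 : 0 <= u by exact: powR_ge0.
  have v0 : 0 <= v by exact: powR_ge0.
  rewrite (_ : C1 * _ = A * (`|D| * (2 `^ `|- L| * u) * v * (M + 1) `^ rho) +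
    A * ((M + 1) `^ rho) * (u * v)); last by rewrite /C1; ring.
  by rewrite lerDl !mulr_ge0// powR_ge0.
apply: (@le_trans _ _ (\sum_(i < N) C1 * 2 `^ (- (i%:R * E)))); last first.
  by rewrite -mulr_sumr ler_wpM2l// pow2_geometric_le.
apply: ler_sum => i _.
(* The index i = 0 occurs here too and falls in the decay branch of [Bk]; the constant covers both
   branches. *)
have BL : Bk (- i%:Z) <= 1 + `|D| * 2 `^ `|- L|.
  rewrite /Bk; case: ifP => [|_]; last by rewrite lerDl mulr_ge0// powR_ge0.
  rewrite oppr_ge0 lez_nat leqn0 => /eqP ->.
  by rewrite oppr0 mul0r powRr0 mulr1 lerDr.
rewrite (_ : 2 `^ (- (i%:R * E)) = 2 `^ ((- i%:Z)%:~R * E)); last first.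
  by rewrite mulrNz -pmulrn mulNr.
set v := 2 `^ (_ * E); have v0 : 0 <= v by exact: powR_ge0.
rewrite (_ : C1 * v = A * ((1 + `|D| * 2 `^ `|- L|) * v * (M + 1) `^ rho)); last first.
  by rewrite /C1; ring.
by rewrite ler_wpM2l// ler_wpM2r ?powR_ge0// ler_wpM2r.
Qed.

(* The borderline exponent: here the sum over annuli converges only because [r <= rho]. *)
Lemma critical_integral_bounded (s kappa M rho : R) (q r : \bar R) :
  (0 < n)%N -> (0 < r)%E -> (r <= rho%:E)%E -> 0 <= M -> 0 < rho -> (rho%:E <= q)%E ->
  kappa + n%:R - rho * (s + n%:R * einv q) = 0 ->
  exists C, forall f, measurable_fun [set: @Rn R n] f -> (@herz_norm R n s q r f <= M%:E)%E ->
  (\int[mu]_x (@enorm R n x `^ kappa * `|f x| `^ rho)%:E <= C%:E)%E.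
Proof.
move=> n0 r0 rrho M0 rho0 rq E0.
pose A := 2 `^ `|kappa| * (2 ^+ n + 1) : R.
have A0 : 0 <= A by rewrite mulr_ge0 ?powR_ge0// addr_ge0// exprn_ge0.
pose G := (1 - 2 `^ (- rho))^-1 : R.
exists (A * 2 `^ rho * (2 * M `^ rho + (G + G))) => f mf Hf.
have [c [c0M Hc Hs]] := herz_coefficients r0 M0 Hf.
(* The annular bound needs c' strictly above c k. Adding 2^(-|k|) achieves this and, unlike the
   cruder choice M + 1, keeps the sum over annuli bounded. *)
pose e (k : int) : R := 2 `^ (- (`|k|%N%:R * 1)).
apply: (@annuli_sum R n _ (fun k => A * (2 `^ rho * (c k `^ rho + e k `^ rho)))) => //.
- apply/measurable_EFinP.
  apply: measurable_funM; last exact: measurable_normpow.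
  exact: (measurableT_comp (measurable_powR _) (@measurable_enorm R n)).
- by move=> x; rewrite lee_fin mulr_ge0 ?powR_ge0.
- move=> k; have /andP[ck cM] := c0M k.
  have e0 : 0 < e k by exact: pow2_gt0.
  under eq_integral do rewrite -[X in X%:E]mulr1.
  apply: le_trans (annulus_weighted_le (w := cst 1) (B := 1) (c' := c k + e k)
    _ mf _ rho0 rq _ (Hc k) ck _ _) _ => //.
  + by rewrite ltrDl.
  + by move=> x _; rewrite /cst ler01 lexx.
  rewrite lee_fin E0 mulr0 powRr0 !mul1r ler_wpM2l//.
  (* As c + e is at most twice the larger of the two, its power rho is at most 2^rho (c^rho +
     e^rho), for rho below 1 as well. *)
  have [ce|ec] := leP (c k) (e k).
    rewrite (@le_trans _ _ ((2 * e k) `^ rho))//.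
      rewrite ge0_ler_powR ?nnegrE ?(ltW rho0)// ?addr_ge0// ?mulr_ge0// ?(ltW e0)//.
      by rewrite mulr2n mulrDl !mul1r lerD2r.
    by rewrite powRM// ?(ltW e0)// ler_wpM2l ?powR_ge0// lerDr powR_ge0.
  rewrite (@le_trans _ _ ((2 * c k) `^ rho))//.
    rewrite ge0_ler_powR ?nnegrE ?(ltW rho0)// ?addr_ge0// ?mulr_ge0// ?(ltW e0)//.
    by rewrite mulr2n mulrDl !mul1r lerD2l ltW.
  by rewrite powRM// ler_wpM2l ?powR_ge0// lerDl powR_ge0.
move=> N.
under eq_bigr do rewrite -mulrDr -mulrDr.
rewrite -!mulr_sumr -mulrA ler_wpM2l// ler_wpM2l ?powR_ge0//.
under eq_bigr do rewrite addrACA.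
rewrite big_split/= lerD ?Hs// big_split/=.
have ge (h : nat -> int) : (forall i, `|h i|%N = i) -> \sum_(i < N) e (h i) `^ rho <= G.
  move=> hi; apply: le_trans (pow2_geometric_le N rho0).
  by apply: ler_sum => i _; rewrite /e hi -powRrM mulr1 mulNr.
apply: lerD; first exact: (ge (fun i => i%:Z)).
by apply: (ge (fun i => - i%:Z)) => i; rewrite abszN.
Qed.

End weighted_bounds.

(** * The potential against the heat kernel *)

Section potential.
Context {R : realType}.
Variable n : nat.
Notation mu := (@lebRn R n).
Implicit Types f W : @Rn R n -> R.

(** This is z/L <= exp(z/L) raised to the power L. *)
Lemma powR_le_expR (L z : R) : 0 < L -> 0 <= z -> z `^ L <= L `^ L * expR z.
Proof.
move=> L0 z0; have -> : expR z = expR (z / L) `^ L.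
  by rewrite -expRM divfK// gt_eqF.
rewrite -powRM ?expR_ge0// ?(ltW L0)//.
rewrite ge0_ler_powR ?nnegrE ?(ltW L0)// ?mulr_ge0 ?expR_ge0// ?(ltW L0)//.
rewrite mulrC -ler_pdivrMr// (le_trans _ (expR_ge1Dx _))//.
by rewrite lerDr.
Qed.

(** Apply [powR_le_expR] to sigma(1 + |x|): exponential decay is traded for polynomial decay at the
    cost sigma^(-eps), and the extra sigma in the exponent is absorbed by exp(T). *)
Lemma expR_l1_le (eps sigma T : R) (x : 'rV[R]_n) : 0 < eps -> 0 < sigma <= T ->
  expR (- (sigma * l1 x)) <=
    eps `^ eps * expR T * sigma `^ (- eps) * (1 + enorm x) `^ (- eps).
Proof.
move=> e0 /andP[s0 sT]; have x0 := enorm_ge0 x.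
have x1 : 0 < 1 + enorm x by rewrite ltr_wpDr.
rewrite -[leRHS]mulrA -powRM ?(ltW s0) ?(ltW x1)// powRN expRN.
rewrite -ler_pdivrMr ?invr_gt0 ?powR_gt0 ?mulr_gt0// invrK mulrC.
rewrite ler_pdivrMr ?expR_gt0//.
apply: le_trans (powR_le_expR e0 _) _; first by rewrite mulr_ge0 ?ltW.
rewrite -mulrA ler_wpM2l ?powR_ge0// -expRD ler_expR mulrDr mulr1 lerD//.
by rewrite ler_wpM2l ?(ltW s0)// enorm_le_l1.
Qed.

(** Cut W at the level sigma^(-n/(2m)). Below it the kernel has mass at most one, above it the
    kernel is bounded by its peak, and this level makes both contributions the same power of
    sigma. *)
Lemma heat_kernel_Lp (m C sigma : R) W (y : @Rn R n) : 1 <= m -> 0 < sigma ->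
  measurable_fun [set: @Rn R n] W -> (forall x, 0 <= W x) ->
  (\int[mu]_x (W x `^ m)%:E <= C%:E)%E ->
  (\int[mu]_x (W x * @heat_kernel R n sigma ((x : 'rV[R]_n) - y))%:E <=
    ((1 + (4 * pi) `^ (- (n%:R / 2)) * C) * sigma `^ (- (n%:R / (2 * m))))%:E)%E.
Proof.
move=> m1 s0 mW W0 WC; have m0 : 0 < m by exact: lt_le_trans m1.
pose L := sigma `^ (- (n%:R / (2 * m))); have L0 : 0 < L by exact: powR_gt0.
have mK : measurable_fun [set: @Rn R n] (fun x => @heat_kernel R n sigma ((x : 'rV[R]_n) - y)).
  by apply: measurable_heat_kernel => //; apply: measurable_subRn.
have mWm : measurable_fun [set: @Rn R n] (fun x => W x `^ m).
  exact: (measurableT_comp (measurable_powR m) mW).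
pose P := (4 * pi * sigma) `^ (- (n%:R / 2)).
apply: (@le_trans _ _ (\int[mu]_x (L%:E * (@heat_kernel R n sigma ((x : 'rV[R]_n) - y))%:E +
    (L `^ (1 - m) * P)%:E * (W x `^ m)%:E))%E).
  apply: ge0_le_integral => //.
  - by move=> x _; rewrite lee_fin mulr_ge0 ?heat_kernel_ge0.
  - by apply/measurable_EFinP; exact: measurable_funM.
  - by apply: emeasurable_funD; apply: measurable_funeM; apply/measurable_EFinP.
  move=> x _; rewrite -!EFinM -EFinD lee_fin.
  have K0 := @heat_kernel_ge0 R n sigma ((x : 'rV[R]_n) - y).
  have KP := @heat_kernel_le R n sigma ((x : 'rV[R]_n) - y) s0.
  have := powR_split ltr01 m1 L0 (W0 x); rewrite !powRr1 ?(ltW L0)// => H.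
  apply: (le_trans (ler_wpM2r K0 H)); rewrite mulrDl lerD2l mulrAC.
  by rewrite ler_wpM2r ?powR_ge0// ler_wpM2l ?powR_ge0.
rewrite ge0_integralD//; last 4 first.
- by move=> x _; rewrite -EFinM lee_fin mulr_ge0 ?heat_kernel_ge0// ltW.
- by apply: measurable_funeM; apply/measurable_EFinP.
- by move=> x _; rewrite -EFinM lee_fin !mulr_ge0 ?powR_ge0.
- by apply: measurable_funeM; apply/measurable_EFinP.
rewrite (ge0_integralZl_EFin _ _ _ _ (ltW L0))//; last 2 first.
- by move=> x _; rewrite lee_fin heat_kernel_ge0.
- by apply/measurable_EFinP.
rewrite (ge0_integralZl_EFin _ _ _ _ (_ : 0 <= L `^ (1 - m) * P))//; last 3 first.
- by move=> x _; rewrite lee_fin powR_ge0.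
- by apply/measurable_EFinP.
- by rewrite mulr_ge0 ?powR_ge0.
rewrite mulrDl mul1r EFinD; apply: leeD.
  rewrite -[leRHS]mule1 lee_pmul ?lee_fin ?(ltW L0)//.
    by apply: integral_ge0 => x _; rewrite lee_fin heat_kernel_ge0.
  exact: integral_heat_kernel_le1.
apply: (@le_trans _ _ ((L `^ (1 - m) * P)%:E * C%:E)%E).
  rewrite lee_pmul ?lee_fin ?mulr_ge0 ?powR_ge0//.
  by apply: integral_ge0 => x _; rewrite lee_fin powR_ge0.
rewrite -EFinM lee_fin le_eqVlt; apply/orP; left; apply/eqP.
rewrite /P powRM ?mulr_ge0 ?pi_ge0 ?(ltW s0)// /L -powRrM.
set c := (4 * pi) `^ _.
rewrite (_ : sigma `^ (- (n%:R / (2 * m))) =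
  sigma `^ (- (n%:R / (2 * m)) * (1 - m)) * sigma `^ (- (n%:R / 2))); first by ring.
rewrite -powRD; last by rewrite (gt_eqF s0) implybT.
by congr (_ `^ _); field; rewrite gt_eqF.
Qed.

(* Young's inequality for [W = |x|^gamma |f|^(alpha-1) (1 + |x|)^(-eps)], which lies in [L^m]
   uniformly in [f]; [n/m] is taken slightly above [(alpha-1)(s + n/q) - gamma]. *)
Lemma potential_bounded (s gamma alpha M T : R) (q r : \bar R) :
  (0 < n)%N -> (0 < r)%E -> 0 <= M -> 1 < alpha -> (alpha%:E <= q)%E ->
  gamma <= (alpha - 1) * s ->
  (alpha - 1) * (s + n%:R * einv q) - gamma < Num.min 2 n%:R ->
  exists C beta : R, [/\ 0 <= C, beta < 1 & forall f, measurable_fun [set: @Rn R n] f ->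
    (@herz_norm R n s q r f <= M%:E)%E -> forall sigma (y : @Rn R n), 0 < sigma <= T ->
    (\int[mu]_x (@enorm R n x `^ gamma * `|f x| `^ (alpha - 1) * expR (- (sigma * @l1 R n x)) *
       @heat_kernel R n (2 * sigma) ((x : 'rV[R]_n) - y))%:E
     <= (C * sigma `^ (- beta))%:E)%E].
Proof.
move=> n0 r0 M0 a1 aq gs; set b := _ - gamma => bn.
have nR : 0 < n%:R :> R by rewrite ltr0n.
have a0 : 0 < alpha - 1 by rewrite subr_gt0.
(* This uses gamma <= (alpha - 1)s. It yields b >= 0 and, later, (alpha - 1)m <= q. *)
have bq : (alpha - 1) * (n%:R * einv q) <= b by rewrite /b mulrDr; lra.
have qcase : q = +oo%E \/ exists2 q', 0 < q' & q = q'%:E.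
  case: q aq {b bn bq} => [q|_|//]; last by left.
  by rewrite lee_fin => aq; right; exists q => //; lra.
have iq0 : 0 <= einv q.
  have [->//|[q' q'0 ->]] := qcase; rewrite /= invr_ge0; exact: ltW.
have b0 : 0 <= b by apply: le_trans bq; rewrite !mulr_ge0// ltW.
move: bn; rewrite lt_min => /andP[b2 bn].
(* A small part of the gap pays for every loss: b + d <= n gives m >= 1, eps = 2d exceeds d, which
   is needed for convergence at infinity, and the final exponent eps + (b + d)/2 = (b + 5d)/2 stays
   below 1. *)
pose d := (Num.min 2 n%:R - b) / 10.
have d0 : 0 < d by rewrite divr_gt0// subr_gt0 lt_min b2 bn.
have d2 : 10 * d <= 2 - b by rewrite /d mulrC divfK// lerD2r ge_min lexx.
have dn : 10 * d <= n%:R - b by rewrite /d mulrC divfK// lerD2r ge_min lexx orbT.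
pose m := n%:R / (b + d).
have bd0 : 0 < b + d by rewrite ltr_wpDl.
have m0 : 0 < m by rewrite divr_gt0.
have m1 : 1 <= m by rewrite /m ler_pdivlMr// mul1r; lra.
have mE : n%:R = m * (b + d) by rewrite /m divfK ?gt_eqF.
pose eps := 2 * d; have e0 : 0 < eps by rewrite mulr_gt0.
have rq : (((alpha - 1) * m)%:E <= q)%E.
  have [->|[q' q'0 qE]] := qcase; first exact: leey.
  have iqE : einv q = q'^-1 by rewrite qE.
  rewrite qE lee_fin /m mulrA ler_pdivrMr//.
  rewrite (_ : _ * n%:R = q' * ((alpha - 1) * (n%:R * einv q))); last first.
    by rewrite iqE; field; rewrite gt_eqF.
  by rewrite ler_pM2l// (le_trans bq)// lerDl ltW.
have em0 : 0 <= eps * m by rewrite mulr_ge0 ?ltW.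
pose w (x : @Rn R n) := (1 + @enorm R n x) `^ (- (eps * m)).
have mw1 : measurable_fun [set: @Rn R n] (fun x => 1 + @enorm R n x).
  by apply: measurable_funD => //; exact: measurable_enorm.
have mw : measurable_fun [set: @Rn R n] w.
  exact: (measurableT_comp (measurable_powR _) mw1).
have H := @weighted_integral_bounded R n s (gamma * m) (eps * m) 1 M ((alpha - 1) * m) q r w
  n0 r0 M0 (mulr_gt0 a0 m0) rq.
have [C HC] : exists C, forall f, measurable_fun [set: @Rn R n] f ->
  (@herz_norm R n s q r f <= M%:E)%E ->
  (\int[mu]_x (@enorm R n x `^ (gamma * m) * `|f x| `^ ((alpha - 1) * m) * w x)%:E <= C%:E)%E.
  apply: H => //.
  (* Since n = m(b + d), the exponent of the annular sum is exactly m d, positive and below the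
     decay eps m = 2 m d of the weight. *)
  - rewrite (_ : gamma * m + _ - _ = m * d); last by rewrite [X in _ + X - _]mE /b; ring.
    by rewrite mulr_gt0//= /eps mulrC ltr_pM2r// ltr_pMl// ltr1n.
  - move=> x; rewrite powR_ge0/= /w powRN invf_le1 ?powR_gt0 ?ltr_wpDr ?enorm_ge0//.
    apply: (@le_trans _ _ (1 `^ (eps * m))); first by rewrite powR1.
    rewrite ge0_ler_powR ?nnegrE ?addr_ge0 ?enorm_ge0//.
    by rewrite lerDl enorm_ge0.
  - move=> x x0; have {}x0 : 0 < @enorm R n x by rewrite lt_neqAle eq_sym x0 enorm_ge0.
    rewrite mul1r /w !powRN lef_pV2 ?posrE ?powR_gt0 ?ltr_wpDr ?(ltW x0)//.
    rewrite ge0_ler_powR ?nnegrE ?addr_ge0 ?(ltW x0)//.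
    by rewrite lerDr.
pose D := eps `^ eps * expR T; have D0 : 0 <= D by rewrite mulr_ge0 ?powR_ge0 ?expR_ge0.
pose F := (1 + (4 * pi) `^ (- (n%:R / 2)) * `|C|) * 2 `^ (- (n%:R / (2 * m))).
have F0 : 0 <= F by rewrite mulr_ge0 ?powR_ge0// addr_ge0// mulr_ge0 ?powR_ge0.
exists (D * F), (eps + (b + d) / 2); split; first exact: mulr_ge0.
  by rewrite /eps; lra.
move=> f mf Hf sigma y /andP[s0 sT].
pose W (x : @Rn R n) := @enorm R n x `^ gamma * `|f x| `^ (alpha - 1) * (1 + @enorm R n x) `^ (- eps).
have mW : measurable_fun [set: @Rn R n] W.
  apply: measurable_funM; last exact: (measurableT_comp (measurable_powR _) mw1).
  apply: measurable_funM; last exact: measurable_normpow.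
  exact: (measurableT_comp (measurable_powR _) (@measurable_enorm R n)).
have W0 x : 0 <= W x by rewrite !mulr_ge0 ?powR_ge0.
have WC : (\int[mu]_x (W x `^ m)%:E <= `|C|%:E)%E.
  apply: le_trans (le_trans (HC f mf Hf) _); last by rewrite lee_fin ler_norm.
  rewrite le_eqVlt; apply/orP; left; apply/eqP; apply: eq_integral => x _.
  rewrite /W !powRM ?mulr_ge0 ?powR_ge0// -!powRrM.
  by congr (_ * _ * (_ `^ _))%:E; ring.
have s20 : 0 < 2 * sigma by rewrite mulr_gt0.
have mK : measurable_fun [set: @Rn R n] (fun x => @heat_kernel R n (2 * sigma) ((x : 'rV[R]_n) - y)).
  by apply: measurable_heat_kernel => //; apply: measurable_subRn.
apply: (@le_trans _ _ (\int[mu]_x ((D * sigma `^ (- eps))%:E *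
   (W x * @heat_kernel R n (2 * sigma) ((x : 'rV[R]_n) - y))%:E))%E).
  apply: ge0_le_integral => //.
  - by move=> x _; rewrite lee_fin !mulr_ge0 ?powR_ge0 ?expR_ge0.
  - apply/measurable_EFinP; apply: measurable_funM => //; apply: measurable_funM.
      apply: measurable_funM; last exact: measurable_normpow.
      exact: (measurableT_comp (measurable_powR _) (@measurable_enorm R n)).
    apply: (measurableT_comp (@measurable_expR R)); apply: measurable_funN.
    by apply: measurable_funM => //; exact: measurable_l1.
  - by apply: measurable_funeM; apply/measurable_EFinP; exact: measurable_funM.
  move=> x _; rewrite -EFinM lee_fin /W [leRHS]mulrA ler_wpM2r ?heat_kernel_ge0//.
  rewrite mulrCA ler_wpM2l ?mulr_ge0 ?powR_ge0//.
  by apply: expR_l1_le; rewrite ?s0.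
rewrite ge0_integralZl_EFin ?mulr_ge0 ?powR_ge0//; last 2 first.
- by move=> x _; rewrite lee_fin mulr_ge0 ?heat_kernel_ge0.
- by apply/measurable_EFinP; exact: measurable_funM.
apply: le_trans (lee_pmul _ _ (lexx _) (heat_kernel_Lp y m1 s20 mW W0 WC)) _.
- by rewrite lee_fin mulr_ge0 ?powR_ge0.
- by apply: integral_ge0 => x _; rewrite lee_fin mulr_ge0 ?heat_kernel_ge0.
rewrite -EFinM lee_fin le_eqVlt; apply/orP; left; apply/eqP.
rewrite (@powRM _ 2 sigma) ?(ltW s0)// (_ : - (eps + (b + d) / 2) = - eps + - (n%:R / (2 * m))).
  rewrite powRD; last by rewrite (gt_eqF s0) implybT.
  by rewrite /F; ring.
by rewrite {1}mE; field; rewrite gt_eqF.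
Qed.

End potential.

(** * Singular kernels in time and translation *)

Section time_kernel.
Context {R : realType}.
Notation leb := (@lebesgue_measure R).

Lemma measurable_powRD1 (D : set R) (theta : R) :
  measurable_fun D (fun x : R => (x `^ theta)%:E).
Proof. by apply: measurable_funTS; apply/measurable_EFinP; exact: measurable_powR. Qed.

(** The integrand may be unbounded at 0, so the fundamental theorem of calculus is applied on
    [T/(N+2), T], and monotone convergence lets N tend to infinity. *)
Lemma integral_powR_le (theta T : R) : 0 < theta -> 0 < T ->
  (\int[leb]_(x in `]0%R, T[) (x `^ (theta - 1))%:E <= (theta^-1 * T `^ theta)%:E)%E.
Proof.
move=> th0 T0.
pose F (N : nat) := (`[T / N.+2%:R, T])%classic : set (measurableTypeR R).
have F0 N x : F N x -> 0 < x.
  by rewrite /F/= in_itv/= => /andP[+ _]; apply: lt_le_trans; rewrite divr_gt0.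
have IF N : (\int[leb]_(x in F N) (x `^ (theta - 1))%:E <= (theta^-1 * T `^ theta)%:E)%E.
  have TN : T / N.+2%:R < T by rewrite ltr_pdivrMr// ltr_pMr// ltr1n.
  have a0 : 0 < T / N.+2%:R by rewrite divr_gt0.
  have dF (x : R) : 0 < x -> is_derive x 1 (fun x => theta^-1 * x `^ theta) (x `^ (theta - 1)).
    move=> x0; have Hd := is_deriveZ theta^-1 (is_derive1_powR theta x0).
    rewrite (_ : x `^ (theta - 1) = theta^-1 *: (theta * x `^ (theta - 1))); first exact: Hd.
    by rewrite /GRing.scale/= mulrA mulVf ?mul1r// gt_eqF.
  have cP (p x : R) : 0 < x -> {for x, continuous (fun y : R => y `^ p)}.
    move=> x0; apply: differentiable_continuous; apply/derivable1_diffP.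
    by apply: derivable_powR; rewrite in_itv/= x0.
  have cF (x : R) : 0 < x -> {for x, continuous (fun x => theta^-1 * x `^ theta)}.
    move=> x0; apply: differentiable_continuous; apply/derivable1_diffP.
    by have [] := dF x x0.
  rewrite (@continuous_FTC2 _ _ (fun x => theta^-1 * x `^ theta) _ _ TN).
  - by rewrite -EFinB lee_fin gerBl mulr_ge0 ?invr_ge0 ?powR_ge0// ltW.
  - apply: continuous_in_subspaceT => x; rewrite inE => /F0; exact: cP.
  - split.
    + move=> x; rewrite in_itv/= => /andP[ax _].
      by have [] := dF x (lt_trans a0 ax).
    + by apply: cvg_at_right_filter; exact: cF.
    + by apply: cvg_at_left_filter; exact: cF.
  - move=> x; rewrite in_itv/= => /andP[ax _].
    by rewrite derive1E; have [_ ->] := dF x (lt_trans a0 ax).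
apply: (@le_trans _ _ (\int[leb]_(x in \bigcup_N F N) (x `^ (theta - 1))%:E)%E).
  apply: ge0_subset_integral => //.
  - by apply: bigcupT_measurable => k; rewrite /F; exact: measurable_itv.
  - exact: measurable_powRD1.
  - by move=> x _; rewrite lee_fin powR_ge0.
  move=> x/=; rewrite in_itv/= => /andP[x0 xT].
  exists (Num.truncn (T / x)) => //; rewrite /F/= in_itv/= (ltW xT) andbT.
  rewrite ler_pdivrMr// mulrC -ler_pdivrMr// (le_trans (ltW (truncnS_gt _)))//.
  by rewrite ler_nat.
have ndF : nondecreasing_seq F.
  apply/nondecreasing_seqP => N; rewrite subsetEset => x; rewrite /F/= !in_itv/=.
  move=> /andP[+ ->]; rewrite andbT; apply: le_trans.
  by rewrite ler_pM2l// lef_pV2 ?posrE// ler_nat.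
have H : (\int[leb]_(x in F i) (x `^ (theta - 1))%:E)%E @[i --> \oo] -->
    (\int[leb]_(x in \bigcup_i F i) (x `^ (theta - 1))%:E)%E.
  apply: ge0_nondecreasing_set_cvg_integral => //.
  - by move=> i; rewrite /F; exact: measurable_itv.
  - by move=> i; exact: measurable_powRD1.
  - by move=> i x _; rewrite lee_fin powR_ge0.
have /cvg_lim <- // := H.
apply: lime_le; last by apply: nearW => N; exact: IF.
by apply/cvg_ex; eexists; exact: H.
Qed.

(** The bound exp(-lam x) <= e^e (lam x)^(-e) with e = (1 - beta)/2 leaves the singularity
    x^(-beta-e) = x^(e-1), still integrable, and the small factor lam^(-e). *)
Lemma damped_kernel_small (C beta T : R) : 0 <= C -> beta < 1 -> 0 < T ->
  exists2 lam : R, 0 < lam &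
  (\int[leb]_(x in `]0%R, T[) (C * x `^ (- beta) * expR (- (lam * x)))%:E <= (2^-1)%:E)%E.
Proof.
move=> C0 b1 T0; pose e := (1 - beta) / 2.
have e0 : 0 < e by rewrite divr_gt0// subr_gt0.
pose J := e^-1 * T `^ e; have J0 : 0 <= J by rewrite mulr_ge0 ?powR_ge0// invr_ge0 ltW.
pose K := C * e `^ e; have K0 : 0 <= K by rewrite mulr_ge0 ?powR_ge0.
(* With lam^(-e) = 1/D the integral is at most K J / D, which is below 1/2. *)
pose D := 2 * K * J + 1; have D0 : 0 < D by rewrite ltr_wpDl// mulr_ge0// mulr_ge0.
exists (D `^ e^-1); first exact: powR_gt0.
set lam := D `^ _; have l0 : 0 < lam by exact: powR_gt0.
have lE : lam `^ (- e) = D^-1.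
  by rewrite /lam -powRrM mulrN mulVf ?gt_eqF// powR_inv1 ?ltW.
have mP := @measurable_powRD1 (`]0%R, T[) (e - 1).
apply: (@le_trans _ _ (\int[leb]_(x in `]0%R, T[) ((K / D)%:E * (x `^ (e - 1))%:E))%E).
  apply: ge0_le_integral => //.
  - by move=> x _; rewrite lee_fin !mulr_ge0 ?powR_ge0 ?expR_ge0.
  - apply: measurable_funTS; apply/measurable_EFinP; apply: measurable_funM.
      by apply: measurable_funM => //; exact: measurable_powR.
    apply: (measurableT_comp (@measurable_expR R)); apply: measurable_funN.
    exact: measurable_funM.
  - exact: measurable_funeM.
  move=> x /=; rewrite in_itv/= => /andP[x0 _]; rewrite -EFinM lee_fin.
  have -> : x `^ (e - 1) = x `^ (- beta) * x `^ (- e).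
    rewrite -powRD; last by rewrite (gt_eqF x0) implybT.
    by congr (_ `^ _); rewrite /e; field.
  rewrite /K -lE.
  rewrite (_ : _ * (x `^ (- beta) * _) =
    C * x `^ (- beta) * (e `^ e * (lam `^ (- e) * x `^ (- e)))); last by ring.
  rewrite ler_wpM2l ?mulr_ge0 ?powR_ge0//.
  rewrite -powRM ?(ltW l0) ?(ltW x0)// powRN expRN -ler_pdivrMr ?invr_gt0 ?powR_gt0 ?mulr_gt0//.
  rewrite invrK mulrC ler_pdivrMr ?expR_gt0//.
  by apply: powR_le_expR; rewrite // mulr_ge0 ?ltW.
rewrite ge0_integralZl_EFin ?divr_ge0 ?(ltW D0)//; last first.
  by move=> x _; rewrite lee_fin powR_ge0.
apply: le_trans (lee_pmul _ _ (lexx _) (integral_powR_le e0 T0)) _.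
- by rewrite lee_fin divr_ge0// ltW.
- by apply: integral_ge0 => x _; rewrite lee_fin powR_ge0.
rewrite -EFinM lee_fin -/J mulrAC ler_pdivrMr//.
by rewrite /D; lra.
Qed.

End time_kernel.

Section shift.
Context {R : realType}.
Notation leb := (@lebesgue_measure R).

Lemma lebesgue_measure_shift (a : R) (A : set (measurableTypeR R)) : measurable A ->
  pushforward leb ((fun x => x + a) : measurableTypeR R -> measurableTypeR R) A = leb A.
Proof.
move=> mA; apply/esym/lebesgue_measure_unique => //= [|_ _ [[b c]] _ <-]; first exact: measurable_funD.
rewrite /pushforward (_ : _ @^-1` _ = `]b - a, c - a]%classic); last first.
  by apply/seteqP; split => x /=; rewrite !in_itv/= ltrBlDr lerBrDr.
rewrite !lebesgue_measure_itv/= !lte_fin ltrD2r.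
by case: ifP => // _; rewrite -!EFinB; congr (_%:E); ring.
Qed.

Lemma ge0_integral_shift (a : R) (f : R -> \bar R) :
  measurable_fun setT f -> (forall x, 0 <= f x)%E ->
  (\int[leb]_x f (x + a)%R = \int[leb]_x f x)%E.
Proof.
move=> mf f0.
have mD : measurable_fun [set: measurableTypeR R]
    ((fun x => x + a) : measurableTypeR R -> measurableTypeR R).
  exact: measurable_funD.
have := @ge0_integral_pushforward _ _ (measurableTypeR R) (measurableTypeR R) R
  (fun x => x + a) mD leb setT f measurableT mf (fun x _ => f0 x).
rewrite preimage_setT => <-.
by apply: eq_measure_integral => A mA _; exact: lebesgue_measure_shift.
Qed.

End shift.

(** * Lipschitz bound for the power nonlinearity *)

Section nonlinearity.
Context {R : realType}.
Implicit Types a b p : R.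

(** In place of the mean value theorem: (y/x)^p >= 1 + p ln(y/x) >= 1 - p(x/y - 1). The factor y on
    the left cancels 1/y and keeps the estimate true for p < 1, where the power is not Lipschitz at
    0. *)
Lemma powR_lipschitz p (x y : R) : 0 < p -> 0 <= y <= x ->
  y * (x `^ p - y `^ p) <= p * (x `^ p * (x - y)).
Proof.
move=> p0 /andP[]; rewrite le_eqVlt => /predU1P[<-|y0] yx.
  by rewrite mul0r !mulr_ge0 ?powR_ge0 ?(ltW p0)// subr0.
have x0 : 0 < x by exact: lt_le_trans yx.
have yxp : x `^ p * (1 - p * (x / y - 1)) <= y `^ p.
  have -> : y `^ p = x `^ p * (y / x) `^ p.
    by rewrite -powRM ?divr_ge0 ?(ltW x0) ?(ltW y0)// mulrC divfK ?gt_eqF.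
  rewrite ler_wpM2l ?powR_ge0//.
  rewrite /powR gt_eqF ?divr_gt0// (le_trans _ (expR_ge1Dx _))// lerD2l.
  rewrite -mulrN ler_pM2l// lerNl -lnV ?posrE ?divr_gt0// invf_div.
  have := @le_ln1Dx R (x / y - 1); rewrite (_ : 1 + (x / y - 1) = x / y); last by ring.
  apply.
  by rewrite (lt_le_trans (y := 0))// ?oppr_lt0// subr_ge0 ler_pdivlMr// mul1r.
rewrite (@le_trans _ _ (y * (x `^ p - x `^ p * (1 - p * (x / y - 1)))))//.
  by rewrite ler_pM2l// lerD2l lerN2.
by rewrite le_eqVlt; apply/orP; left; apply/eqP; field; rewrite gt_eqF.
Qed.

(** For |b| <= |a| the difference is |a|^p (a - b) + (|a|^p - |b|^p) b, and the previous lemma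
    bounds the second term. With p = alpha - 1 the constant is alpha. *)
Lemma powR_nonlinearity_lipschitz p a b : 0 < p ->
  `| `|a| `^ p * a - `|b| `^ p * b | <= (1 + p) * (`|a| `^ p + `|b| `^ p) * `|a - b|.
Proof.
move=> p0; wlog ba : a b / `|b| <= `|a|.
  move=> H; have [|/ltW] := leP `|b| `|a|; first exact: H.
  by move/H; rewrite distrC [`|b| `^ p + _]addrC [`|b - a|]distrC.
have -> : `|a| `^ p * a - `|b| `^ p * b =
    `|a| `^ p * (a - b) + (`|a| `^ p - `|b| `^ p) * b by ring.
have P0 : 0 <= `|a| `^ p by exact: powR_ge0.
have Pb : `|b| `^ p <= `|a| `^ p by rewrite ge0_ler_powR ?nnegrE// ltW.
rewrite (le_trans (ler_normD _ _))// !normrM [`| _ `^ _ |]ger0_norm//.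
rewrite [`| _ - _ `^ _|]ger0_norm ?subr_ge0//.
have H : (`|a| `^ p - `|b| `^ p) * `|b| <= p * (`|a| `^ p * `|a - b|).
  rewrite mulrC; apply: le_trans (powR_lipschitz p0 _) _; first by rewrite normr_ge0.
  rewrite ler_pM2l// ler_wpM2l//.
  by rewrite lerBlDr (le_trans _ (ler_normD _ _))// subrK.
have Q0 : 0 <= `|b| `^ p * `|a - b| by rewrite mulr_ge0 ?powR_ge0.
rewrite (_ : (1 + p) * _ * _ = `|a| `^ p * `|a - b| + (p * (`|a| `^ p * `|a - b|) +
  (1 + p) * (`|b| `^ p * `|a - b|))); last by ring.
rewrite lerD2l (le_trans H)// lerDl mulr_ge0//.
by rewrite addr_ge0// ltW.
Qed.

Lemma norm_powR_nonlinearity p a : 0 <= p -> `| `|a| `^ p * a | = `|a| `^ (p + 1).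
Proof.
move=> p0; rewrite normrM ger0_norm ?powR_ge0//.
have [->|a0] := eqVneq a 0; first by rewrite normr0 mulr0 powR0// gt_eqF// ltr_wpDl.
by rewrite powRD ?powRr1// normr_eq0 a0 implybT.
Qed.

End nonlinearity.

(** * Space-time measure and the weighted Gronwall argument *)

Section spacetime.
Context {R : realType}.
Notation leb := (@lebesgue_measure R).

(** Bundled as a sigma-finite measure so that Tonelli's theorem applies to pairs of space-time
    points. *)
Definition lebST (n : nat) :
    {sigma_finite_measure set (measurableTypeR R * @Rn R n)%type -> \bar R} :=
  projT1 (cid (sigma_finite_pack (sigma_finite_prod leb (@lebRn R n)))).

Lemma integral_lebST (n : nat) (f : measurableTypeR R * @Rn R n -> \bar R) :
  measurable_fun [set: (measurableTypeR R * @Rn R n)%type] f ->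
  (forall z, 0 <= f z)%E ->
  (\int[lebST n]_z f z = \int[leb]_t \int[lebRn n]_x f (t, x))%E.
Proof.
move=> mf f0; rewrite (projT2 (cid (sigma_finite_pack (sigma_finite_prod leb (@lebRn R n))))).
exact: fubini_tonelli1.
Qed.

Lemma ae_mono d (Y : measurableType d) (m : {measure set Y -> \bar R}) (A B : Y -> Prop) :
  (forall x, A x -> B x) -> {ae m, forall x, A x} -> {ae m, forall x, B x}.
Proof. by move=> AB; apply: negligibleS => x nB Ax; apply: nB; exact: AB. Qed.

Lemma ae_and d (Y : measurableType d) (m : {measure set Y -> \bar R}) (A B : Y -> Prop) :
  {ae m, forall x, A x} -> {ae m, forall x, B x} -> {ae m, forall x, A x /\ B x}.
Proof.
move=> mA mB; apply: negligibleS (negligibleU mA mB) => x /= nAB.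
by apply: contrapT => /not_orP[/contrapT Ax /contrapT Bx]; exact: nAB.
Qed.

Lemma measurable_slice d1 d2 d3 (X1 : measurableType d1) (X2 : measurableType d2)
    (Y : measurableType d3) (f : X1 * X2 -> Y) (x : X1) :
  measurable_fun setT f -> measurable_fun setT (fun y => f (x, y)).
Proof. by move=> mf; apply: (measurableT_comp mf); exact: pair1_measurable. Qed.

End spacetime.

Section gronwall.
Context {R : realType}.
Variable n : nat.
Notation leb := (@lebesgue_measure R).
Notation mu := (@lebRn R n).
Notation X := (measurableTypeR R * @Rn R n)%type.
Notation P := (@lebST R n).

(** In [w] the first point is (t,x), where the solution is observed, and the second is the source
    (tau,y). Extending the kernel by zero off this set turns the nested Duhamel integrals into
    integrals over full spaces, whose order can be exchanged. *)
Definition causal (T : R) (w : X * X) : bool :=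
  [&& 0 < w.2.1, w.2.1 < w.1.1 & w.1.1 < T].

Definition causal_kernel (T : R) (w : X * X) : R :=
  if causal T w then @heat_kernel R n (w.1.1 - w.2.1) ((w.1.2 : 'rV[R]_n) - w.2.2) else 0.

Lemma measurable_causal_kernel (T : R) : measurable_fun setT (causal_kernel T).
Proof.
have m11 : measurable_fun [set: X * X] (fun w : X * X => w.1.1).
  by apply: (measurableT_comp measurable_fst); exact: measurable_fst.
have m21 : measurable_fun [set: X * X] (fun w : X * X => w.2.1).
  by apply: (measurableT_comp measurable_fst); exact: measurable_snd.
apply: measurable_fun_ifT => //.
  apply: measurable_and; first exact: measurable_fun_ltr.
  by apply: measurable_and; exact: measurable_fun_ltr.
apply: measurable_heat_kernel; first exact: measurable_funB.
apply: measurable_subRn.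
  by apply: (measurableT_comp measurable_snd); exact: measurable_fst.
by apply: (measurableT_comp measurable_snd); exact: measurable_snd.
Qed.

Lemma causal_kernel_ge0 (T : R) (w : X * X) : 0 <= causal_kernel T w.
Proof. by rewrite /causal_kernel; case: ifP => // _; exact: heat_kernel_ge0. Qed.

Lemma integral_causal_kernel (T : R) (g : X -> R) (t : R) (x : @Rn R n) :
  measurable_fun [set: X] g -> (forall z, 0 <= g z) -> t < T ->
  (\int[P]_z (causal_kernel T ((t, x), z) * g z)%:E =
   \int[leb]_(tau in `]0%R, t[)
     \int[mu]_y (@heat_kernel R n (t - tau) ((x : 'rV[R]_n) - y) * g (tau, y))%:E)%E.
Proof.
move=> mg g0 tT.
rewrite integral_lebST; last 2 first.
- apply/measurable_EFinP; apply: measurable_funM => //.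
  exact: (measurable_slice _ (measurable_causal_kernel T)).
- by move=> z; rewrite lee_fin mulr_ge0 ?causal_kernel_ge0.
rewrite [RHS]integral_mkcond; apply: eq_integral => tau _; rewrite patchE.
case: ifPn => [/set_mem|/negP H].
  rewrite /= in_itv/= => /andP[tau0 taut]; apply: eq_integral => y _.
  by rewrite /causal_kernel /causal/= tau0 taut tT.
rewrite integral0_eq// => y _; rewrite /causal_kernel /causal/= tT andbT.
case: ifPn => [/andP[a b]|_]; last by rewrite mul0r.
by exfalso; apply: H; apply/mem_set; rewrite /= in_itv/= a b.
Qed.

(** [g] and [V] are independent data, so the statement is linear: the three almost-everywhere
    hypotheses are the smoothing bound, the bound that makes Theta finite, and the inequality to be
    absorbed. *)
Lemma heat_gronwall (g V : X -> R) (C beta B T : R) :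
  0 < T -> 0 <= C -> beta < 1 ->
  measurable_fun [set: X] g -> measurable_fun [set: X] V ->
  (forall z, 0 <= g z) -> (forall z, 0 <= V z) ->
  {ae leb, forall t : R, 0 < t < T -> forall sigma (y : @Rn R n), 0 < sigma <= T ->
    (\int[mu]_x (V (t, x) * expR (- (sigma * @l1 R n x)) *
       @heat_kernel R n (2 * sigma) ((x : 'rV[R]_n) - y))%:E
     <= (C * sigma `^ (- beta))%:E)%E} ->
  {ae leb, forall t : R, 0 < t < T ->
    (\int[mu]_x (g (t, x) * expR (- @l1 R n x))%:E <= B%:E)%E} ->
  {ae leb, forall t : R, 0 < t < T -> {ae mu, forall x,
    ((g (t, x))%:E <= (V (t, x))%:E * \int[leb]_(tau in `]0%R, t[)
     \int[mu]_y (@heat_kernel R n (t - tau) ((x : 'rV[R]_n) - y) * g (tau, y))%:E)%E}} ->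
  {ae leb, forall t : R, 0 < t < T -> {ae mu, forall x, g (t, x) = 0}}.
Proof.
move=> T0 C0 b1 mg mV g0 V0 HV HB HD.
(* The constant of [heat_kernel_weight_sub] for rate 1 + tau and time t - tau, made uniform by
   replacing both times by T. *)
pose c := 2 `^ (n%:R / 2) * expR (n%:R * (2 * T * (1 + T) ^+ 2)).
have c0 : 0 <= c by rewrite mulr_ge0 ?powR_ge0 ?expR_ge0.
have [lam lam0 Hlam] := damped_kernel_small (mulr_ge0 c0 C0) b1 T0.
pose phi (z : X) := expR (- (lam * z.1)) * expR (- ((1 + z.1) * @l1 R n z.2)).
have phi0 z : 0 < phi z by rewrite mulr_gt0 ?expR_gt0.
have mphi : measurable_fun [set: X] phi.
  apply: measurable_funM; apply: (measurableT_comp (@measurable_expR R)).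
    by apply: measurable_funN; apply: measurable_funM => //; exact: measurable_fst.
  apply: measurable_funN; apply: measurable_funM.
    by apply: measurable_funD => //; exact: measurable_fst.
  by apply: (measurableT_comp (@measurable_l1 R n)); exact: measurable_snd.
(* The hypotheses concern 0 < t < T only; the cutoff lets Theta be an integral over all of
   space-time. *)
pose I01 (t : R) : R := \1_(`]0%R, T[%classic) t.
have mI01 : measurable_fun setT I01 by exact: measurable_indic.
have I010 t : 0 <= I01 t by rewrite /I01 indicE.
pose G (z : X) := I01 z.1 * (g z * phi z).
have mG : measurable_fun [set: X] G.
  apply: measurable_funM; last exact: measurable_funM.
  by apply: (measurableT_comp mI01); exact: measurable_fst.
have G0 z : 0 <= G z by rewrite !mulr_ge0// ltW.
have mGE : measurable_fun [set: X] (fun z => (G z)%:E) by exact/measurable_EFinP.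
pose Theta := (\int[P]_z (G z)%:E)%E.
have Theta0 : (0 <= Theta)%E by apply: integral_ge0 => z _; rewrite lee_fin.
pose F (w : X * X) := V w.1 * phi w.1 * causal_kernel T w * g w.2.
have mF : measurable_fun [set: X * X] F.
  apply: measurable_funM; last by apply: (measurableT_comp mg); exact: measurable_snd.
  apply: measurable_funM; last exact: measurable_causal_kernel.
  apply: measurable_funM.
    by apply: (measurableT_comp mV); exact: measurable_fst.
  by apply: (measurableT_comp mphi); exact: measurable_fst.
have F0 w : 0 <= F w by rewrite !mulr_ge0 ?causal_kernel_ge0// ltW.
have mFE : measurable_fun [set: X * X] (fun w => (F w)%:E) by exact/measurable_EFinP.
have FE0 w : (0 <= (F w)%:E)%E by rewrite lee_fin.
have I01in t : 0 < t < T -> I01 t = 1.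
  by move=> tT; rewrite /I01 indicE mem_set//= in_itv.
have I01out t : ~~ (0 < t < T) -> I01 t = 0.
  by move=> tT; rewrite /I01 indicE memNset//= in_itv/=; exact/negP.
have ThetaE : Theta = (\int[leb]_t \int[mu]_x (G (t, x))%:E)%E.
  by rewrite /Theta integral_lebST// => z; rewrite lee_fin.
have mGt t : measurable_fun [set: @Rn R n] (fun x => (G (t, x))%:E).
  exact: (measurable_slice t mGE).
have mGint : measurable_fun [set: measurableTypeR R] (fun t => \int[mu]_x (G (t, x))%:E)%E.
  exact: (measurable_fun_fubini_tonelli_F (fun z => (G z)%:E)).
have Gint0 t : (0 <= \int[mu]_x (G (t, x))%:E)%E.
  by apply: integral_ge0 => x _; rewrite lee_fin.
have Theta_fin : (Theta <= (`|B| * T)%:E)%E.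
  rewrite ThetaE; apply: (@le_trans _ _ (\int[leb]_(t in `]0%R, T[) (`|B|%:E))%E).
    rewrite [leRHS]integral_mkcond; apply: ae_ge0_le_integral => //.
    - by move=> t _; rewrite patchE; case: ifP => // _; rewrite lee_fin.
    - by apply/(measurable_restrictT _ (measurable_itv _)).
    apply: ae_mono HB => t Ht _.
    have [tT|tT] := boolP (0 < t < T); last first.
      rewrite integral0_eq; last by move=> x _; rewrite /G/= I01out// mul0r.
      by rewrite patchE; case: ifP => // _; rewrite lee_fin.
    rewrite patchE mem_set/= ?in_itv//.
    apply: (@le_trans _ _ B%:E); last by rewrite lee_fin ler_norm.
    apply: le_trans (Ht tT); apply: ge0_le_integral => //.
    - by move=> x _; rewrite lee_fin.
    - apply/measurable_EFinP; apply: measurable_funM; first exact: (measurable_slice t mg).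
      apply: (measurableT_comp (@measurable_expR R)); apply: measurable_funN.
      exact: measurable_l1.
    - move=> x _; rewrite lee_fin /G/= I01in// mul1r ler_wpM2l//.
      have /andP[t0 _] := tT.
      rewrite /phi/= -expRD ler_expR mulrDl mul1r.
      have := @l1_ge0 R n x; have : 0 <= lam * t by rewrite mulr_ge0 ?ltW.
      move=> A1 A2; have : 0 <= t * l1 (x : 'rV[R]_n) by rewrite mulr_ge0 ?(ltW t0).
      by move: A1 A2; lra.
  rewrite integral_cst//.
  by rewrite /= lebesgue_measure_itv/= lte_fin T0 oppr0 adde0.
have step2 : (Theta <= \int[P]_z \int[P]_z' (F (z, z'))%:E)%E.
  have mH : measurable_fun [set: X] (fun z => \int[P]_z' (F (z, z'))%:E)%E.
    exact: (measurable_fun_fubini_tonelli_F (fun w => (F w)%:E)).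
  have H0 z : (0 <= \int[P]_z' (F (z, z'))%:E)%E by apply: integral_ge0.
  rewrite ThetaE [leRHS]integral_lebST//.
  apply: ae_ge0_le_integral => //.
  - by move=> t _; apply: integral_ge0.
  - exact: (measurable_fun_fubini_tonelli_F (fun z => \int[P]_z' (F (z, z'))%:E)%E).
  apply: ae_mono HD => t Ht _.
  have [tT|tT] := boolP (0 < t < T); last first.
    rewrite integral0_eq; first exact: integral_ge0.
    by move=> x _; rewrite /G/= I01out// mul0r.
  have /andP[t0 tlT] := tT.
  apply: ae_ge0_le_integral => //.
  - by move=> x _; rewrite lee_fin.
  - exact: (measurable_slice t mH).
  apply: ae_mono (Ht tT) => x Hx _.
  rewrite /F/=.
  under eq_integral do rewrite -mulrA EFinM.
  rewrite ge0_integralZl_EFin//; last 3 first.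
  - by move=> w _; rewrite lee_fin mulr_ge0 ?causal_kernel_ge0.
  - apply/measurable_EFinP; apply: measurable_funM => //.
    exact: (measurable_slice _ (measurable_causal_kernel T)).
  - by rewrite mulr_ge0// ltW.
  rewrite integral_causal_kernel// /G/= I01in// mul1r.
  have -> : ((g (t, x) * phi (t, x))%:E = (phi (t, x))%:E * (g (t, x))%:E)%E.
    by rewrite mulrC EFinM.
  have -> : ((V (t, x) * phi (t, x))%:E = (phi (t, x))%:E * (V (t, x))%:E)%E.
    by rewrite mulrC EFinM.
  by rewrite -muleA lee_pmul// lee_fin// ltW.
(* Since [1 + t = (t - tau) + (1 + tau)], the kernel absorbs the change of weight from
   [(1 + tau)|x|_1] to [(1 + tau)|y|_1] and [exp(-(t - tau)|x|_1)] is left for [V]. *)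
have step4 z' : (\int[P]_z (F (z, z'))%:E <= (2^-1 * G z')%:E)%E.
  have mFz : measurable_fun [set: X] (fun z => (F (z, z'))%:E).
    by apply: (measurableT_comp mFE); exact: pair2_measurable.
  rewrite integral_lebST//.
  have [zT|zT] := boolP (0 < z'.1 < T); last first.
    rewrite integral0_eq; first by rewrite lee_fin mulr_ge0.
    move=> t _; rewrite integral0_eq// => x _.
    rewrite /F /causal_kernel /causal/=; case: ifPn => [/and3P[a b d]|_].
      by case/negP: zT; rewrite a (lt_trans b).
    by rewrite mulr0 mul0r.
  have /andP[z0 zlT] := zT.
  pose h (s : R) := c * C * s `^ (- beta) * expR (- (lam * s)).
  have h0 s : 0 <= h s by rewrite !mulr_ge0 ?powR_ge0 ?expR_ge0.
  have hI0 s : 0 <= I01 s * h s by exact: mulr_ge0.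
  have mh : measurable_fun [set: R] h.
    apply: measurable_funM.
      by apply: measurable_funM => //; exact: measurable_powR.
    apply: (measurableT_comp (@measurable_expR R)); apply: measurable_funN.
    exact: measurable_funM.
  have mhI : measurable_fun [set: R] (fun s => (I01 s * h s)%:E).
    by apply/measurable_EFinP; exact: measurable_funM.
  have GE : G z' = g z' * phi z' by rewrite /G I01in// mul1r.
  apply: (@le_trans _ _ (\int[leb]_t ((G z')%:E * (I01 (t - z'.1) * h (t - z'.1))%:E))%E).
    have mhs : measurable_fun [set: measurableTypeR R]
        (fun t : measurableTypeR R => (I01 (t - z'.1) * h (t - z'.1))%:E).
      by apply: (measurableT_comp mhI); exact: measurable_funB.
    apply: ae_ge0_le_integral => //.
    - by move=> t _; apply: integral_ge0.
    - exact: (measurable_fun_fubini_tonelli_F (fun z => (F (z, z'))%:E)).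
    - by move=> t _; rewrite mule_ge0// lee_fin.
    - exact: measurable_funeM.
    apply: ae_mono HV => t Ht _.
    have [/andP[tz tT]|tT] := boolP (z'.1 < t < T); last first.
      rewrite integral0_eq; first by rewrite mule_ge0// lee_fin.
      move=> x _; rewrite /F /causal_kernel /causal/=.
      by rewrite (negbTE tT) andbF mulr0 mul0r.
    have s0 : 0 < t - z'.1 by rewrite subr_gt0.
    have sT : t - z'.1 < T by rewrite ltrBlDr (lt_trans tT)// ltrDl.
    have tT' : 0 < t < T by rewrite (lt_trans z0).
    rewrite I01in ?s0// mul1r.
    (* All the factors free of x, including the constant c from the transfer of weights. *)
    pose D := g z' * (expR (- (lam * t)) * (c * expR (- ((1 + z'.1) * @l1 R n z'.2)))).
    have D0 : 0 <= D by rewrite !mulr_ge0 ?expR_ge0.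
    pose Q (x : @Rn R n) := V (t, x) * expR (- ((t - z'.1) * @l1 R n x)) *
      @heat_kernel R n (2 * (t - z'.1)) ((x : 'rV[R]_n) - z'.2).
    have Q0 x : 0 <= Q x by rewrite mulr_ge0 ?heat_kernel_ge0// mulr_ge0 ?expR_ge0.
    have mQ : measurable_fun [set: @Rn R n] (fun x => (Q x)%:E).
      apply/measurable_EFinP; apply: measurable_funM; last first.
        by apply: measurable_heat_kernel => //; exact: measurable_subRn.
      apply: measurable_funM; first exact: (measurable_slice t mV).
      apply: (measurableT_comp (@measurable_expR R)); apply: measurable_funN.
      by apply: measurable_funM => //; exact: measurable_l1.
    apply: (@le_trans _ _ (\int[mu]_x (D%:E * (Q x)%:E))%E).
      apply: ge0_le_integral => //.
      - exact: (measurable_slice t mFz).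
      - exact: measurable_funeM.
      move=> x _; rewrite -EFinM lee_fin /F /causal_kernel /causal/= z0 tz tT/=.
      have A0 : 0 <= 1 + z'.1 by rewrite addr_ge0// ltW.
      have Hk := heat_kernel_weight_sub (x : 'rV[R]_n) z'.2 s0 A0.
      have Hc : 2 `^ (n%:R / 2) * expR (n%:R * (2 * (t - z'.1) * (1 + z'.1) ^+ 2)) <= c.
        rewrite /c ler_wpM2l ?powR_ge0// ler_expR ler_wpM2l//.
        rewrite ler_pM ?mulr_ge0 ?(ltW s0) ?exprn_ge0//.
          by rewrite ler_pM2l// ltW.
        by rewrite ler_pXn2r ?nnegrE ?addr_ge0 ?(ltW T0) ?(ltW z0)// lerD2l ltW.
      have {Hc}Hk := le_trans Hk (ler_wpM2r (mulr_ge0 (expR_ge0 _) (heat_kernel_ge0 _ _)) Hc).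
      rewrite /phi/= (_ : (1 + t) * _ =
        (t - z'.1) * l1 (x : 'rV[R]_n) + (1 + z'.1) * l1 (x : 'rV[R]_n)); last by ring.
      rewrite opprD expRD.
      set a := expR (- ((t - z'.1) * _)) in Hk *.
      have a0 : 0 <= V (t, x) * a * g z' * expR (- (lam * t)) by rewrite !mulr_ge0 ?expR_ge0.
      rewrite /D /Q -/a.
      have := ler_wpM2l a0 Hk.
      set b := expR (- ((1 + z'.1) * l1 (x : 'rV[R]_n))).
      set K1 := heat_kernel _ _; set K2 := heat_kernel _ _; set e1 := expR _; set e2 := expR _.
      move=> H; rewrite [leLHS](_ : _ = V (t, x) * a * g z' * e1 * (b * K1)); last by ring.
      rewrite [leRHS](_ : _ = V (t, x) * a * g z' * e1 * (c * (e2 * K2))); last by ring.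
      exact: H.
    rewrite ge0_integralZl_EFin//; last by move=> x _; rewrite lee_fin.
    have sT' : 0 < t - z'.1 <= T by rewrite s0 ltW.
    apply: le_trans (lee_pmul _ _ (lexx _) (Ht tT' (t - z'.1) z'.2 sT')) _.
    - by rewrite lee_fin.
    - by apply: integral_ge0 => x _; rewrite lee_fin; exact: Q0.
    rewrite -!EFinM lee_fin GE /D /h /phi le_eqVlt; apply/orP; left; apply/eqP.
    have -> : expR (- (lam * t)) = expR (- (lam * z'.1)) * expR (- (lam * (t - z'.1))).
      by rewrite -expRD; congr expR; ring.
    by ring.
  rewrite ge0_integralZl_EFin//; last 2 first.
  - by move=> t _; rewrite lee_fin.
  - by apply: (measurableT_comp mhI); exact: measurable_funB.
  (* After translation by tau this is exactly the time integral that [lam] makes at most one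
     half. *)
  rewrite (@ge0_integral_shift _ (- z'.1) (fun s => (I01 s * h s)%:E))//.
  rewrite [leRHS](_ : _ = (G z')%:E * (2^-1)%:E)%E; last by rewrite -EFinM mulrC.
  rewrite lee_pmul//; first by rewrite lee_fin.
    by apply: integral_ge0 => s _; rewrite lee_fin.
  apply: le_trans Hlam; rewrite [leRHS]integral_mkcond le_eqVlt; apply/orP; left; apply/eqP.
  apply: eq_integral => s _; rewrite patchE /I01 indicE.
  by case: (s \in _); rewrite ?mul1r ?mul0r.
have Theta_half : (Theta <= (2^-1)%:E * Theta)%E.
  apply: (le_trans step2); rewrite (fubini_tonelli (fun w => (F w)%:E))//.
  rewrite -ge0_integralZl_EFin//; last by move=> z _; rewrite lee_fin.
  apply: ge0_le_integral => //.
  - by move=> z _; apply: integral_ge0 => w _.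
  - exact: (measurable_fun_fubini_tonelli_G (fun w => (F w)%:E)).
  - exact: measurable_funeM.
have Theta_eq0 : Theta = 0%E.
  (* Finiteness is essential: Theta <= Theta/2 alone would allow +oo. *)
  have Tf : Theta \is a fin_num by rewrite ge0_fin_numE// (le_lt_trans Theta_fin)// ltry.
  move: Theta_half Theta0; rewrite -(fineK Tf) -EFinM !lee_fin => H1 H2.
  by congr (_%:E); lra.
(* A nonnegative function with zero integral vanishes almost everywhere. This is used in t, and
   again in x at almost every t, where the weight is positive and the cutoff is 1. *)
have /ae_eq_integral_abs Hae : (\int[leb]_t `|\int[mu]_x (G (t, x))%:E| = 0)%E.
  rewrite -[RHS]Theta_eq0 ThetaE; apply: eq_integral => t _.
  by rewrite gee0_abs.
apply: ae_mono (Hae measurableT mGint) => t /(_ I) Ht tT.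
have /ae_eq_integral_abs Haex : (\int[mu]_x `|(G (t, x))%:E| = 0)%E.
  rewrite -[RHS]Ht; apply: eq_integral => x _.
  by rewrite gee0_abs// lee_fin.
apply: ae_mono (Haex measurableT (mGt t)) => x /(_ I) [] /eqP.
by rewrite /G/= I01in// mul1r mulf_eq0 [phi _ == 0]gt_eqF ?orbF// => /eqP.
Qed.

End gronwall.

(** * Lower integrals and measurability of open sets *)

Section lower_integral.
Context {R : realType}.
Notation leb := (@lebesgue_measure R).
Import HBNNSimple.

(** The integral of a nonnegative function is a supremum over simple functions below it, so it is
    monotone on arbitrary functions. *)
Lemma le_lower_integral d (X : measurableType d) (m : {measure set X -> \bar R})
    (f g : X -> \bar R) :
  (forall x, 0 <= f x)%E -> (forall x, f x <= g x)%E ->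
  (\int[m]_x f x <= \int[m]_x g x)%E.
Proof.
move=> f0 fg; have g0 x : (0 <= g x)%E by exact: le_trans (fg x).
rewrite !ge0_integralTE//; apply: le_ereal_sup => _ [h hf <-].
by exists h => // x; exact: le_trans (fg x).
Qed.

(** A simple function below c f, divided by c, lies below f. One inequality is enough: it passes
    through iterated integrals by monotonicity, and the factor 1/c returns the converse. *)
Lemma lower_integralZl_le d (X : measurableType d) (m : {measure set X -> \bar R})
    (f : X -> \bar R) (c : R) : 0 < c -> (forall x, 0 <= f x)%E ->
  (\int[m]_x (c%:E * f x) <= c%:E * \int[m]_x f x)%E.
Proof.
move=> c0 f0; have cf0 x : (0 <= c%:E * f x)%E by rewrite mule_ge0// lee_fin ltW.
rewrite [leLHS]ge0_integralTE// [in leRHS]ge0_integralTE//.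
apply: ge_ereal_sup => _ [h hf <-].
have ci0 : 0 <= c^-1 by rewrite invr_ge0 ltW.
pose h' := scale_nnsfun h ci0.
have -> : sintegral m h = (c%:E * sintegral m h')%E.
  rewrite -sintegralrM; apply: eq_sintegral => x.
  by rewrite /h'/= mulrA divff ?mul1r// gt_eqF.
rewrite lee_wpmul2l ?lee_fin ?(ltW c0)//.
apply: ereal_sup_ubound; exists h' => // x.
by rewrite /h'/= EFinM lee_pdivrMl//; exact: hf.
Qed.

Lemma le_iint (k : nat) (f g : seq R -> \bar R) :
  (forall s, 0 <= f s)%E -> (forall s, f s <= g s)%E ->
  (0 <= iint k f)%E /\ (iint k f <= iint k g)%E.
Proof.
elim: k f g => [|k IH] f g f0 fg /=; first by split.
split; first by apply: integral_ge0 => x _; exact: (IH _ (fun s => f (x :: s)) _ _).1.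
by apply: le_lower_integral => x; have [] := IH (fun s => f (x :: s)) (fun s => g (x :: s))
  (fun s => f0 _) (fun s => fg _).
Qed.

Lemma iintZl_le (k : nat) (f : seq R -> \bar R) (c : R) : 0 < c -> (forall s, 0 <= f s)%E ->
  (iint k (fun s => c%:E * f s) <= c%:E * iint k f)%E.
Proof.
move=> c0; elim: k f => [|k IH] f f0 //=.
have i0 (x : R) : (0 <= iint k (fun s => f (x :: s)))%E.
  by have [] := @le_iint k (fun s => f (x :: s)) _ (fun s => f0 _) (fun s => lexx _).
apply: le_trans (lower_integralZl_le leb c0 i0).
apply: le_lower_integral => x; last exact: IH.
by have [] := @le_iint k (fun s => c%:E * f (x :: s))%E _
  (fun s => mule_ge0 (ltW c0 : (0 <= c%:E)%E) (f0 _)) (fun s => lexx _).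
Qed.

Lemma le_lebint (n : nat) (f g : 'rV[R]_n -> \bar R) :
  (forall x, 0 <= f x)%E -> (forall x, f x <= g x)%E -> (lebint f <= lebint g)%E.
Proof. by move=> f0 fg; have [] := @le_iint n _ _ (fun s => f0 (vec_of_seq n s)) (fun s => fg _). Qed.

Lemma lebint_ge0 (n : nat) (f : 'rV[R]_n -> \bar R) :
  (forall x, 0 <= f x)%E -> (0 <= lebint f)%E.
Proof. by move=> f0; have [] := @le_iint n _ _ (fun s => f0 (vec_of_seq n s)) (fun s => lexx _). Qed.

Lemma lebintZl (n : nat) (f : 'rV[R]_n -> \bar R) (c : R) : 0 < c -> (forall x, 0 <= f x)%E ->
  (lebint (fun x => c%:E * f x) = c%:E * lebint f)%E.
Proof.
move=> c0 f0; apply/eqP; rewrite eq_le; apply/andP; split.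
  exact: (@iintZl_le n (fun s => f (vec_of_seq n s)) c c0 (fun s => f0 _)).
rewrite -lee_pdivlMl//.
have ci0 : 0 < c^-1 by rewrite invr_gt0.
have cf0 x : (0 <= c%:E * f x)%E by rewrite mule_ge0// lee_fin ltW.
apply: le_trans (@iintZl_le n (fun s => c%:E * f (vec_of_seq n s))%E _ ci0 (fun s => cf0 _)).
apply: (@le_lebint n f (fun x => c^-1%:E * (c%:E * f x))%E) => // x.
by rewrite muleA -EFinM mulVf ?mul1e// gt_eqF.
Qed.

End lower_integral.

Section open_sets.
Context {R : realType}.
Variable n : nat.

(** The sigma-algebra comes from the coordinates, so openness is stated through them: the set is the
    union of the countably many rational cubes that it contains. *)
Lemma measurable_sup_open (S : set (@Rn R n)) :
  (forall x, S x -> exists2 rho : R, 0 < rho &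
    forall x' : @Rn R n, (forall i, `|(x' : 'rV[R]_n) 0 i - (x : 'rV[R]_n) 0 i| < rho) -> S x') ->
  measurable S.
Proof.
move=> openS.
pose cube (p : 'rV[rat]_n * nat) : set (@Rn R n) :=
  [set x | forall i, `|(x : 'rV[R]_n) 0 i - ratr (p.1 0 i)| < p.2.+1%:R^-1].
pose F p : set (@Rn R n) := if pselect (cube p `<=` S) then cube p else set0.
have mcube p : measurable (cube p).
  rewrite (_ : cube p = \bigcap_(i in [set: 'I_n])
      ((fun x : @Rn R n => (x : 'rV[R]_n) 0 i) @^-1` ball (ratr (p.1 0 i) : R) p.2.+1%:R^-1)).
    apply: fin_bigcap_measurable => [|i _]; first exact: finite_finset.
    rewrite -[X in measurable X]setTI; apply: measurable_coord => //.
    exact: measurable_ball.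
  by apply/seteqP; split => x /= H i; [move=> _|]; have := H i;
    rewrite /ball/= distrC// => /(_ I).
suff -> : S = \bigcup_p F p.
  apply: countable_bigcupT_measurable => [|p]; first exact: countableP.
  by rewrite /F; case: pselect => ?; [exact: mcube|exact: measurable0].
apply/seteqP; split => [x Sx|x [p _]]; last by rewrite /F; case: pselect => // pS; exact: pS.
have [rho rho0 HS] := openS x Sx.
(* A cube of radius 1/(m+1) containing x lies within 2/(m+1) < rho of x in every coordinate. *)
pose m := Num.truncn (2 / rho).
have m2 : 2 * m.+1%:R^-1 < rho.
  by rewrite ltr_pdivrMr// -ltr_pdivrMl// mulrC truncnS_gt.
have q i : exists q : rat, `|(x : 'rV[R]_n) 0 i - ratr q| < m.+1%:R^-1.
  have : (x : 'rV[R]_n) 0 i - m.+1%:R^-1 < (x : 'rV[R]_n) 0 i + m.+1%:R^-1.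
    by rewrite ltrD2l gtrN// invr_gt0.
  move=> /rat_in_itvoo[q]; rewrite in_itv/= => /andP[q1 q2]; exists q.
  by rewrite distrC ltr_distl q1 q2.
have /choice[p Hp] := q.
exists (\row_i p i, m) => //; rewrite /F; case: pselect => [_|] /=.
  by move=> i; rewrite mxE.
case=> x' /= x'p; apply: HS => i.
have := x'p i; have := Hp i; rewrite mxE => H1 H2.
rewrite (_ : _ - _ = ((x' : 'rV[R]_n) 0 i - ratr (p i)) - ((x : 'rV[R]_n) 0 i - ratr (p i))).
  by apply: le_lt_trans m2; rewrite mulr_natl mulr2n (le_trans (ler_normB _ _))// lerD// ltW.
by ring.
Qed.

Lemma measurable_usc (f : @Rn R n -> \bar R) :
  (forall x (a : R), (f x < a%:E)%E -> exists2 rho : R, 0 < rho &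
    forall x' : @Rn R n, (forall i, `|(x' : 'rV[R]_n) 0 i - (x : 'rV[R]_n) 0 i| < rho) ->
      (f x' < a%:E)%E) ->
  measurable_fun [set: @Rn R n] f.
Proof.
move=> uscf; apply: (@measurability _ _ (@Rn R n) (\bar R) _ _ _ (ErealGenInftyO.measurableE R)).
move=> _ [_ [a ->] <-]; rewrite setTI; apply: measurable_sup_open => x /=.
by rewrite in_itv/= => /uscf [rho r0 H]; exists rho => // x' /H; rewrite in_itv.
Qed.

End open_sets.

(** * Heat flow of arbitrary initial data *)

Section rough_data.
Context {R : realType}.
Variable n : nat.
Variable f : 'rV[R]_n -> R.
Hypothesis f0 : forall x, 0 <= f x.

(* [f] is not assumed measurable, so [lebint] is only a (homogeneous, monotone) lower
   integral here.  The family is still monotone in [t], and its right limit is upper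
   semicontinuous in [x], hence measurable. *)
Definition gauss_conv (t : R) (x : 'rV[R]_n) : \bar R :=
  lebint (fun y : 'rV[R]_n => (expR (- (enorm (x - y)) ^+ 2 / (4 * t)) * f y)%:E).

Lemma gauss_conv_ge0 (t : R) (x : 'rV[R]_n) : (0 <= gauss_conv t x)%E.
Proof. by apply: lebint_ge0 => y; rewrite lee_fin mulr_ge0 ?expR_ge0. Qed.

Lemma gauss_conv_mono (s t : R) (x : 'rV[R]_n) : 0 < s -> s <= t -> (gauss_conv s x <= gauss_conv t x)%E.
Proof.
move=> s0 st; have t0 : 0 < t by exact: lt_le_trans st.
apply: le_lebint => y; first by rewrite lee_fin mulr_ge0 ?expR_ge0.
rewrite lee_fin ler_wpM2r// ler_expR !mulNr lerN2 ler_wpM2l ?sqr_ge0//.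
by rewrite lef_pV2 ?posrE ?mulr_gt0// ler_pM2l.
Qed.

(** A later time absorbs a shift of the centre. With 1 + eta = t/s, the inequality |x-y|^2 <=
    (1+eta)|x'-y|^2 + (1+1/eta)|x-x'|^2 compares the two Gaussians pointwise in y up to exp(e). *)
Lemma gauss_conv_shift (s t : R) (x : 'rV[R]_n) (e : R) : 0 < s -> s < t -> 0 < e ->
  exists2 rho : R, 0 < rho &
    forall x' : 'rV[R]_n, (forall i, `|x' 0 i - x 0 i| < rho) ->
      (gauss_conv s x' <= (expR e)%:E * gauss_conv t x)%E.
Proof.
move=> s0 st e0; have t0 : 0 < t by exact: lt_trans st.
pose eta := t / s - 1; have eta0 : 0 < eta by rewrite subr_gt0 ltr_pdivlMr// mul1r.
(* K rho^2 bounds the error in the exponent; the summand 1 keeps K positive, and rho <= 1 gives K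
   rho^2 <= K rho <= e. *)
pose K := (1 + eta^-1) * n%:R / (4 * t) + 1.
have K0 : 0 < K.
  by rewrite ltr_wpDl// divr_ge0 ?mulr_ge0 ?addr_ge0 ?invr_ge0 ?(ltW eta0) ?(ltW t0).
pose rho := Num.min 1 (e / K).
have rho0 : 0 < rho by rewrite lt_min ltr01 divr_gt0.
have rho2 : K * rho ^+ 2 <= e.
  rewrite mulrC -ler_pdivlMr// (@le_trans _ _ rho)//; last by rewrite ge_min lexx orbT.
  by rewrite expr2 ler_piMr// ?(ltW rho0)// ge_min lexx.
exists rho => // x' xx'.
rewrite -lebintZl ?expR_gt0//; last by move=> y; rewrite lee_fin mulr_ge0 ?expR_ge0.
apply: le_lebint => y; first by rewrite lee_fin mulr_ge0 ?expR_ge0.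
rewrite -EFinM lee_fin mulrA ler_wpM2r// -expRD ler_expR.
have H : enorm (x - y) ^+ 2 <= (1 + eta) * enorm (x' - y) ^+ 2 + (1 + eta^-1) * (n%:R * rho ^+ 2).
  rewrite !enorm_sqr.
  have -> : n%:R * rho ^+ 2 = \sum_(i < n) rho ^+ 2.
    by rewrite sumr_const card_ord mulr_natl.
  rewrite !mulr_sumr -big_split/=; apply: ler_sum => i _; rewrite !mxE.
  have b2 : (x 0 i - x' 0 i) ^+ 2 <= rho ^+ 2.
    rewrite -real_normK ?num_real// ler_pXn2r ?nnegrE ?(ltW rho0)//.
    by rewrite distrC ltW.
  have eV : 0 < 1 + eta^-1 by rewrite addr_gt0// invr_gt0.
  apply: (@le_trans _ _ ((1 + eta) * (x' 0 i - y 0 i) ^+ 2 +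
      (1 + eta^-1) * (x 0 i - x' 0 i) ^+ 2)).
    rewrite -subr_ge0.
    have -> : (1 + eta) * (x' 0 i - y 0 i) ^+ 2 + (1 + eta^-1) * (x 0 i - x' 0 i) ^+ 2 -
       (x 0 i - y 0 i) ^+ 2 = (eta * (x' 0 i - y 0 i) - (x 0 i - x' 0 i)) ^+ 2 / eta.
      by field; rewrite gt_eqF.
    by rewrite divr_ge0 ?sqr_ge0 ?ltW.
  by rewrite lerD2l ler_pM2l.
have t40 : 0 < 4 * t by rewrite mulr_gt0.
rewrite -subr_ge0 -(pmulr_rge0 _ t40).
have -> : 4 * t * (e + - enorm (x - y) ^+ 2 / (4 * t) - - enorm (x' - y) ^+ 2 / (4 * s)) =
  4 * t * e - enorm (x - y) ^+ 2 + (1 + eta) * enorm (x' - y) ^+ 2.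
  by rewrite /eta; field; rewrite !gt_eqF.
have H2 : (1 + eta^-1) * (n%:R * rho ^+ 2) <= 4 * t * e.
  have r2 : 0 <= rho ^+ 2 by rewrite sqr_ge0.
  rewrite -ler_pdivrMl// (le_trans _ rho2)//.
  rewrite (_ : K * _ = (4 * t)^-1 * ((1 + eta^-1) * (n%:R * rho ^+ 2)) + rho ^+ 2).
    by rewrite lerDl.
  by rewrite /K; ring.
by move: H H2; lra.
Qed.

Definition gauss_conv_right (t : R) (x : 'rV[R]_n) : \bar R :=
  ereal_inf (range (fun k : nat => gauss_conv (t + k.+1%:R^-1) x)).

Lemma gauss_conv_right_ge0 (t : R) (x : 'rV[R]_n) : (0 <= gauss_conv_right t x)%E.
Proof. by apply: le_ereal_inf_tmp => _ [k _ <-]; exact: gauss_conv_ge0. Qed.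

Lemma gauss_conv_le_right (t : R) (x : 'rV[R]_n) : 0 < t -> (gauss_conv t x <= gauss_conv_right t x)%E.
Proof.
move=> t0; apply: le_ereal_inf_tmp => _ [k _ <-]; apply: gauss_conv_mono => //.
by rewrite lerDl.
Qed.

Lemma gauss_conv_right_le (s t : R) (x : 'rV[R]_n) : 0 < s -> s < t ->
  (gauss_conv_right s x <= gauss_conv t x)%E.
Proof.
move=> s0 st; pose k := Num.truncn (t - s)^-1.
have ts : 0 < t - s by rewrite subr_gt0.
apply: ge_ereal_inf; exists (gauss_conv (s + k.+1%:R^-1) x); first by exists k.
apply: gauss_conv_mono; first by rewrite addr_gt0// invr_gt0.
rewrite -lerBrDl -[leRHS]invrK lef_pV2 ?posrE ?invr_gt0// ltW//.
exact: truncnS_gt.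
Qed.

Lemma gauss_conv_right_mono (s t : R) (x : 'rV[R]_n) : 0 < s -> s <= t ->
  (gauss_conv_right s x <= gauss_conv_right t x)%E.
Proof.
move=> s0; rewrite le_eqVlt => /predU1P[->//|st].
apply: le_trans (gauss_conv_right_le x s0 st) _.
by apply: gauss_conv_le_right; exact: lt_trans st.
Qed.

(** A value below [a] at x is witnessed at the time t + 1/(k+1). The slightly earlier time t +
    1/(k+2) leaves room for [gauss_conv_shift], so nearby points stay below [a]. *)
Lemma measurable_gauss_conv_right (t : R) : 0 < t ->
  measurable_fun [set: @Rn R n] (gauss_conv_right t).
Proof.
move=> t0; apply: measurable_usc => x a /ereal_inf_lt[_ [k _ <-]] Hka.
pose t2 := t + k.+1%:R^-1; pose t1 := t + k.+2%:R^-1.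
have t10 : 0 < t1 by rewrite addr_gt0// invr_gt0.
have t12 : t1 < t2 by rewrite ltrD2l ltf_pV2 ?posrE// ltr_nat.
have [e e0 He] : exists2 e : R, 0 < e & ((expR e)%:E * gauss_conv t2 x < a%:E)%E.
  have := gauss_conv_ge0 t2 x; move: Hka; rewrite -/t2.
  case: (gauss_conv t2 x) => [v|//|//]; rewrite lte_fin lee_fin => va v0.
  have [->|vn] := eqVneq v 0.
    by exists 1 => //; rewrite mule0 lte_fin; exact: le_lt_trans va.
  have {}v0 : 0 < v by rewrite lt_neqAle eq_sym vn.
  have a0 : 0 < a by exact: lt_trans va.
  exists (ln (a / v) / 2).
    by rewrite divr_gt0// ln_gt0// ltr_pdivlMr// mul1r.
  rewrite -EFinM lte_fin -ltr_pdivlMr// -[ltRHS]lnK ?posrE ?divr_gt0// ltr_expR.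
  by rewrite ltr_pdivrMr// mulr_natr mulr2n ltrDl ln_gt0// ltr_pdivlMr// mul1r.
have [rho rho0 H] := gauss_conv_shift x t10 t12 e0.
exists rho => // x' /H Hx'; apply: le_lt_trans He; apply: le_trans Hx'.
by apply: ge_ereal_inf; exists (gauss_conv t1 x') => //; exists k.+1.
Qed.

End rough_data.

Section rough_data_ae.
Context {R : realType}.
Variable n : nat.
Notation leb := (@lebesgue_measure R).
Notation mu := (@lebRn R n).

Lemma le_integral_ae_eq d (Y : measurableType d) (m : {measure set Y -> \bar R})
    (a b : Y -> \bar R) :
  measurable_fun setT a -> measurable_fun setT b ->
  (forall x, 0 <= a x)%E -> (forall x, a x <= b x)%E -> (forall x, b x \is a fin_num) ->
  (\int[m]_x b x <= \int[m]_x a x)%E -> (\int[m]_x b x < +oo)%E ->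
  {ae m, forall x, a x = b x}.
Proof.
move=> ma mb a0 ab bf ba boo.
have af x : a x \is a fin_num.
  by rewrite ge0_fin_numE// (le_lt_trans (ab x))// -ge0_fin_numE// (le_trans (a0 x)).
have c0 x : (0 <= b x - a x)%E by rewrite suber_ge0.
have mc : measurable_fun setT (fun x => b x - a x)%E by exact: emeasurable_funB.
have E : (\int[m]_x b x = \int[m]_x a x + \int[m]_x (b x - a x))%E.
  rewrite -ge0_integralD//; apply: eq_integral => x _.
  by rewrite addeC subeK.
have ioo : (\int[m]_x a x)%E \is a fin_num.
  rewrite ge0_fin_numE; last exact: integral_ge0.
  by apply: le_lt_trans boo; exact: ge0_le_integral.
have I0 : (\int[m]_x `|b x - a x| = 0)%E.
  rewrite (eq_integral (fun x => b x - a x)%E); last by move=> x _; rewrite gee0_abs.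
  apply/eqP; rewrite eq_le; apply/andP; split; last exact: integral_ge0.
  by move: ba; rewrite E -[leRHS]adde0 leeD2lE.
have /ae_eq_integral_abs H := I0.
apply: ae_mono (H measurableT mc) => x /(_ I) /eqP.
by rewrite -(fineK (af x)) -(fineK (bf x)) -EFinB eqe subr_eq0 => /eqP ->.
Qed.

Variable f : 'rV[R]_n -> R.
Hypothesis f0 : forall x, 0 <= f x.
Notation gcr := (gauss_conv_right f).

(** A positive weight of finite mass: together with truncation at N it keeps [Phi] finite even where
    the Gaussian integral is infinite. *)
Let w (x : @Rn R n) : R := heat_kernel 1 (x : 'rV[R]_n).
Let trunc (N : nat) (v : \bar R) : \bar R := mine v N%:R%:E.
Let Phi (N : nat) (h : @Rn R n -> \bar R) : \bar R :=
  (\int[mu]_x (trunc N (h x) * (w x)%:E))%E.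

Let w0 x : 0 < w x.
Proof. by rewrite /w /heat_kernel mulr_gt0 ?expR_gt0// powR_gt0// !mulr_gt0// pi_gt0. Qed.

Let mw : measurable_fun setT (fun x => (w x)%:E).
Proof.
apply/measurable_EFinP; apply: measurable_heat_kernel => //; exact: measurable_id.
Qed.

Let trunc_ge0 N v : (0 <= v -> 0 <= trunc N v)%E.
Proof. by move=> v0; rewrite le_min v0 lee_fin ler0n. Qed.

Let trunc_fin N v : (0 <= v)%E -> trunc N v \is a fin_num.
Proof.
move=> v0; rewrite ge0_fin_numE ?trunc_ge0//.
by rewrite (le_lt_trans (y := N%:R%:E)) ?ltry// ge_min lexx orbT.
Qed.

Let trunc_le N v v' : (v <= v' -> trunc N v <= trunc N v')%E.
Proof. by move=> vv; rewrite le_min !ge_min vv lexx orbT. Qed.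

Let mtrunc N (h : @Rn R n -> \bar R) : measurable_fun setT h ->
  measurable_fun setT (fun x => trunc N (h x) * (w x)%:E)%E.
Proof. by move=> mh; apply: emeasurable_funM => //; exact: measurable_mine. Qed.

Let Phi_ge0 N h : (forall x, 0 <= h x)%E -> (0 <= Phi N h)%E.
Proof. by move=> h0; apply: integral_ge0 => x _; rewrite mule_ge0 ?trunc_ge0// lee_fin ltW. Qed.

Let Phi_le N h h' : measurable_fun setT h -> measurable_fun setT h' ->
  (forall x, 0 <= h x)%E -> (forall x, h x <= h' x)%E -> (Phi N h <= Phi N h')%E.
Proof.
move=> mh mh' h0 hh; apply: ge0_le_integral => //.
- by move=> x _; rewrite mule_ge0 ?trunc_ge0// lee_fin ltW.
- exact: mtrunc.
- exact: mtrunc.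
- by move=> x _; rewrite lee_wpmul2r ?trunc_le// lee_fin ltW.
Qed.

Let Phi_lty N h : measurable_fun setT h -> (forall x, 0 <= h x)%E -> (Phi N h < +oo)%E.
Proof.
move=> mh h0; apply: (@le_lt_trans _ _ (N%:R%:E * 1)%E); last by rewrite mule1 ltry.
apply: (@le_trans _ _ (\int[mu]_x (N%:R%:E * (w x)%:E))%E).
  apply: ge0_le_integral => //.
  - by move=> x _; rewrite mule_ge0 ?trunc_ge0// lee_fin ltW.
  - exact: mtrunc.
  - exact: measurable_funeM.
  - move=> x _; apply: lee_wpmul2r; first by rewrite lee_fin ltW.
    by rewrite ge_min lexx orbT.
rewrite ge0_integralZl_EFin//; last by move=> x _; rewrite lee_fin ltW.
rewrite lee_wpmul2l// ?lee_fin//.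
apply: le_trans (@integral_heat_kernel_le1 R n 1 (0 : 'rV[R]_n) ltr01).
rewrite le_eqVlt; apply/orP; left; apply/eqP; apply: eq_integral => x _.
by rewrite /w (subr0 (x : 'rV[R]_n)).
Qed.

Let jump (N : nat) (q : rat) : set R :=
  [set t | [/\ 0 < t, forall s, 0 < s -> s < t -> (Phi N (gcr s) <= (ratr q)%:E)%E &
    ((ratr q)%:E < Phi N (gcr t))%E]].

(** For fixed N and q there is at most one such time: s < t both in the set would give q < Phi(s) <=
    q. *)
Let jump_countable N q : countable (jump N q).
Proof.
have [->|/set0P[t0 jt0]] := eqVneq (jump N q) set0; first exact: countable0.
apply: (@sub_countable _ _ _ [set t0]); last exact: countable1.
apply: subset_card_le => t jt /=.
have key s t' : jump N q s -> jump N q t' -> ~ (s < t').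
  move=> [s0 _ qs] [t'0 Ht _] st; have := lt_le_trans qs (Ht s s0 st).
  by rewrite ltxx.
by case: (ltgtP t t0) => // /key H; exfalso; exact: H.
Qed.

(* The left and right limits in time of [gauss_conv f] agree almost everywhere unless some
   truncated mass [Phi N] jumps at [t], which happens for countably many [t] only. *)
Lemma gauss_conv_ae_measurable :
  {ae leb, forall t : R, 0 < t ->
    exists2 H : @Rn R n -> \bar R, measurable_fun setT H &
      {ae mu, forall x, gauss_conv f t x = H x}}.
Proof.
pose bad := \bigcup_N \bigcup_q jump N q.
have cbad : countable bad.
  apply: bigcup_countable => // N _; apply: bigcup_countable => // q _.
exists bad; split; [exact: countable_measurable|exact: countable_lebesgue_measure0|].
move=> t /= tP; apply: contrapT => tbad; apply: tP => t0.
pose tk (k : nat) := t - t / k.+2%:R.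
have tk0 k : 0 < tk k by rewrite subr_gt0 ltr_pdivrMr// ltr_pMr// ltr1n.
have tkt k : tk k < t by rewrite gtrBl divr_gt0.
(* A tail supremum from index 0 is the supremum over all k, that is, the left limit in time. It is
   measurable, and [gauss_conv f t] lies between it and the right limit. *)
pose H (x : @Rn R n) := esups (fun k => gcr (tk k) x) 0.
have mH : measurable_fun setT H.
  by apply: measurable_fun_esups => k; exact: measurable_gauss_conv_right.
have mg := measurable_gauss_conv_right f0 t0.
have gkH k x : (gcr (tk k) x <= H x)%E by apply: ereal_sup_ubound; exists k.
have H0 x : (0 <= H x)%E by apply: le_trans (gkH 0%N x); exact: gauss_conv_right_ge0.
have Hg x : (H x <= gauss_conv f t x)%E.
  by apply: ge_ereal_sup => _ [k _ <-]; exact: gauss_conv_right_le.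
have gg x : (gauss_conv f t x <= gcr t x)%E by exact: gauss_conv_le_right.
have PhiH N : (Phi N (gcr t) <= Phi N H)%E.
  (* A gap between the two truncated masses would contain a rational, which makes t a jump time. *)
  rewrite leNgt; apply/negP => lt; apply: tbad.
  have F1 : Phi N H \is a fin_num by rewrite ge0_fin_numE ?Phi_ge0// Phi_lty.
  have F2 : Phi N (gcr t) \is a fin_num.
    by rewrite ge0_fin_numE ?Phi_ge0 ?Phi_lty// => x; exact: gauss_conv_right_ge0.
  move: (lt); rewrite -(fineK F1) -(fineK F2) lte_fin => /rat_in_itvoo[q].
  rewrite in_itv/= => /andP[q1 q2].
  exists N => //; exists q => //; split => //.
    move=> s s0 st; apply: (@le_trans _ _ (Phi N H)); last first.
      by rewrite -(fineK F1) lee_fin ltW.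
    pose k := Num.truncn (t / (t - s)).
    have stk : s <= tk k.
      rewrite /tk lerBrDl -lerBrDr ler_pdivrMr// mulrC -ler_pdivrMr ?subr_gt0//.
      rewrite (le_trans (ltW (truncnS_gt _)))// ler_nat//.
    apply: Phi_le => //.
    - exact: measurable_gauss_conv_right.
    - by move=> x; exact: gauss_conv_right_ge0.
    - by move=> x; apply: le_trans (gkH k x); exact: gauss_conv_right_mono.
  by rewrite -(fineK F2) lte_fin.
exists H => //.
have aeN N : {ae mu, forall x, trunc N (H x) = trunc N (gcr t x)}.
  have g0 x : (0 <= gcr t x)%E by exact: gauss_conv_right_ge0.
  apply: ae_mono (le_integral_ae_eq (mtrunc N mH) (mtrunc N mg) _ _ _ (PhiH N)
    (Phi_lty N mg g0)) => x.
  - have wn : (w x)%:E != 0%E by rewrite eqe gt_eqF.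
    have F1 := trunc_fin N (H0 x); have F2 := trunc_fin N (g0 x).
    rewrite -(fineK F1) -(fineK F2) -!EFinM => -[/(mulIf _)]; rewrite gt_eqF// => H1.
    by rewrite H1.
  - by rewrite mule_ge0 ?trunc_ge0// lee_fin ltW.
  - apply: lee_wpmul2r; first by rewrite lee_fin ltW.
    by apply: trunc_le; exact: le_trans (Hg x) (gg x).
  - by rewrite fin_numM// trunc_fin.
have /ae_foralln Hall := aeN.
apply: ae_mono Hall => x Hx.
have Heq : H x = gcr t x.
  apply/eqP; rewrite eq_le (le_trans (Hg x) (gg x))/=.
  rewrite leNgt; apply/negP => lt.
  (* If H x were smaller than the right limit it would be finite, and truncation at an N above it
     would still separate the two. *)
  have [N HN] : exists N : nat, (H x < N%:R%:E)%E.
    have HF : H x \is a fin_num by rewrite ge0_fin_numE// (lt_le_trans lt)// leey.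
    by exists (Num.truncn (fine (H x))).+1; rewrite -{1}(fineK HF) lte_fin truncnS_gt.
  have := Hx N; rewrite /trunc (min_l (ltW HN)) minEle.
  by case: ifP => _ E; [move: lt|move: HN]; rewrite E ltxx.
by apply/eqP; rewrite eq_le Hg Heq gg.
Qed.

End rough_data_ae.

(** * Difference of two Duhamel formulas *)

Section duhamel.
Context {R : realType}.
Variable n : nat.
Notation leb := (@lebesgue_measure R).
Notation mu := (@lebRn R n).
Notation X := (measurableTypeR R * @Rn R n)%type.

(** Vanishing of [lebm] on an arbitrary set is a statement on lower integrals; by monotonicity it
    passes to measurable subsets, where [lebm] is the measure. *)
Lemma lebm0_subset (S : set 'rV[R]_n) (B : set (@Rn R n)) :
  measurable B -> B `<=` S -> lebm S = 0%E -> mu B = 0%E.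
Proof.
move=> mB BS S0; apply/eqP; rewrite eq_le measure_ge0 andbT -S0 -lebmE//.
apply: le_lebint => x; first by rewrite lee_fin indicE.
rewrite lee_fin !indicE; have [/set_mem Bx|//] := boolP (x \in _).
by rewrite (mem_set (BS _ Bx)).
Qed.

Lemma heat_gauss_conv (t : R) (f : 'rV[R]_n -> R) (x : 'rV[R]_n) : 0 < t ->
  heat t f x = (((4 * pi * t) `^ (- (n%:R / 2)))%:E *
      gauss_conv (fun y => Num.max (f y) 0%R) t x -
    ((4 * pi * t) `^ (- (n%:R / 2)))%:E *
      gauss_conv (fun y => Num.max (- f y)%R 0%R) t x)%E.
Proof.
move=> t0; have c0 : 0 < (4 * pi * t) `^ (- (n%:R / 2)).
  by rewrite powR_gt0// !mulr_gt0// pi_gt0.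
have m0 (g : 'rV[R]_n -> R) y : (0 <= (expR (- enorm (x - y) ^+ 2 / (4 * t)) * Num.max (g y) 0%R)%:E)%E.
  by rewrite lee_fin mulr_ge0 ?expR_ge0// le_max lexx orbT.
rewrite /heat /slebint /gauss_conv -!lebintZl//; last exact: (m0 (fun y => - f y)).
have E (g : 'rV[R]_n -> R) : (fun y => (Num.max (heat_kernel t (x - y) * g y) 0%R)%:E) =
    (fun y => ((4 * pi * t) `^ (- (n%:R / 2)))%:E *
      (expR (- enorm (x - y) ^+ 2 / (4 * t)) * Num.max (g y) 0%R)%:E)%E.
  apply/funext => y; rewrite -EFinM mulrA -/(heat_kernel t (x - y)).
  by rewrite maxr_pMr ?heat_kernel_ge0// mulr0.
by under [X in (_ - lebint X)%E]eq_fun do rewrite -mulrN; rewrite !E.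
Qed.

Lemma heat_measurableE (t : R) (f : @Rn R n -> R) (x : @Rn R n) :
  measurable_fun [set: @Rn R n] f ->
  @heat R n t f x =
  (\int[mu]_y (Num.max (heat_kernel t ((x : 'rV[R]_n) - y) * f y) 0)%:E -
   \int[mu]_y (Num.max (- (heat_kernel t ((x : 'rV[R]_n) - y) * f y)) 0)%:E)%E.
Proof.
move=> mf.
have mK : measurable_fun [set: @Rn R n] (fun y => heat_kernel t ((x : 'rV[R]_n) - y) * f y).
  by apply: measurable_funM => //; apply: measurable_heat_kernel => //; exact: measurable_subRn.
rewrite /heat /slebint; congr (_ - _)%E; rewrite lebintE//.
- by apply/measurable_EFinP; exact: measurable_maxr.
- by move=> y; rewrite lee_fin le_max lexx orbT.
- by apply/measurable_EFinP; apply: measurable_maxr => //; exact: measurable_funN.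
- by move=> y; rewrite lee_fin le_max lexx orbT.
Qed.

Lemma measurable_heat_slice (t : R) (N : X -> R) : measurable_fun [set: X] N ->
  measurable_fun [set: X] (fun z => @heat R n (t - z.1) (fun y => N (z.1, y)) z.2).
Proof.
move=> mN.
have -> : (fun z : X => @heat R n (t - z.1) (fun y => N (z.1, y)) z.2) = (fun z : X =>
  (\int[mu]_y (Num.max (heat_kernel (t - z.1) ((z.2 : 'rV[R]_n) - y) * N (z.1, y)) 0)%:E -
   \int[mu]_y (Num.max (- (heat_kernel (t - z.1) ((z.2 : 'rV[R]_n) - y) * N (z.1, y))) 0)%:E)%E).
  apply/funext => z; apply: heat_measurableE; exact: (measurable_slice z.1 mN).
have m1 : measurable_fun [set: X * @Rn R n] (fun w : X * @Rn R n => w.1.1).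
  by apply: (measurableT_comp measurable_fst); exact: measurable_fst.
have m2 : measurable_fun [set: X * @Rn R n] (fun w : X * @Rn R n => w.1.2).
  by apply: (measurableT_comp measurable_snd); exact: measurable_fst.
have mKN : measurable_fun [set: X * @Rn R n] (fun w : X * @Rn R n =>
    heat_kernel (t - w.1.1) ((w.1.2 : 'rV[R]_n) - w.2) * N (w.1.1, w.2)).
  apply: measurable_funM.
    apply: measurable_heat_kernel; first exact: measurable_funB.
    by apply: measurable_subRn.
  by apply: (measurableT_comp mN); exact: measurable_fun_pair.
apply: emeasurable_funB.
  apply: (measurable_fun_fubini_tonelli_F (fun w : X * @Rn R n =>
    (Num.max (heat_kernel (t - w.1.1) ((w.1.2 : 'rV[R]_n) - w.2) * N (w.1.1, w.2)) 0)%:E)).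
    by apply/measurable_EFinP; exact: measurable_maxr.
  by move=> w; rewrite lee_fin le_max lexx orbT.
apply: (measurable_fun_fubini_tonelli_F (fun w : X * @Rn R n =>
    (Num.max (- (heat_kernel (t - w.1.1) ((w.1.2 : 'rV[R]_n) - w.2) * N (w.1.1, w.2))) 0)%:E)).
  by apply/measurable_EFinP; apply: measurable_maxr => //; exact: measurable_funN.
by move=> w; rewrite lee_fin le_max lexx orbT.
Qed.

Lemma measurable_integral_slice (I : set (measurableTypeR R)) (h : X -> \bar R) :
  measurable I -> measurable_fun [set: X] h ->
  measurable_fun [set: @Rn R n] (fun x => \int[leb]_(tau in I) h (tau, x))%E.
Proof.
move=> mI mh.
have -> : (fun x : @Rn R n => \int[leb]_(tau in I) h (tau, x))%E = (fun x =>
  \int[leb]_tau ((h^\+ \_ (I `*` setT)) (tau, x)) -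
  \int[leb]_tau ((h^\- \_ (I `*` setT)) (tau, x)))%E.
  apply/funext => x; rewrite integralE; congr (_ - _)%E; rewrite integral_mkcond;
    apply: eq_integral => tau _; rewrite !patchE; congr (if _ then _ else _);
    by rewrite ?in_setX /= ?in_setT ?andbT ?funeposE ?funenegE.
have mIT : measurable (I `*` [set: @Rn R n]) by exact: measurableX.
have r0 (k : X -> \bar R) z : (forall z, 0 <= k z)%E -> (0 <= (k \_ (I `*` setT)) z)%E.
  by move=> k0; rewrite patchE; case: ifP.
apply: emeasurable_funB.
- apply: (measurable_fun_fubini_tonelli_G (h^\+ \_ (I `*` setT))%E).
    by apply/(measurable_restrictT _ mIT); apply: measurable_funTS; exact: measurable_funepos.
  by move=> z; exact: r0.
apply: (measurable_fun_fubini_tonelli_G (h^\- \_ (I `*` setT))%E).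
  by apply/(measurable_restrictT _ mIT); apply: measurable_funTS; exact: measurable_funeneg.
by move=> z; exact: r0.
Qed.

(** Positive and negative parts are integrated separately, so the comparison is first proved in the
    additive form P1 + Q2 <= P2 + Q1 + K, which involves no subtraction. Finiteness of both heat
    terms then makes the four integrals finite. *)
Lemma heat_difference_le (t : R) (N1 N2 : @Rn R n -> R) (x : @Rn R n) :
  measurable_fun [set: @Rn R n] N1 -> measurable_fun [set: @Rn R n] N2 ->
  @heat R n t N1 x \is a fin_num -> @heat R n t N2 x \is a fin_num ->
  (`|@heat R n t N1 x - @heat R n t N2 x| <=
   \int[mu]_y (heat_kernel t ((x : 'rV[R]_n) - y) * `|N1 y - N2 y|)%:E)%E.
Proof.
move=> mN1 mN2; rewrite !heat_measurableE//.
have mK : measurable_fun [set: @Rn R n] (fun y => heat_kernel t ((x : 'rV[R]_n) - y)).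
  by apply: measurable_heat_kernel => //; exact: measurable_subRn.
have mKN (N : @Rn R n -> R) : measurable_fun [set: @Rn R n] N ->
    measurable_fun [set: @Rn R n] (fun y => (Num.max (heat_kernel t ((x : 'rV[R]_n) - y) * N y) 0)%:E).
  by move=> mN; apply/measurable_EFinP; apply: measurable_maxr => //; exact: measurable_funM.
have mKNn (N : @Rn R n -> R) : measurable_fun [set: @Rn R n] N ->
    measurable_fun [set: @Rn R n] (fun y => (Num.max (- (heat_kernel t ((x : 'rV[R]_n) - y) * N y)) 0)%:E).
  move=> mN; apply/measurable_EFinP; apply: measurable_maxr => //.
  by apply: measurable_funN; exact: measurable_funM.
have mD : measurable_fun [set: @Rn R n] (fun y => (heat_kernel t ((x : 'rV[R]_n) - y) * `|N1 y - N2 y|)%:E).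
  apply/measurable_EFinP; apply: measurable_funM => //.
  apply: (measurableT_comp (@normr_measurable R setT)); exact: measurable_funB.
have max0 (a : R) : (0 <= (Num.max a 0%R)%:E)%E by rewrite lee_fin le_max lexx orbT.
have D0 (y : @Rn R n) : (0 <= (heat_kernel t ((x : 'rV[R]_n) - y) * `|N1 y - N2 y|)%:E)%E.
  by rewrite lee_fin mulr_ge0 ?heat_kernel_ge0.
have key (M1 M2 : @Rn R n -> R) : measurable_fun [set: @Rn R n] M1 -> measurable_fun [set: @Rn R n] M2 ->
    (forall y, `|M1 y - M2 y| = `|N1 y - N2 y|) ->
    (\int[mu]_y (Num.max (heat_kernel t ((x : 'rV[R]_n) - y) * M1 y) 0)%:E +
     \int[mu]_y (Num.max (- (heat_kernel t ((x : 'rV[R]_n) - y) * M2 y)) 0)%:E <=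
     \int[mu]_y (Num.max (heat_kernel t ((x : 'rV[R]_n) - y) * M2 y) 0)%:E +
     \int[mu]_y (Num.max (- (heat_kernel t ((x : 'rV[R]_n) - y) * M1 y)) 0)%:E +
     \int[mu]_y (heat_kernel t ((x : 'rV[R]_n) - y) * `|N1 y - N2 y|)%:E)%E.
  move=> mM1 mM2 EM.
  rewrite -!ge0_integralD//; [|by move=> y _; rewrite adde_ge0|
    by apply: emeasurable_funD; [exact: mKN|exact: mKNn]|exact: mKN|exact: mKNn|
    exact: mKN|exact: mKNn].
  apply: ge0_le_integral => //.
  - by move=> y _; rewrite adde_ge0.
  - by apply: emeasurable_funD; [exact: mKN|exact: mKNn].
  - apply: emeasurable_funD => //.
    by apply: emeasurable_funD; [exact: mKN|exact: mKNn].
  move=> y _; rewrite -!EFinD lee_fin -EM.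
  have K0 := @heat_kernel_ge0 R n t ((x : 'rV[R]_n) - y).
  move: (heat_kernel _ _) K0 => K K0.
  have -> : K * `|M1 y - M2 y| = `|K * M1 y - K * M2 y|.
    by rewrite -mulrBr normrM ger0_norm.
  move: (K * M1 y) (K * M2 y) => a b; have := ler_norm (a - b).
  have := normr_ge0 (a - b); move: `|a - b| => A.
  by case: (leP a 0); case: (leP b 0); case: (leP (- a) 0); case: (leP (- b) 0); lra.
have k1 := key N1 N2 mN1 mN2 (fun=> erefl).
have k2 := key N2 N1 mN2 mN1 (fun y => distrC _ _).
move: k1 k2.
set P1 := (\int[mu]_y (Num.max (_ * N1 y) 0)%:E)%E.
set Q1 := (\int[mu]_y (Num.max (- (_ * N1 y)) 0)%:E)%E.
set P2 := (\int[mu]_y (Num.max (_ * N2 y) 0)%:E)%E.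
set Q2 := (\int[mu]_y (Num.max (- (_ * N2 y)) 0)%:E)%E.
set K := (\int[mu]_y (_ * _)%:E)%E.
have K0 : (0 <= K)%E by exact: integral_ge0.
move=> k1 k2; rewrite fin_numB => /andP[fP1 fQ1]; rewrite fin_numB => /andP[fP2 fQ2].
have [Kf|Koo] := boolP (K \is a fin_num); last first.
  by move: Koo; rewrite ge0_fin_numE// -leNgt leye_eq => /eqP ->; rewrite leey.
move: k1 k2; rewrite -(fineK fP1) -(fineK fP2) -(fineK fQ1) -(fineK fQ2) -(fineK Kf).
rewrite -!EFinB -!EFinD !lee_fin => k1 k2.
by rewrite ler_norml; apply/andP; split; lra.
Qed.

End duhamel.

Section duhamel_difference.
Context {R : realType}.
Variable n : nat.
Notation leb := (@lebesgue_measure R).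
Notation mu := (@lebRn R n).
Notation X := (measurableTypeR R * @Rn R n)%type.
Variables (gamma alpha T : R) (u0 : 'rV[R]_n -> R).

Lemma measurable_nonlin (u : R -> 'rV[R]_n -> R) :
  measurable_fun [set: X] (fun z : X => u z.1 z.2) ->
  measurable_fun [set: X] (fun z : X => nonlin gamma alpha (u z.1) z.2).
Proof.
move=> mu_; rewrite /nonlin; apply: measurable_funM.
  apply: (measurableT_comp (measurable_powR gamma)).
  by apply: (measurableT_comp (@measurable_enorm R n)); exact: measurable_snd.
by apply: measurable_funM => //; exact: measurable_normpow.
Qed.

Definition duhamel_term (u : R -> 'rV[R]_n -> R) (t : R) (x : 'rV[R]_n) : \bar R :=
  (\int[leb]_(tau in `]0%R, t[) heat (t - tau) (nonlin gamma alpha (u tau)) x)%E.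

Lemma measurable_duhamel_term (u : R -> 'rV[R]_n -> R) (t : R) :
  measurable_fun [set: X] (fun z : X => u z.1 z.2) ->
  measurable_fun [set: @Rn R n] (duhamel_term u t).
Proof.
move=> mu_; apply: (measurable_integral_slice
  (h := fun z : X => heat (t - z.1) (nonlin gamma alpha (u z.1)) z.2)) => //.
exact: (measurable_heat_slice t (measurable_nonlin mu_)).
Qed.

Lemma measurable_kernel_integral (t : R) (x : @Rn R n) (h : X -> R) :
  measurable_fun [set: X] h -> (forall z, 0 <= h z) ->
  measurable_fun [set: measurableTypeR R] (fun tau =>
    \int[mu]_y (heat_kernel (t - tau) ((x : 'rV[R]_n) - y) * h (tau, y))%:E)%E.
Proof.
move=> mh h0; apply: (measurable_fun_fubini_tonelli_F (fun w : X =>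
  (heat_kernel (t - w.1) ((x : 'rV[R]_n) - w.2) * h (w.1, w.2))%:E)).
  apply/measurable_EFinP; apply: measurable_funM.
    apply: measurable_heat_kernel; first exact: measurable_funB.
    by apply: measurable_subRn => //; exact: measurable_snd.
  by apply: (measurableT_comp mh); exact: measurable_fun_pair.
by move=> w; rewrite lee_fin mulr_ge0 ?heat_kernel_ge0.
Qed.

(* [u0] need not be measurable, and a set [A] with [lebm A = 0] is a priori only
   null for the lower integral, so the exceptional set is first made measurable. *)
Lemma duhamel_solution_ae (u : R -> 'rV[R]_n -> R) :
  measurable_fun [set: X] (fun z : X => u z.1 z.2) ->
  duhamel_solution gamma alpha T u0 u ->
  {ae leb, forall t : R, 0 < t < T -> {ae mu, forall x,
    (u t x)%:E = (heat t u0 x + duhamel_term u t x)%E}}.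
Proof.
move=> mu_ Hu.
have f0 (g : 'rV[R]_n -> R) x : 0 <= Num.max (g x) 0 by rewrite le_max lexx orbT.
have := ae_and (gauss_conv_ae_measurable (f0 u0))
               (gauss_conv_ae_measurable (f0 (fun y => - u0 y))).
apply: ae_mono => t [Hp Hn] tT; have /andP[t0 _] := tT.
have [H1 mH1 E1] := Hp t0; have [H2 mH2 E2] := Hn t0.
pose c := (4 * pi * t) `^ (- (n%:R / 2)).
pose HH (x : @Rn R n) := (c%:E * H1 x - c%:E * H2 x + duhamel_term u t x)%E.
have mHH : measurable_fun [set: @Rn R n] HH.
  apply: emeasurable_funD; last exact: measurable_duhamel_term.
  by apply: emeasurable_funB; exact: measurable_funeM.
have mut : measurable_fun [set: @Rn R n] (fun x => (u t x)%:E).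
  by apply/measurable_EFinP; exact: (measurable_slice t mu_).
have [N [mN N0 NS]] := ae_and E1 E2.
have HE x : ~ N x -> heat t u0 x = (c%:E * H1 x - c%:E * H2 x)%E.
  move=> Nx; have [e1 e2] : gauss_conv (fun y => Num.max (u0 y) 0) t x = H1 x /\
      gauss_conv (fun y => Num.max (- u0 y) 0) t x = H2 x.
    by apply: contrapT => H; apply: Nx; exact: NS.
  by rewrite heat_gauss_conv// e1 e2.
(* Off [N] the heat term of [u0] equals a measurable function; removing [N] makes the set measurable
   and contained in the exceptional set of the hypothesis. *)
pose B : set (@Rn R n) := [set x | (u t x)%:E != HH x] `\` N.
have mB : measurable B.
  by apply: measurableD => //; rewrite -[X in measurable X]setTI; exact: measurable_neqe.
have B0 : mu B = 0%E.
  by apply: lebm0_subset (Hu t tT) => // x [/eqP xB Nx] /=; rewrite HE.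
exists (B `|` N); split.
- exact: measurableU.
- have : (mu (B `|` N) <= mu B + mu N)%E by exact: measureU2.
  by rewrite B0 N0 add0e measure_le0 => /eqP.
move=> x /= xP; have [Nx|Nx] := pselect (N x); [by right|left; split => //].
by apply/eqP => E; apply: xP; rewrite HE.
Qed.

(** A finite integral has finite positive and negative parts, so each integrand is absolutely
    integrable in tau; hence the heat terms are finite for almost every tau, as [heat_difference_le]
    requires. *)
Lemma duhamel_term_difference (u1 u2 : R -> 'rV[R]_n -> R) (t : R) (x : @Rn R n) :
  measurable_fun [set: X] (fun z : X => u1 z.1 z.2) ->
  measurable_fun [set: X] (fun z : X => u2 z.1 z.2) ->
  duhamel_term u1 t x \is a fin_num -> duhamel_term u2 t x \is a fin_num ->
  (`|duhamel_term u1 t x - duhamel_term u2 t x| <=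
   \int[leb]_(tau in `]0%R, t[) \int[mu]_y (heat_kernel (t - tau) ((x : 'rV[R]_n) - y) *
     `|nonlin gamma alpha (u1 tau) y - nonlin gamma alpha (u2 tau) y|)%:E)%E.
Proof.
move=> mu1 mu2 F1 F2.
have mN1 := measurable_nonlin mu1; have mN2 := measurable_nonlin mu2.
pose h (u : R -> 'rV[R]_n -> R) (tau : measurableTypeR R) := heat (t - tau) (nonlin gamma alpha (u tau)) x.
have mh u : measurable_fun [set: X] (fun z : X => nonlin gamma alpha (u z.1) z.2) ->
    measurable_fun `]0%R, t[%classic (h u).
  move=> mN; apply: measurable_funTS.
  have mH : measurable_fun [set: X] (fun z : X => heat (t - z.1) (nonlin gamma alpha (u z.1)) z.2).
    exact: (measurable_heat_slice t mN).
  exact: (measurableT_comp mH (pair2_measurable x)).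
have mI : measurable (`]0%R, t[%classic : set (measurableTypeR R)) by exact: measurable_itv.
have ih u : measurable_fun `]0%R, t[%classic (h u) -> duhamel_term u t x \is a fin_num ->
    leb.-integrable `]0%R, t[%classic (h u).
  move=> mhu; rewrite fin_num_abs => /abse_integralP H.
  by apply/integrableP; split => //; exact: H.
have i1 := ih u1 (mh u1 mN1) F1; have i2 := ih u2 (mh u2 mN2) F2.
rewrite /duhamel_term -/(h u1) -/(h u2) -integralB//.
have mh12 : measurable_fun `]0%R, t[%classic (h u1 \- h u2)%E.
  by apply: emeasurable_funB; exact: mh.
apply: le_trans (le_abse_integral _ mI mh12) _.
apply: ae_ge0_le_integral => //.
- by apply: measurableT_comp.
- by move=> tau _; apply: integral_ge0 => y _; rewrite lee_fin mulr_ge0 ?heat_kernel_ge0.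
- apply: measurable_funTS; apply: (@measurable_kernel_integral t x (fun z : X =>
    `|nonlin gamma alpha (u1 z.1) z.2 - nonlin gamma alpha (u2 z.1) z.2|)) => //.
  by apply: (measurableT_comp (@normr_measurable R setT)); exact: measurable_funB.
have a1 := integrable_ae mI i1; have a2 := integrable_ae mI i2.
apply: ae_mono (ae_and a1 a2) => tau [b1 b2] tauI.
apply: heat_difference_le; [| |exact: b1|exact: b2].
- exact: (measurable_slice tau mN1).
- exact: (measurable_slice tau mN2).
Qed.

(** A real value of u on the left forces both terms on the right to be finite, so the common heat
    term of [u0] cancels. *)
Lemma duhamel_difference (u1 u2 : R -> 'rV[R]_n -> R) :
  measurable_fun [set: X] (fun z : X => u1 z.1 z.2) ->
  measurable_fun [set: X] (fun z : X => u2 z.1 z.2) ->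
  duhamel_solution gamma alpha T u0 u1 -> duhamel_solution gamma alpha T u0 u2 ->
  {ae leb, forall t : R, 0 < t < T -> {ae mu, forall x,
    (`|u1 t x - u2 t x|%:E <=
     \int[leb]_(tau in `]0%R, t[) \int[mu]_y (heat_kernel (t - tau) ((x : 'rV[R]_n) - y) *
     `|nonlin gamma alpha (u1 tau) y - nonlin gamma alpha (u2 tau) y|)%:E)%E}}.
Proof.
move=> mu1 mu2 d1 d2.
apply: ae_mono (ae_and (duhamel_solution_ae mu1 d1) (duhamel_solution_ae mu2 d2)).
move=> t [H1 H2] tT; apply: ae_mono (ae_and (H1 tT) (H2 tT)) => x [E1 E2].
have F1 : (heat t u0 x + duhamel_term u1 t x)%E \is a fin_num by rewrite -E1.
have F2 : (heat t u0 x + duhamel_term u2 t x)%E \is a fin_num by rewrite -E2.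
move: F1 F2; rewrite fin_numD => /andP[Fh F1]; rewrite fin_numD => /andP[_ F2].
apply: le_trans (duhamel_term_difference mu1 mu2 F1 F2).
move: E1 E2 F1 F2; case: (heat t u0 x) Fh => // h _.
case: (duhamel_term u1 t x) => // a1; case: (duhamel_term u2 t x) => // a2.
rewrite -!EFinD => -[->] [->] _ _.
by rewrite lee_fin opprD addrACA subrr add0r.
Qed.

End duhamel_difference.

(** * Exponents and uniqueness *)

Section uniqueness.
Context {R : realType}.
Variable n : nat.
Notation leb := (@lebesgue_measure R).
Notation mu := (@lebRn R n).
Notation X := (measurableTypeR R * @Rn R n)%type.

(** Write d = s/n + 1/q. The q_c condition is (alpha-1)nd - gamma < 2, and the Q_c condition is
    alpha nd <= n + gamma. The latter gives (alpha-1)nd - gamma <= n - nd, below n when d > 0; when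
    d = 0 the left side is -gamma < n. *)
Lemma hardy_henon_exponents (gamma alpha s : R) (q r : \bar R) :
  (0 < n)%N -> 1 < alpha -> - Num.min 2 n%:R < gamma ->
  (0 < s / n%:R + einv q \/ (s / n%:R + einv q = 0 /\ r = +oo%E)) ->
  (let invqc := (2 + gamma) / (n%:R * (alpha - 1)) in
   let invQc := (n%:R + gamma) / (n%:R * alpha) in
   s / n%:R + einv q < Num.min invqc invQc \/
   (s / n%:R + einv q = invQc /\ invQc < invqc /\ (r <= alpha%:E)%E)) ->
  (alpha - 1) * (s + n%:R * einv q) - gamma < Num.min 2 n%:R /\
  (0 < gamma + n%:R - alpha * (s + n%:R * einv q) \/
   gamma + n%:R - alpha * (s + n%:R * einv q) = 0 /\ (r <= alpha%:E)%E).
Proof.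
move=> n0 a1 gmin dpos; cbv zeta => dlt.
have nR : 0 < n%:R :> R by rewrite ltr0n.
set d := s / n%:R + einv q in dpos dlt *.
have -> : s + n%:R * einv q = n%:R * d by rewrite /d; field; rewrite gt_eqF.
have d0 : 0 <= d by case: dpos => [/ltW//|[-> _]].
have dqc : d < (2 + gamma) / (n%:R * (alpha - 1)) -> (alpha - 1) * (n%:R * d) - gamma < 2.
  by rewrite ltr_pdivlMr ?mulr_gt0 ?subr_gt0// => H; lra.
have an0 : 0 < n%:R * alpha by rewrite mulr_gt0//; lra.
have dQc : d < (n%:R + gamma) / (n%:R * alpha) -> 0 < gamma + n%:R - alpha * (n%:R * d).
  by rewrite ltr_pdivlMr// => H; lra.
have dQe : d = (n%:R + gamma) / (n%:R * alpha) -> gamma + n%:R - alpha * (n%:R * d) = 0.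
  by move=> ->; field; rewrite !gt_eqF//; lra.
have [gn2 gnn] : - gamma < 2 /\ - gamma < n%:R.
  by move: gmin; rewrite ltrNl lt_min => /andP.
have bn : 0 <= gamma + n%:R - alpha * (n%:R * d) -> (alpha - 1) * (n%:R * d) - gamma < n%:R.
  move=> H; case: dpos => [dp|[-> _]]; last by rewrite !mulr0 sub0r.
  have := mulr_gt0 nR dp; lra.
rewrite lt_min; case: dlt => [|[e [lt ra]]].
  rewrite lt_min => /andP[/dqc -> /dQc e0]; split; last by left.
  by apply: bn; exact: ltW.
have E := dQe e; split; last by right.
by apply/andP; split; [apply: dqc; rewrite e|apply: bn; rewrite E].
Qed.

Lemma ge0_le_integral_lincomb (f f1 f2 : @Rn R n -> R) (c K1 K2 : R) :
  measurable_fun [set: @Rn R n] f -> measurable_fun [set: @Rn R n] f1 ->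
  measurable_fun [set: @Rn R n] f2 ->
  (forall x, 0 <= f x) -> (forall x, 0 <= f1 x) -> (forall x, 0 <= f2 x) -> 0 <= c ->
  (forall x, f x <= c * (f1 x + f2 x)) ->
  (\int[mu]_x (f1 x)%:E <= K1%:E)%E -> (\int[mu]_x (f2 x)%:E <= K2%:E)%E ->
  (\int[mu]_x (f x)%:E <= (c * (K1 + K2))%:E)%E.
Proof.
move=> mf mf1 mf2 f0 f10 f20 c0 le_f H1 H2.
apply: (@le_trans _ _ (\int[mu]_x (c%:E * ((f1 x)%:E + (f2 x)%:E)))%E).
  apply: ge0_le_integral => //.
  - by move=> x _; rewrite lee_fin.
  - exact/measurable_EFinP.
  - apply: measurable_funeM; apply: emeasurable_funD; exact/measurable_EFinP.
  - by move=> x _; rewrite -EFinD -EFinM lee_fin.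
rewrite ge0_integralZl_EFin//; last 2 first.
- by move=> x _; rewrite -EFinD lee_fin addr_ge0.
- by apply: emeasurable_funD; exact/measurable_EFinP.
rewrite ge0_integralD//; last 4 first.
- by move=> x _; rewrite lee_fin.
- exact/measurable_EFinP.
- by move=> x _; rewrite lee_fin.
- exact/measurable_EFinP.
by rewrite EFinM EFinD lee_wpmul2l ?lee_fin// leeD.
Qed.

Variables (gamma alpha T : R) (q r : \bar R) (s : R).

(** This is the source of finiteness of Theta. Below the critical exponent the exponential weight
    provides the decay at infinity; at equality the sum over annuli already converges and the weight
    is bounded by 1. *)
Lemma damped_nonlinearity_bounded (M : R) :
  (0 < n)%N -> 1 < alpha -> (alpha%:E <= q)%E -> (0 < r)%E -> 0 <= M ->
  (0 < gamma + n%:R - alpha * (s + n%:R * einv q) \/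
   gamma + n%:R - alpha * (s + n%:R * einv q) = 0 /\ (r <= alpha%:E)%E) ->
  exists C : R, forall f : @Rn R n -> R, measurable_fun [set: @Rn R n] f ->
    (herz_norm s q r f <= M%:E)%E ->
    (\int[mu]_x (enorm x `^ gamma * `|f x| `^ alpha * expR (- l1 x))%:E <= C%:E)%E.
Proof.
move=> n0 a1 aq r0 M0 H.
have a0 : 0 < alpha by lra.
have e1 x : 0 <= expR (- @l1 R n x) <= 1.
  by rewrite expR_ge0 /= -[leRHS]expR0 ler_expR oppr_le0 l1_ge0.
have mw : measurable_fun [set: @Rn R n] (fun x => expR (- l1 x)).
  by apply: (measurableT_comp (@measurable_expR R)); apply: measurable_funN; exact: measurable_l1.
case: H => [e0|[e0 ra]].
  (* Any L above e would do, since the exponential decays faster than every power. *)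
  set e := (X in 0 < X) in e0; pose L := e + 1.
  have L0 : 0 < L by rewrite /L; lra.
  have hL : 0 < e < L by rewrite e0 /L; lra.
  apply: (weighted_integral_bounded (D := L `^ L) n0 r0 M0 a0 aq hL mw e1) => x x0.
  have x1 : 0 < enorm x by rewrite lt_neqAle eq_sym x0 enorm_ge0.
  rewrite powRN ler_pdivlMr ?powR_gt0// expRN mulrC ler_pdivrMr ?expR_gt0//.
  apply: le_trans (powR_le_expR L0 (ltW x1)) _.
  by rewrite ler_wpM2l ?powR_ge0// ler_expR enorm_le_l1.
have [C HC] := critical_integral_bounded n0 r0 ra M0 a0 aq e0.
exists C => f mf Hf; apply: le_trans (HC f mf Hf).
have mF : measurable_fun [set: @Rn R n] (fun x => enorm x `^ gamma * `|f x| `^ alpha).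
  apply: measurable_funM; last exact: measurable_normpow.
  by apply: (measurableT_comp (measurable_powR gamma)); exact: measurable_enorm.
have F0 (x : @Rn R n) : 0 <= enorm x `^ gamma * `|f x| `^ alpha.
  by rewrite mulr_ge0 ?powR_ge0.
apply: ge0_le_integral => //.
- by move=> x _; rewrite lee_fin mulr_ge0 ?F0 ?expR_ge0.
- by apply/measurable_EFinP; apply: measurable_funM.
- exact/measurable_EFinP.
by move=> x _; rewrite lee_fin ler_piMr//; case/andP: (e1 x).
Qed.

Lemma Linf_herz_common_bound (u1 u2 : R -> 'rV[R]_n -> R) :
  in_Linf_herz s q r T u1 -> in_Linf_herz s q r T u2 ->
  exists2 M : R, 0 <= M & {ae leb, forall t : R, 0 < t < T ->
    (herz_norm s q r (u1 t) <= M%:E)%E /\ (herz_norm s q r (u2 t) <= M%:E)%E}.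
Proof.
move=> [_ [M1 H1]] [_ [M2 H2]].
exists (Num.max 0 (Num.max M1 M2)); first by rewrite le_max lexx.
apply: ae_mono (ae_and H1 H2) => t [h1 h2] tT; split.
  by apply: le_trans (h1 tT) _; rewrite lee_fin !le_max lexx !orbT.
by apply: le_trans (h2 tT) _; rewrite lee_fin !le_max lexx !orbT.
Qed.

End uniqueness.

Theorem theorem1p1 (R : realType) (n : nat) (gamma alpha s T : R) (q r : \bar R)
  (u0 : 'rV[R]_n -> R) (u1 u2 : R -> 'rV[R]_n -> R) :
  (1 <= n)%N ->
  1 < alpha ->
  0 < T ->
  - Num.min 2 n%:R < gamma ->
  Num.max 1 (1 + gamma / n%:R) <= alpha ->
  gamma / (alpha - 1) <= s -> s <= n%:R ->
  (alpha%:E <= q)%E ->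
  (0 < r)%E ->
  (0 < s / n%:R + einv q \/ (s / n%:R + einv q = 0 /\ r = +oo%E)) ->
  (s / n%:R + einv q < 1 \/ (s / n%:R + einv q = 1 /\ (r <= 1)%E)) ->
  (let invqc := (2 + gamma) / (n%:R * (alpha - 1)) in
   let invQc := (n%:R + gamma) / (n%:R * alpha) in
   s / n%:R + einv q < Num.min invqc invQc \/
   (s / n%:R + einv q = invQc /\ invQc < invqc /\ (r <= alpha%:E)%E)) ->
  in_Linf_herz s q r T u1 -> in_Linf_herz s q r T u2 ->
  duhamel_solution gamma alpha T u0 u1 -> duhamel_solution gamma alpha T u0 u2 ->
  {ae @lebesgue_measure R, forall t, 0 < t < T ->
     lebm [set x | u1 t x <> u2 t x] = 0%E}.
Proof.
set leb := @lebesgue_measure R; set mu := @lebRn R n.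
pose X : measurableType _ := (measurableTypeR R * @Rn R n)%type.
move=> n0 a1 T0 gmin _ gs _ aq r0 dpos _ dlt h1 h2 d1 d2.
have [bmin eta0] := hardy_henon_exponents n0 a1 gmin dpos dlt.
have mu1 : measurable_fun [set: X] (fun z : X => u1 z.1 z.2) by case: h1.
have mu2 : measurable_fun [set: X] (fun z : X => u2 z.1 z.2) by case: h2.
have [M M0 HM] := Linf_herz_common_bound h1 h2.
have a0 : 0 < alpha - 1 by lra.
have gs' : gamma <= (alpha - 1) * s by move: gs; rewrite ler_pdivrMr// mulrC.
have [C [beta [C0 beta1 HC]]] := potential_bounded T n0 r0 M0 a1 aq gs' bmin.
have [B HB] := damped_nonlinearity_bounded n0 a1 aq r0 M0 eta0.
have mf1 t : measurable_fun [set: @Rn R n] (u1 t) := measurable_slice t mu1.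
have mf2 t : measurable_fun [set: @Rn R n] (u2 t) := measurable_slice t mu2.
have mN1 := @measurable_nonlin R n gamma alpha u1 mu1.
have mN2 := @measurable_nonlin R n gamma alpha u2 mu2.
have menz p : measurable_fun [set: X] (fun z : X => enorm (z.2 : 'rV[R]_n) `^ p).
  apply: (measurableT_comp (measurable_powR p)).
  by apply: (measurableT_comp (@measurable_enorm R n)); exact: measurable_snd.
have men p : measurable_fun [set: @Rn R n] (fun x => enorm (x : 'rV[R]_n) `^ p).
  by apply: (measurableT_comp (measurable_powR p)); exact: measurable_enorm.
pose g (z : X) := `|nonlin gamma alpha (u1 z.1) z.2 - nonlin gamma alpha (u2 z.1) z.2|.
(* The factor alpha is the Lipschitz constant 1 + p at p = alpha - 1. *)
pose V (z : X) := alpha * (enorm z.2 `^ gamma * `|u1 z.1 z.2| `^ (alpha - 1) +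
                           enorm z.2 `^ gamma * `|u2 z.1 z.2| `^ (alpha - 1)).
have mg : measurable_fun [set: X] g.
  by apply: (measurableT_comp (@normr_measurable R setT)); exact: measurable_funB.
have mV : measurable_fun [set: X] V.
  apply: measurable_funM => //.
  by apply: measurable_funD; apply: measurable_funM => //; exact: measurable_normpow.
have g0 z : 0 <= g z by exact: normr_ge0.
have w0 (v : 'rV[R]_n -> R) p (x : 'rV[R]_n) : 0 <= enorm x `^ gamma * `|v x| `^ p.
  by rewrite mulr_ge0 ?powR_ge0.
have V0 z : 0 <= V z by rewrite /V mulr_ge0 ?addr_ge0 ?w0//; lra.
have gE z : g z = enorm z.2 `^ gamma *
    `| `|u1 z.1 z.2| `^ (alpha - 1) * u1 z.1 z.2 - `|u2 z.1 z.2| `^ (alpha - 1) * u2 z.1 z.2|.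
  by rewrite /g /nonlin -mulrBr normrM ger0_norm// powR_ge0.
have gV z : g z <= V z * `|u1 z.1 z.2 - u2 z.1 z.2|.
  rewrite gE /V -mulrDr mulrCA -mulrA ler_wpM2l ?powR_ge0//.
  by have := powR_nonlinearity_lipschitz (u1 z.1 z.2) (u2 z.1 z.2) a0; rewrite (addrC 1 (alpha - 1)) subrK.
have gB z : g z <= 1 * (enorm z.2 `^ gamma * `|u1 z.1 z.2| `^ alpha +
                   enorm z.2 `^ gamma * `|u2 z.1 z.2| `^ alpha).
  rewrite gE mul1r -mulrDr ler_wpM2l ?powR_ge0//; apply: le_trans (ler_normB _ _) _.
  by rewrite !norm_powR_nonlinearity ?subrK// ltW.
have HV : {ae leb, forall t : R, 0 < t < T -> forall sigma (y : @Rn R n), 0 < sigma <= T ->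
    (\int[mu]_x (V (t, x) * expR (- (sigma * @l1 R n x)) *
       @heat_kernel R n (2 * sigma) ((x : 'rV[R]_n) - y))%:E
     <= (alpha * (C + C) * sigma `^ (- beta))%:E)%E}.
  apply: ae_mono HM => t Ht tT sigma y sT; have [H1 H2] := Ht tT.
  have k0 x : 0 <= expR (- (sigma * @l1 R n x)) * heat_kernel (2 * sigma) (x - y).
    by apply: mulr_ge0; [exact: expR_ge0|exact: heat_kernel_ge0].
  have mk : measurable_fun [set: @Rn R n] (fun x : @Rn R n => expR (- (sigma * @l1 R n x)) *
      heat_kernel (2 * sigma) ((x : 'rV[R]_n) - y)).
    apply: measurable_funM.
      apply: (measurableT_comp (@measurable_expR R)); apply: measurable_funN.
      by apply: measurable_funM => //; exact: measurable_l1.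
    by apply: measurable_heat_kernel => //; exact: measurable_subRn.
  have mw (v : 'rV[R]_n -> R) : measurable_fun [set: @Rn R n] (v : @Rn R n -> R) ->
      measurable_fun [set: @Rn R n] (fun x : @Rn R n => enorm (x : 'rV[R]_n) `^ gamma * `|v x| `^ (alpha - 1) *
        expR (- (sigma * @l1 R n x)) * heat_kernel (2 * sigma) ((x : 'rV[R]_n) - y)).
    move=> mv; under eq_fun do rewrite -mulrA; apply: measurable_funM => //.
    by apply: measurable_funM => //; exact: measurable_normpow.
  rewrite -[X in (_ <= X%:E)%E]mulrA (mulrDl C).
  apply: (ge0_le_integral_lincomb _ (mw _ (mf1 t)) (mw _ (mf2 t)) _ _ _ _ _
    (HC _ (mf1 t) H1 _ y sT) (HC _ (mf2 t) H2 _ y sT)).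
  - under eq_fun do rewrite -mulrA; apply: measurable_funM => //; exact: (measurable_slice t mV).
  - by move=> x; rewrite -mulrA mulr_ge0.
  - by move=> x; rewrite -mulrA mulr_ge0.
  - by move=> x; rewrite -mulrA mulr_ge0.
  - lra.
  - by move=> x; rewrite /V /= -!(mulrA _ (expR _)) -mulrA -mulrDl.
have HBd : {ae leb, forall t : R, 0 < t < T ->
    (\int[mu]_x (g (t, x) * expR (- @l1 R n x))%:E <= (1 * (B + B))%:E)%E}.
  apply: ae_mono HM => t Ht tT; have [H1 H2] := Ht tT.
  have me : measurable_fun [set: @Rn R n] (fun x : @Rn R n => expR (- @l1 R n x)).
    apply: (measurableT_comp (@measurable_expR R)); apply: measurable_funN; exact: measurable_l1.
  have mw (v : 'rV[R]_n -> R) : measurable_fun [set: @Rn R n] (v : @Rn R n -> R) ->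
      measurable_fun [set: @Rn R n] (fun x : @Rn R n => enorm (x : 'rV[R]_n) `^ gamma * `|v x| `^ alpha *
        expR (- @l1 R n x)).
    move=> mv; apply: measurable_funM => //.
    by apply: measurable_funM => //; exact: measurable_normpow.
  apply: (ge0_le_integral_lincomb _ (mw _ (mf1 t)) (mw _ (mf2 t)) _ _ _ _ _
    (HB _ (mf1 t) H1) (HB _ (mf2 t) H2)) => //.
  - by apply: measurable_funM => //; exact: (measurable_slice t mg).
  - by move=> x; rewrite mulr_ge0 ?expR_ge0.
  - by move=> x; apply: mulr_ge0; [exact: w0|exact: expR_ge0].
  - by move=> x; apply: mulr_ge0; [exact: w0|exact: expR_ge0].
  - by move=> x; rewrite -mulrDl mulrA ler_wpM2r ?expR_ge0// gB.
have HD := duhamel_difference mu1 mu2 d1 d2.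
have HDg : {ae leb, forall t : R, 0 < t < T -> {ae mu, forall x,
    ((g (t, x))%:E <= (V (t, x))%:E * \int[leb]_(tau in `]0%R, t[)
     \int[mu]_y (@heat_kernel R n (t - tau) ((x : 'rV[R]_n) - y) * g (tau, y))%:E)%E}}.
  apply: ae_mono HD => t Ht tT; apply: ae_mono (Ht tT) => x Hx.
  apply: (@le_trans _ _ ((V (t, x))%:E * `|u1 t x - u2 t x|%:E)%E).
    by rewrite -EFinM lee_fin gV.
  by rewrite lee_wpmul2l ?lee_fin.
have Cge0 : 0 <= alpha * (C + C) by rewrite mulr_ge0 ?addr_ge0//; lra.
have G := heat_gronwall T0 Cge0 beta1 mg mV g0 V0 HV HBd HDg.
apply: ae_mono HD => t Ht tT.
(* Instead of inverting the nonlinearity, vanishing of g is put back into the difference inequality: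
   its right side is 0 for every x, although g(tau) is known to vanish only for almost every tau. *)
have Z : (fun x : @Rn R n => \int[leb]_(tau in `]0%R, t[) \int[mu]_y (heat_kernel (t - tau)
    ((x : 'rV[R]_n) - y) * g (tau, y))%:E)%E = cst 0%E.
  apply/funext => x /=; transitivity (\int[leb]_(tau in `]0%R, t[) (cst 0%E tau))%E; last exact: integral0.
  apply: ae_eq_integral => //.
  - by apply: measurable_funTS; exact: measurable_kernel_integral.
  apply: ae_mono G => tau Gtau; rewrite /= in_itv /= => /andP[tau0 taut].
  have tauT : 0 < tau < T by rewrite tau0 (lt_trans taut)//; case/andP: tT.
  transitivity (\int[mu]_y (cst 0%E y))%E; last exact: integral0.
  apply: ae_eq_integral => //.
  - apply/measurable_EFinP; apply: measurable_funM; last exact: (measurable_slice tau mg).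
    by apply: measurable_heat_kernel => //; exact: measurable_subRn.
  by apply: ae_mono (Gtau tauT) => y gy _ /=; rewrite gy mulr0.
have mD : measurable [set x : @Rn R n | u1 t x != u2 t x].
  rewrite -[X in measurable X]setTI.
  have m1 : measurable_fun [set: @Rn R n] (EFin \o u1 t) by exact/measurable_EFinP.
  have m2 : measurable_fun [set: @Rn R n] (EFin \o u2 t) by exact/measurable_EFinP.
  exact: (measurable_neqe _ m1 m2).
(* Both solutions are measurable, so this set is measurable and [lebm] is its measure. *)
rewrite (_ : [set x | u1 t x <> u2 t x] = [set x : @Rn R n | u1 t x != u2 t x]); last first.
  by apply/seteqP; split => x /= /eqP.
rewrite lebmE//; apply: (measure_negligible mD).
have [N [mN N0 NS]] := Ht tT; exists N; split => // x xD; apply: NS => /= Hx.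
move: (congr1 (@^~ x) Z) Hx => /= -> ; rewrite lee_fin normr_le0 subr_eq0 => /eqP E.
by move: xD; rewrite /= E eqxx.
Qed.
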